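(* Let $k\in\frac12+\mathbb Z$ with $k>\frac52$, let $N\in 4\mathbb N$, let $f\in S_k(\Gamma_0^*(N))$ (i.e. $f$ is a cusp form of weight $k$ for $\Gamma_0(N)$ with $f|_kW_N=f$), and let $a\in[0,2k-\frac92]$. For $z,w\in\mathfrak H$ put $$\Phi_a(z,w)=\sum_{n=0}^{k-5/2}\left[\binom{k-2}{n}(iNz)^n w^{a-n}+\frac{i^k}{N^{1/4}}\binom{k-2}{n+\frac12}(iz)^n(-Nw)^{2k-\frac92-a-n}\right],$$ $$P_a(z)=\int_0^{i\infty}f(w)\Phi_a(z,w)\,dw,\qquad F_a(z)=\int_z^{i\infty}f(w)\Phi_a(z,w)\,dw .$$ Then: (i) For all $z\in\mathfrak H$, $-i^{k-5/2}\,(F_a|_{5/2-k}W_N)(z)+F_a(z)=P_a(z)$. Consequently, if $\chi$ is a character of $\Gamma_0^*(N)$ with $\chi(W_N)=i^{\frac52-k}$, then $P_a|_{5/2-k,\chi}(W_N+1)=0$; in particular, if $4\mid (k-\frac52)$, then $P_a|_{5/2-k}(W_N+1)=0$. (ii) $P_a$ is a polynomial of degree at most $k-\frac52$, and for every $z\in\mathbb C$, $$P_a(z)=i^{a+1}\sum_{n=0}^{k-5/2}\left[\binom{k-2}{n}N^n\Lambda_f(a+1-n)+\binom{k-2}{n+\frac12}N^{2k-a-n-\frac{19}{4}}\,i^{2n-k+\frac12}\,\Lambda_f\!\left(2k-\tfrac72-a-n\right)\right]z^n.$$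
   Context: All complex powers use the principal branch of the logarithm, with $-\pi<\arg z\le\pi$; in particular $i^t=e^{i\pi t/2}$ for real $t$. $\mathfrak H$ is the upper half-plane. For $z,w\in\mathbb C$, $\binom{z}{w}:=\frac{\Gamma(z+1)}{\Gamma(w+1)\Gamma(z-w+1)}$. Half-integral weight action: for odd $d$, $\epsilon_d=1$ if $d\equiv1\pmod 4$ and $\epsilon_d=i$ if $d\equiv 3\pmod 4$; $\left(\frac cd\right)$ is the Kronecker symbol. For $k\in\frac12+\mathbb Z$ and $\gamma=\begin{pmatrix}*&*\\c&d\end{pmatrix}\in\Gamma_0(N)$, $(f|_k\gamma)(z)=\left(\frac cd\right)\epsilon_d^{2k}(cz+d)^{-k}f(\gamma z)$. With $W_N=\begin{pmatrix}0&-1/\sqrt N\\ \sqrt N&0\end{pmatrix}$, $(f|_kW_N)(z)=(-i\sqrt N z)^{-k}f(-1/(Nz))$. $\Gamma_0^*(N)=\langle\Gamma_0(N),W_N\rangle$. $S_k(\Gamma_0^*(N))$ denotes the holomorphic cusp forms $f$ on $\mathfrak H$ with $f|_k\gamma=f$ for all $\gamma\in\Gamma_0(N)$ and $f|_kW_N=f$. Actions extend linearly to the group ring. Integral weight action: for $m\in\mathbb Z$ and $\gamma=\begin{pmatrix}*&*\\c&d\end{pmatrix}\in \mathrm{SL}_2(\mathbb R)$, $(F|_m\gamma)(z)=(cz+d)^{-m}F(\gamma z)$; thus $(F|_{5/2-k}W_N)(z)=(\sqrt N z)^{k-5/2}F(-1/(Nz))$. For a character $\chi$, $F|_{m,\chi}\gamma:=\overline{\chi(\gamma)}\,F|_m\gamma$.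 $L$-series: for $f(z)=\sum_{n\ge1}a_f(n)e^{2\pi i n z}$, $\Lambda_f(s)=\int_0^\infty f(it)t^{s-1}\,dt=(2\pi)^{-s}\Gamma(s)\sum_{n\ge1}a_f(n)n^{-s}$, extended to an entire function. *)

(* Defs.v *)
From Stdlib Require Import Reals ZArith Arith List Bool.
From Coquelicot Require Import Coquelicot.
Import ListNotations.
Open Scope R_scope.

Definition Carg (z : C) : R :=
  let x := Re z in let y := Im z in
  if Rlt_dec 0 x then atan (y / x)
  else if Rlt_dec x 0 then
         (if Rle_dec 0 y then atan (y / x) + PI else atan (y / x) - PI)
  else if Rlt_dec 0 y then PI / 2
  else if Rlt_dec y 0 then - (PI / 2)
  else 0.

Definition Clog (z : C) : C := (ln (Cmod z), Carg z).

Definition Cexp (w : C) : C := (exp (Re w) * cos (Im w), exp (Re w) * sin (Im w)).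

Definition cpow (z w : C) : C :=
  if Req_EM_T (Cmod z) 0 then RtoC 0 else Cexp (Cmult w (Clog z)).

Definition Cpowz (z : C) (n : Z) : C :=
  match n with
  | Z0 => RtoC 1
  | Zpos p => Cpow z (Pos.to_nat p)
  | Zneg p => Cinv (Cpow z (Pos.to_nat p))
  end.

Fixpoint Csum (M : nat) (g : nat -> C) : C :=
  match M with
  | O => g O
  | S M' => Cplus (Csum M' g) (g M)
  end.

Definition CInt0inf (g : R -> C) : C :=
  (RInt_gen (fun t => Re (g t)) (at_right 0) (Rbar_locally p_infty),
   RInt_gen (fun t => Im (g t)) (at_right 0) (Rbar_locally p_infty)).

(* Euler's integral, for x > 0 (all arguments used below are > 0) *)
Definition RGamma (x : R) : R :=
  RInt_gen (fun t => Rpower t (x - 1) * exp (- t)) (at_right 0) (Rbar_locally p_infty).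

Definition binom (z w : R) : R :=
  RGamma (z + 1) / (RGamma (w + 1) * RGamma (z - w + 1)).

Definition primeb (p : nat) : bool :=
  (2 <=? p)%nat && forallb (fun d => negb (Nat.eqb (p mod d) 0)) (seq 2 (p - 2)).

Definition legendre (c : Z) (p : nat) : Z :=
  let r := Z.to_nat (c mod Z.of_nat p)%Z in
  if Nat.eqb r 0 then 0%Z
  else if existsb (fun x => Nat.eqb ((x * x) mod p) r) (seq 1 (p - 1)) then 1%Z
  else (-1)%Z.

(* p-adic valuation of n (fuel = n suffices) *)
Fixpoint vp (fuel p n : nat) : nat :=
  match fuel with
  | O => O
  | S f => if (0 <? n)%nat && Nat.eqb (n mod p) 0 then S (vp f p (n / p)) else O
  end.

Definition jacobi (c : Z) (n : nat) : Z :=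
  fold_right Z.mul 1%Z
    (map (fun p => Z.pow (legendre c p) (Z.of_nat (vp n p n)))
         (filter (fun p => primeb p && Nat.eqb (n mod p) 0) (seq 2 (n - 1)))).

(* Kronecker symbol (c/d) for odd d (the only case used):
   (c/d) = (c/-1)^[d<0] * (c/|d|), with (c/-1) = -1 if c < 0, 1 otherwise *)
Definition kron (c d : Z) : Z :=
  if (d <? 0)%Z then ((if (c <? 0)%Z then (-1)%Z else 1%Z) * jacobi c (Z.to_nat (- d)))%Z
  else jacobi c (Z.to_nat d).

Definition epsd (d : Z) : C := if Z.eqb (d mod 4) 1 then RtoC 1 else Ci.

Definition in_H (z : C) : Prop := 0 < Im z.

Definition Mat : Type := (R * R * R * R)%type.
Definition mk (a b c d : R) : Mat := (a, b, c, d).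
Definition ma (g : Mat) : R := fst (fst (fst g)).
Definition mb (g : Mat) : R := snd (fst (fst g)).
Definition mc (g : Mat) : R := snd (fst g).
Definition md (g : Mat) : R := snd g.
Definition mmul (g h : Mat) : Mat :=
  mk (ma g * ma h + mb g * mc h) (ma g * mb h + mb g * md h)
     (mc g * ma h + md g * mc h) (mc g * mb h + md g * md h).
Definition minv (g : Mat) : Mat := mk (md g) (- mb g) (- mc g) (ma g).
Definition I2 : Mat := mk 1 0 0 1.

Definition moeb (g : Mat) (z : C) : C :=
  Cdiv (Cplus (Cmult (ma g) z) (mb g)) (Cplus (Cmult (mc g) z) (md g)).

Definition WN (N : nat) : Mat := mk 0 (- / sqrt (INR N)) (sqrt (INR N)) 0.

Definition in_Gamma0 (N : nat) (g : Mat) : Prop :=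
  exists a b c d : Z, (a * d - b * c = 1)%Z /\ (Z.of_nat N | c)%Z /\
    g = mk (IZR a) (IZR b) (IZR c) (IZR d).

Inductive in_Gamma0star (N : nat) : Mat -> Prop :=
  | G0s_base : forall g, in_Gamma0 N g -> in_Gamma0star N g
  | G0s_W : in_Gamma0star N (WN N)
  | G0s_mul : forall g h, in_Gamma0star N g -> in_Gamma0star N h ->
                in_Gamma0star N (mmul g h)
  | G0s_inv : forall g, in_Gamma0star N g -> in_Gamma0star N (minv g).

Definition is_character (N : nat) (chi : Mat -> C) : Prop :=
  (forall g h, in_Gamma0star N g -> in_Gamma0star N h ->
     chi (mmul g h) = Cmult (chi g) (chi h)) /\
  (forall g, in_Gamma0star N g -> chi g <> RtoC 0).

Definition slash_int (m : Z) (g : Mat) (F : C -> C) (z : C) : C :=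
  Cmult (Cpowz (Cplus (Cmult (mc g) z) (md g)) (- m)) (F (moeb g z)).

Definition slash_chi (chi : Mat -> C) (m : Z) (g : Mat) (F : C -> C) (z : C) : C :=
  Cmult (Cconj (chi g)) (slash_int m g F z).

Definition slash_half (k : R) (a b c d : Z) (f : C -> C) (z : C) : C :=
  Cmult (Cmult (RtoC (IZR (kron c d))) (cpow (epsd d) (RtoC (2 * k))))
    (Cmult (cpow (Cplus (Cmult (IZR c) z) (IZR d)) (RtoC (- k)))
       (f (moeb (mk (IZR a) (IZR b) (IZR c) (IZR d)) z))).

Definition slash_half_W (k : R) (N : nat) (f : C -> C) (z : C) : C :=
  Cmult (cpow (Cmult (Cmult (Copp Ci) (RtoC (sqrt (INR N)))) z) (RtoC (- k)))
        (f (Copp (Cinv (Cmult (RtoC (INR N)) z)))).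

Definition cusp_form_star (k : R) (N : nat) (f : C -> C) : Prop :=
  (forall z, in_H z -> ex_derive (K := C_AbsRing) (V := C_NormedModule) f z) /\
  (forall a b c d : Z, (a * d - b * c = 1)%Z -> (Z.of_nat N | c)%Z ->
     forall z, in_H z -> slash_half k a b c d f z = f z) /\
  (forall z, in_H z -> slash_half_W k N f z = f z) /\
  (forall a b c d : Z, (a * d - b * c = 1)%Z ->
     forall eps, 0 < eps -> exists Y, forall z, Y < Im z ->
       Cmod (Cmult (cpow (Cplus (Cmult (IZR c) z) (IZR d)) (RtoC (- k)))
                   (f (moeb (mk (IZR a) (IZR b) (IZR c) (IZR d)) z))) < eps).

(* Lambda is the entire continuation of s |-> int_0^oo f(it) t^(s-1) dt:
   entire, and equal to the (convergent) integral for all real s large enough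
   (this determines Lambda uniquely by the identity theorem) *)
Definition is_Lambda (f : C -> C) (Lam : C -> C) : Prop :=
  (forall s, ex_derive (K := C_AbsRing) (V := C_NormedModule) Lam s) /\
  (exists s0 : R, forall s : R, s0 < s ->
     is_RInt_gen (fun t : R => Cmult (f (Cmult Ci (RtoC t))) (RtoC (Rpower t (s - 1))))
       (at_right 0) (Rbar_locally p_infty) (Lam (RtoC s))).

Definition Phi (M N : nat) (a : R) (z w : C) : C :=
  let k := INR M + 5 / 2 in
  Csum M (fun n =>
    Cplus
      (Cmult (Cmult (RtoC (binom (k - 2) (INR n)))
                    (Cpow (Cmult (Cmult Ci (RtoC (INR N))) z) n))
             (cpow w (RtoC (a - INR n))))
      (Cmult (Cmult (Cdiv (cpow Ci (RtoC k)) (RtoC (Rpower (INR N) (1 / 4))))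
                    (Cmult (RtoC (binom (k - 2) (INR n + 1 / 2))) (Cpow (Cmult Ci z) n)))
             (cpow (Cmult (RtoC (- INR N)) w) (RtoC (2 * k - 9 / 2 - a - INR n))))).

Definition Pa (M N : nat) (f : C -> C) (a : R) (z : C) : C :=
  Cmult Ci (CInt0inf (fun t => let w := Cmult Ci (RtoC t) in Cmult (f w) (Phi M N a z w))).

Definition Fa (M N : nat) (f : C -> C) (a : R) (z : C) : C :=
  Cmult Ci (CInt0inf (fun t => let w := Cplus z (Cmult Ci (RtoC t)) in
                               Cmult (f w) (Phi M N a z w))).

(* Main.v *)
(* Write z' = -1/(Nz) and Psi_z(w) = f(w) Phi_a(z,w). Because binom(k-2,n) = binom(k-2,k-5/2-n+1/2), the
   substitution w = -1/(Nu), combined with f|W_N = f, exchanges the two families of terms of Phi_a: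
     (sqrt N z)^(k-5/2) Psi_{z'}(-1/(Nu)) d(-1/(Nu))/du = (-i)^(k-5/2) Psi_z(u).
   Hence (-i)^(k-5/2) times a primitive G of Psi_z and (sqrt N z)^(k-5/2) times a primitive G' of Psi_{z'}
   composed with u |-> -1/(Nu) differ by a constant. As F_a(z) = G(i oo) - G(z) and P_a(z) = G(i oo) - G(0),
   this gives (i). Termwise integration along the imaginary axis gives (ii).

   The primitives come from Goursat's theorem. The integrals converge because f decays faster than any power
   of Im z at i oo (Cauchy's estimate plus periodicity) and, by f|W_N = f, at 0 along the imaginary axis. The
   Mellin integral of f is therefore entire, so by the identity theorem it is Lambda at every real point. *)

Require Import Defs.
From Stdlib Require Import Reals ZArith Arith Lra Lia FunctionalExtensionality.
From Coquelicot Require Import Coquelicot.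
Open Scope R_scope.

(** In general the preimage of the vertical ray above z' = -1/(Nz) under u |-> -1/(Nu) is a circular
    arc, so changing variables in the improper integrals would also demand a contour deformation.
    Primitives avoid it: one primitive on the upper half-plane serves every path, and its value at i
    oo is the common limit along all vertical lines. In (i) the limit at 0 needs no estimate either:
    up to an affine map it is the limit at i oo of the other primitive. The delicate point is the
    branch of each power. On the upper half-plane every principal power that occurs is the
    exponential of a linear expression in one holomorphic logarithm [logH], so an identity between
    products of powers becomes a linear identity between exponents, true exactly or up to 2 pi i.
    The identity theorem is needed because [is_Lambda] ties Lambda to the integral only for large s,
    while (ii) evaluates it at points that may lie outside this range. It is obtained without power
    series: the integrals [cauchy_int] stand for the Taylor coefficients, and division by the
    variable shifts their index. *)

(** * Continuity and derivatives of complex functions and of curves *)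

Definition cts (h : C -> C) (z : C) : Prop :=
  forall eps, 0 < eps -> exists del, 0 < del /\
    forall w, Cmod (w - z) < del -> Cmod (h w - h z) < eps.

Definition hol (h : C -> C) (z d : C) : Prop :=
  forall eps, 0 < eps -> exists del, 0 < del /\
    forall w, Cmod (w - z) < del ->
      Cmod (h w - h z - d * (w - z)) <= eps * Cmod (w - z).

(** Stated on the components, so that real mean value theorems and [RInt] apply directly; [cder_eps]
    gives the equivalent form with moduli. *)
Definition cder (k : R -> C) (t : R) (l : C) : Prop :=
  is_derive (fun s => Re (k s)) t (Re l) /\ is_derive (fun s => Im (k s)) t (Im l).

Definition ccts (k : R -> C) (t : R) : Prop :=
  continuous (fun s => Re (k s)) t /\ continuous (fun s => Im (k s)) t.

Lemma im_le_Cmod (z : C) : Rabs (Im z) <= Cmod z.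
Proof.
  eapply Rle_trans; [ apply Rmax_r | apply Rmax_Cmod ].
Qed.

Lemma Cmod_le_abs (z : C) : Cmod z <= Rabs (Re z) + Rabs (Im z).
Proof.
  replace z with (RtoC (Re z) + Ci * RtoC (Im z))%C at 1.
  - eapply Rle_trans; [ apply Cmod_triangle | ].
    rewrite Cmod_mult, Cmod_Ci, !Cmod_R; lra.
  - destruct z; unfold Ci, RtoC, Cplus, Cmult, Re, Im; simpl; f_equal; ring.
Qed.

Lemma Cmod_sub_sym (z w : C) : Cmod (z - w) = Cmod (w - z).
Proof. rewrite <- Cmod_opp; f_equal; ring. Qed.

Lemma Cmod_tri3 (a b c : C) : Cmod (a + b + c) <= Cmod a + Cmod b + Cmod c.
Proof.
  eapply Rle_trans; [ apply Cmod_triangle | ].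
  apply Rplus_le_compat_r, Cmod_triangle.
Qed.

Lemma Cmod_sub_ge (a b : C) : Cmod a - Cmod b <= Cmod (a - b).
Proof.
  assert (H := Cmod_triangle (a - b) b).
  replace (a - b + b)%C with a in H by ring; lra.
Qed.

Lemma is_derive_eps (f : R -> R) (t l : R) :
  is_derive f t l <->
  (forall eps, 0 < eps -> exists del, 0 < del /\
     forall s, Rabs (s - t) < del -> Rabs (f s - f t - l * (s - t)) <= eps * Rabs (s - t)).
Proof.
  split.
  - intros [_ H] eps He.
    destruct (H t (fun P h => h) (mkposreal eps He)) as [d Hd].
    exists d; split; [ apply cond_pos | intros s Hs ].
    specialize (Hd s Hs); cbv -[Rabs Rle Rplus Rmult Ropp Rminus] in Hd.
    replace (f s - f t - l * (s - t)) with (f s + - f t + - ((s + - t) * l)) by ring.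
    exact Hd.
  - intros H; split; [ apply is_linear_scal_l | ].
    intros x Hx; assert (E := is_filter_lim_locally_unique (V := AbsRing_NormedModule R_AbsRing) _ _ Hx); subst x.
    intros eps; destruct (H eps (cond_pos eps)) as [d [Hd0 Hd]].
    exists (mkposreal d Hd0); intros s Hs; specialize (Hd s Hs).
    cbv -[Rabs Rle Rplus Rmult Ropp Rminus pos].
    replace (f s + - f t + - ((s + - t) * l)) with (f s - f t - l * (s - t)) by ring.
    exact Hd.
Qed.

Lemma cder_eps (k : R -> C) (t : R) (l : C) :
  cder k t l <->
  (forall eps, 0 < eps -> exists del, 0 < del /\
     forall s, Rabs (s - t) < del ->
       Cmod (k s - k t - l * RtoC (s - t)) <= eps * Rabs (s - t)).
Proof.
  assert (HR : forall s, Re (k s - k t - l * RtoC (s - t))%C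
                 = Re (k s) - Re (k t) - Re l * (s - t)).
  { intros s; unfold Re, Cminus, Cplus, Copp, Cmult, RtoC; simpl; ring. }
  assert (HI : forall s, Im (k s - k t - l * RtoC (s - t))%C
                 = Im (k s) - Im (k t) - Im l * (s - t)).
  { intros s; unfold Im, Cminus, Cplus, Copp, Cmult, RtoC; simpl; ring. }
  split.
  - intros [H1 H2] eps He.
    destruct (proj1 (is_derive_eps _ _ _) H1 (eps / 2)) as [d1 [Hd1 K1]]; [ lra | ].
    destruct (proj1 (is_derive_eps _ _ _) H2 (eps / 2)) as [d2 [Hd2 K2]]; [ lra | ].
    exists (Rmin d1 d2); split; [ apply Rmin_pos; auto | intros s Hs ].
    eapply Rle_trans; [ apply Cmod_le_abs | rewrite HR, HI ].
    specialize (K1 s (Rlt_le_trans _ _ _ Hs (Rmin_l _ _))).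
    specialize (K2 s (Rlt_le_trans _ _ _ Hs (Rmin_r _ _))). lra.
  - intros H; split; apply is_derive_eps; intros eps He;
      destruct (H eps He) as [d [Hd K]]; exists d; split; auto; intros s Hs;
      eapply Rle_trans; [ | exact (K s Hs) | | exact (K s Hs) ].
    + rewrite <- HR; apply re_le_Cmod.
    + rewrite <- HI; apply im_le_Cmod.
Qed.

Lemma continuous_eps (f : R -> R) (t : R) :
  continuous f t <->
  (forall eps, 0 < eps -> exists del, 0 < del /\
     forall s, Rabs (s - t) < del -> Rabs (f s - f t) < eps).
Proof.
  split.
  - intros H eps He.
    destruct (proj1 (filterlim_locally _ _) H (mkposreal eps He)) as [d Hd].
    exists d; split; [ apply cond_pos | intros s Hs; exact (Hd s Hs) ].
  - intros H; apply filterlim_locally; intros eps.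
    destruct (H eps (cond_pos eps)) as [d [Hd0 Hd]].
    exists (mkposreal d Hd0); intros s Hs; exact (Hd s Hs).
Qed.

Lemma ccts_eps (k : R -> C) (t : R) :
  ccts k t <->
  (forall eps, 0 < eps -> exists del, 0 < del /\
     forall s, Rabs (s - t) < del -> Cmod (k s - k t) < eps).
Proof.
  split.
  - intros [H1 H2] eps He.
    destruct (proj1 (continuous_eps _ _) H1 (eps / 2)) as [d1 [Hd1 K1]]; [ lra | ].
    destruct (proj1 (continuous_eps _ _) H2 (eps / 2)) as [d2 [Hd2 K2]]; [ lra | ].
    exists (Rmin d1 d2); split; [ apply Rmin_pos; auto | intros s Hs ].
    eapply Rle_lt_trans; [ apply Cmod_le_abs | ].
    specialize (K1 s (Rlt_le_trans _ _ _ Hs (Rmin_l _ _))).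
    specialize (K2 s (Rlt_le_trans _ _ _ Hs (Rmin_r _ _))).
    change (Re (k s - k t)%C) with (Re (k s) - Re (k t)).
    change (Im (k s - k t)%C) with (Im (k s) - Im (k t)). lra.
  - intros H; split; apply continuous_eps; intros eps He;
      destruct (H eps He) as [d [Hd K]]; exists d; split; auto; intros s Hs;
      eapply Rle_lt_trans; [ | exact (K s Hs) | | exact (K s Hs) ].
    + apply (re_le_Cmod (k s - k t)).
    + apply (im_le_Cmod (k s - k t)).
Qed.

Lemma cder_ccts (k : R -> C) (t : R) (l : C) : cder k t l -> ccts k t.
Proof.
  intros [H1 H2]; split; apply (ex_derive_continuous (V := R_NormedModule)); eexists; eassumption.
Qed.

Lemma hol_of_ex_derive (f : C -> C) (z : C) :
  ex_derive (K := C_AbsRing) (V := C_NormedModule) f z -> exists d, hol f z d.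
Proof.
  intros [l [_ H]]; exists l; intros eps He.
  destruct (H z (fun P h => h) (mkposreal eps He)) as [d Hd].
  exists d; split; [ apply cond_pos | intros w Hw ].
  specialize (Hd w Hw); simpl in Hd.
  replace (f w - f z - l * (w - z))%C with (f w - f z - (w - z) * l)%C by ring.
  exact Hd.
Qed.

Lemma hol_cts (h : C -> C) (z d : C) : hol h z d -> cts h z.
Proof.
  intros H eps He. destruct (H 1 Rlt_0_1) as [e [He0 K]].
  assert (HD : 0 < Cmod d + 1) by (assert (Q := Cmod_ge_0 d); lra).
  exists (Rmin e (eps / (Cmod d + 1))); split.
  { apply Rmin_pos; auto; apply Rdiv_lt_0_compat; auto. }
  intros w Hw.
  assert (H1 := Rlt_le_trans _ _ _ Hw (Rmin_l _ _)).
  assert (H2 := Rlt_le_trans _ _ _ Hw (Rmin_r _ _)).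
  specialize (K w H1).
  replace (h w - h z)%C with ((h w - h z - d * (w - z)) + d * (w - z))%C by ring.
  eapply Rle_lt_trans; [ apply Cmod_triangle | rewrite Cmod_mult ].
  apply (Rmult_lt_compat_l (Cmod d + 1)) in H2; auto.
  replace ((Cmod d + 1) * (eps / (Cmod d + 1))) with eps in H2 by (field; lra). lra.
Qed.

Lemma hol_ext_loc (h g : C -> C) (z d : C) (r : R) : 0 < r ->
  (forall w, Cmod (w - z) < r -> h w = g w) -> hol h z d -> hol g z d.
Proof.
  intros Hr E H eps He; destruct (H eps He) as [e [He0 K]].
  exists (Rmin e r); split; [ apply Rmin_pos; auto | intros w Hw ].
  rewrite <- !E; [ apply K; eapply Rlt_le_trans; [ exact Hw | apply Rmin_l ] | | ].
  - replace (z - z)%C with (RtoC 0) by ring. rewrite Cmod_0; auto.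
  - eapply Rlt_le_trans; [ exact Hw | apply Rmin_r ].
Qed.

Lemma hol_const (a z : C) : hol (fun _ => a) z 0.
Proof.
  intros eps He; exists 1; split; [ lra | intros w _ ].
  replace (a - a - 0 * (w - z))%C with (RtoC 0) by ring. rewrite Cmod_0.
  apply Rmult_le_pos; [ lra | apply Cmod_ge_0 ].
Qed.

Lemma hol_id (z : C) : hol (fun w => w) z 1.
Proof.
  intros eps He; exists 1; split; [ lra | intros w _ ].
  replace (w - z - 1 * (w - z))%C with (RtoC 0) by ring. rewrite Cmod_0.
  apply Rmult_le_pos; [ lra | apply Cmod_ge_0 ].
Qed.

Lemma hol_plus (h g : C -> C) (z d e : C) :
  hol h z d -> hol g z e -> hol (fun w => h w + g w)%C z (d + e)%C.
Proof.
  intros H G eps He.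
  destruct (H (eps / 2)) as [e1 [H1 K1]]; [ lra | ].
  destruct (G (eps / 2)) as [e2 [H2 K2]]; [ lra | ].
  exists (Rmin e1 e2); split; [ apply Rmin_pos; auto | intros w Hw ].
  specialize (K1 w (Rlt_le_trans _ _ _ Hw (Rmin_l _ _))).
  specialize (K2 w (Rlt_le_trans _ _ _ Hw (Rmin_r _ _))).
  replace (h w + g w - (h z + g z) - (d + e) * (w - z))%C with
    ((h w - h z - d * (w - z)) + (g w - g z - e * (w - z)))%C by ring.
  eapply Rle_trans; [ apply Cmod_triangle | lra ].
Qed.

Lemma hol_comp (h g : C -> C) (z d e : C) :
  hol g z e -> hol h (g z) d -> hol (fun w => h (g w)) z (d * e)%C.
Proof.
  intros G H eps He.
  assert (P1 := Cmod_ge_0 e). assert (P2 := Cmod_ge_0 d).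
  (* The condition [p <= 1] below gives [g] the Lipschitz constant [Cmod e + 1] near [z], which [q]
     absorbs; the other bound on [p] absorbs the factor [d]. Each of the two remainders receives
     half of [eps]. *)
  set (q := eps / (2 * (Cmod e + 1))).
  assert (Hq : 0 < q) by (apply Rdiv_lt_0_compat; lra).
  destruct (H q Hq) as [e1 [H1 K1]].
  destruct (hol_cts _ _ _ G e1 H1) as [e2 [H2 K2]].
  set (p := Rmin 1 (eps / (2 * (Cmod d + 1)))).
  assert (Hp : 0 < p) by (apply Rmin_pos; [ lra | apply Rdiv_lt_0_compat; lra ]).
  destruct (G p Hp) as [e3 [H3 K3]].
  exists (Rmin e2 e3); split; [ apply Rmin_pos; auto | intros w Hw ].
  specialize (K2 w (Rlt_le_trans _ _ _ Hw (Rmin_l _ _))).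
  specialize (K3 w (Rlt_le_trans _ _ _ Hw (Rmin_r _ _))).
  specialize (K1 (g w) K2).
  assert (Hx := Cmod_ge_0 (w - z)).
  assert (Q1 : p <= 1) by apply Rmin_l.
  assert (Q2 : p <= eps / (2 * (Cmod d + 1))) by apply Rmin_r.
  assert (L : Cmod (g w - g z) <= (Cmod e + 1) * Cmod (w - z)).
  { replace (g w - g z)%C with ((g w - g z - e * (w - z)) + e * (w - z))%C by ring.
    eapply Rle_trans; [ apply Cmod_triangle | rewrite Cmod_mult ]. nra. }
  replace (h (g w) - h (g z) - d * e * (w - z))%C with
    ((h (g w) - h (g z) - d * (g w - g z)) + d * (g w - g z - e * (w - z)))%C by ring.
  eapply Rle_trans; [ apply Cmod_triangle | rewrite Cmod_mult ].
  assert (A1 : q * Cmod (g w - g z) <= eps / 2 * Cmod (w - z)).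
  { eapply Rle_trans; [ apply Rmult_le_compat_l; [ lra | exact L ] | ].
    rewrite <- Rmult_assoc. apply Rmult_le_compat_r; auto.
    right; unfold q; field; lra. }
  assert (A2 : Cmod d * (p * Cmod (w - z)) <= eps / 2 * Cmod (w - z)).
  { rewrite <- Rmult_assoc. apply Rmult_le_compat_r; auto.
    apply Rle_trans with ((Cmod d + 1) * (eps / (2 * (Cmod d + 1)))).
    - apply Rmult_le_compat; lra.
    - right; field; lra. }
  assert (A3 : Cmod d * Cmod (g w - g z - e * (w - z)) <= Cmod d * (p * Cmod (w - z)))
    by (apply Rmult_le_compat_l; auto).
  lra.
Qed.

Lemma hol_sqr (z : C) : hol (fun w => w * w)%C z (2 * z)%C.
Proof.
  intros eps He; exists eps; split; [ lra | intros w Hw ].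
  replace (w * w - z * z - 2 * z * (w - z))%C with ((w - z) * (w - z))%C by ring.
  rewrite Cmod_mult. apply Rmult_le_compat_r; [ apply Cmod_ge_0 | lra ].
Qed.

Lemma hol_scal (a : C) (h : C -> C) (z d : C) : hol h z d -> hol (fun w => a * h w)%C z (a * d)%C.
Proof.
  intros H. refine (hol_comp (fun u => a * u)%C h z a d H _).
  intros eps He; exists 1; split; [ lra | intros w _ ].
  replace (a * w - a * h z - a * (w - h z))%C with (RtoC 0) by ring. rewrite Cmod_0.
  apply Rmult_le_pos; [ lra | apply Cmod_ge_0 ].
Qed.

Lemma hol_eq (h : C -> C) (z d d' : C) : hol h z d -> d = d' -> hol h z d'.
Proof. intros H <-; exact H. Qed.

Lemma hol_minus (h g : C -> C) (z d e : C) :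
  hol h z d -> hol g z e -> hol (fun w => h w - g w)%C z (d - e)%C.
Proof.
  intros H G. apply (hol_ext_loc (fun w => h w + (-1) * g w)%C) with (r := 1); [ lra | intros; ring | ].
  eapply hol_eq; [ apply hol_plus; [ exact H | apply hol_scal; exact G ] | ring ].
Qed.

(* Polarization: [h g = ((h + g)^2 - (h - g)^2) / 4]. *)
Lemma hol_mult (h g : C -> C) (z d e : C) :
  hol h z d -> hol g z e -> hol (fun w => h w * g w)%C z (d * g z + h z * e)%C.
Proof.
  intros H G.
  assert (N4 : RtoC 4 <> 0) by (intros E; apply (f_equal Re) in E; simpl in E; lra).
  apply (hol_ext_loc (fun w => / 4 * ((h w + g w) * (h w + g w) - (h w - g w) * (h w - g w)))%C)
    with (r := 1); [ lra | intros; field; exact N4 | ].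
  eapply hol_eq.
  - apply hol_scal, hol_minus.
    + apply (hol_comp (fun u => u * u)%C (fun w => h w + g w)%C).
      * apply hol_plus; eassumption.
      * apply hol_sqr.
    + apply (hol_comp (fun u => u * u)%C (fun w => h w - g w)%C).
      * apply hol_minus; eassumption.
      * apply hol_sqr.
  - field; exact N4.
Qed.

Lemma hol_inv (z : C) : z <> 0 -> hol Cinv z (- / (z * z))%C.
Proof.
  intros Hz eps He.
  assert (Pz := proj1 (Cmod_gt_0 z) Hz). set (m := Cmod z) in *.
  assert (Hm2 : 0 < m / 2) by lra.
  (* The remainder is (w - z)^2 / (z^2 w). The first radius keeps |w| above m/2, so the quotient to
     be bounded by [eps] is |w - z| / (m^2 |w|), whence the cube in the second radius. *)
  exists (Rmin (m / 2) (eps * (m * m * m) / 2)); split.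
  { apply Rmin_pos; auto. apply Rdiv_lt_0_compat; [ | lra ].
    repeat apply Rmult_lt_0_compat; auto. }
  intros w Hw.
  assert (W1 := Rlt_le_trans _ _ _ Hw (Rmin_l _ _)).
  assert (W2 := Rlt_le_trans _ _ _ Hw (Rmin_r _ _)).
  assert (Hw0 : m / 2 < Cmod w).
  { assert (Q := Cmod_sub_ge z (z - w)). rewrite (Cmod_sub_sym z w) in Q.
    replace (z - (z - w))%C with w in Q by ring. fold m in Q. lra. }
  assert (Nw : w <> 0) by (apply Cmod_gt_0; lra).
  replace (/ w - / z - - / (z * z) * (w - z))%C
    with ((w - z) * ((w - z) / (z * z * w)))%C by (field; auto).
  rewrite Cmod_mult, Rmult_comm. apply Rmult_le_compat_r; [ apply Cmod_ge_0 | ].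
  rewrite Cmod_div by (repeat apply Cmult_neq_0; auto).
  rewrite !Cmod_mult. fold m.
  assert (Pd : 0 < m * m * Cmod w) by (repeat apply Rmult_lt_0_compat; lra).
  apply (Rmult_le_reg_r (m * m * Cmod w)); auto.
  unfold Rdiv; rewrite Rmult_assoc, Rinv_l, Rmult_1_r by lra.
  apply Rlt_le, (Rlt_le_trans _ _ _ W2).
  replace (eps * (m * m * m) / 2) with (eps * (m * m) * (m / 2)) by field.
  replace (eps * (m * m * Cmod w)) with (eps * (m * m) * Cmod w) by ring.
  apply Rmult_le_compat_l; [ | lra ].
  apply Rmult_le_pos; [ lra | apply Rmult_le_pos; lra ].
Qed.

Lemma cder_hol (h : C -> C) (g : R -> C) (t : R) (d l : C) :
  cder g t l -> hol h (g t) d -> cder (fun s => h (g s)) t (d * l)%C.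
Proof.
  rewrite !cder_eps; intros G H eps He.
  assert (P1 := Cmod_ge_0 l). assert (P2 := Cmod_ge_0 d).
  set (q := eps / (2 * (Cmod l + 1))).
  assert (Hq : 0 < q) by (apply Rdiv_lt_0_compat; lra).
  destruct (H q Hq) as [e1 [H1 K1]].
  assert (Gc : ccts g t) by (eapply cder_ccts; apply cder_eps; exact G).
  destruct (proj1 (ccts_eps _ _) Gc e1 H1) as [e2 [H2 K2]].
  set (p := Rmin 1 (eps / (2 * (Cmod d + 1)))).
  assert (Hp : 0 < p) by (apply Rmin_pos; [ lra | apply Rdiv_lt_0_compat; lra ]).
  destruct (G p Hp) as [e3 [H3 K3]].
  exists (Rmin e2 e3); split; [ apply Rmin_pos; auto | intros w Hw ].
  specialize (K2 w (Rlt_le_trans _ _ _ Hw (Rmin_l _ _))).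
  specialize (K3 w (Rlt_le_trans _ _ _ Hw (Rmin_r _ _))).
  specialize (K1 (g w) K2).
  assert (Hx := Rabs_pos (w - t)).
  assert (Q1 : p <= 1) by apply Rmin_l.
  assert (Q2 : p <= eps / (2 * (Cmod d + 1))) by apply Rmin_r.
  assert (L : Cmod (g w - g t) <= (Cmod l + 1) * Rabs (w - t)).
  { replace (g w - g t)%C with ((g w - g t - l * RtoC (w - t)) + l * RtoC (w - t))%C by ring.
    eapply Rle_trans; [ apply Cmod_triangle | rewrite Cmod_mult, Cmod_R ]. nra. }
  replace (h (g w) - h (g t) - d * l * RtoC (w - t))%C with
    ((h (g w) - h (g t) - d * (g w - g t)) + d * (g w - g t - l * RtoC (w - t)))%C by ring.
  eapply Rle_trans; [ apply Cmod_triangle | rewrite Cmod_mult ].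
  assert (A1 : q * Cmod (g w - g t) <= eps / 2 * Rabs (w - t)).
  { eapply Rle_trans; [ apply Rmult_le_compat_l; [ lra | exact L ] | ].
    rewrite <- Rmult_assoc. apply Rmult_le_compat_r; auto.
    right; unfold q; field; lra. }
  assert (A2 : Cmod d * (p * Rabs (w - t)) <= eps / 2 * Rabs (w - t)).
  { rewrite <- Rmult_assoc. apply Rmult_le_compat_r; auto.
    apply Rle_trans with ((Cmod d + 1) * (eps / (2 * (Cmod d + 1)))).
    - apply Rmult_le_compat; lra.
    - right; field; lra. }
  assert (A3 : Cmod d * Cmod (g w - g t - l * RtoC (w - t)) <= Cmod d * (p * Rabs (w - t)))
    by (apply Rmult_le_compat_l; auto).
  lra.
Qed.

Lemma cts_ccts (h : C -> C) (g : R -> C) (t : R) :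
  ccts g t -> cts h (g t) -> ccts (fun s => h (g s)) t.
Proof.
  rewrite !ccts_eps; intros G H eps He.
  destruct (H eps He) as [e1 [H1 K1]]; destruct (G e1 H1) as [e2 [H2 K2]].
  exists e2; split; auto.
Qed.

Lemma ccts_const (a : C) (t : R) : ccts (fun _ => a) t.
Proof. split; apply continuous_const. Qed.

Lemma ccts_plus (g h : R -> C) (t : R) : ccts g t -> ccts h t -> ccts (fun s => g s + h s)%C t.
Proof.
  intros [A B] [A' B']; split.
  - apply (continuous_plus (fun s => Re (g s)) (fun s => Re (h s))); auto.
  - apply (continuous_plus (fun s => Im (g s)) (fun s => Im (h s))); auto.
Qed.

Lemma ccts_mult (g h : R -> C) (t : R) : ccts g t -> ccts h t -> ccts (fun s => g s * h s)%C t.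
Proof.
  intros [A B] [A' B']; split.
  - apply (continuous_minus (fun s => Re (g s) * Re (h s)) (fun s => Im (g s) * Im (h s)));
      apply (continuous_mult (K := R_AbsRing)); auto.
  - apply (continuous_plus (fun s => Re (g s) * Im (h s)) (fun s => Im (g s) * Re (h s)));
      apply (continuous_mult (K := R_AbsRing)); auto.
Qed.

Lemma cder_plus (g h : R -> C) (t : R) (l m : C) :
  cder g t l -> cder h t m -> cder (fun s => g s + h s)%C t (l + m)%C.
Proof.
  intros [A B] [A' B']; split.
  - apply (is_derive_plus (fun s => Re (g s)) (fun s => Re (h s))); auto.
  - apply (is_derive_plus (fun s => Im (g s)) (fun s => Im (h s))); auto.
Qed.

Lemma cder_scal (a : C) (g : R -> C) (t : R) (l : C) :
  cder g t l -> cder (fun s => a * g s)%C t (a * l)%C.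
Proof.
  intros [A B]; split.
  - apply (is_derive_minus (fun s => Re a * Re (g s)) (fun s => Im a * Im (g s)));
      apply is_derive_scal; auto.
  - apply (is_derive_plus (fun s => Re a * Im (g s)) (fun s => Im a * Re (g s)));
      apply is_derive_scal; auto.
Qed.

Lemma cder_const (a : C) (t : R) : cder (fun _ => a) t 0.
Proof.
  split; [ exact (is_derive_const (K := R_AbsRing) (V := R_NormedModule) (Re a) t)
         | exact (is_derive_const (K := R_AbsRing) (V := R_NormedModule) (Im a) t) ].
Qed.

Lemma cder_eq (g : R -> C) (t : R) (l m : C) : cder g t l -> l = m -> cder g t m.
Proof. intros H <-; exact H. Qed.

Lemma cder_RtoC (t : R) : cder RtoC t 1.
Proof. split; [ apply (is_derive_id (K := R_AbsRing)) | exact (is_derive_const (K := R_AbsRing) (V := R_NormedModule) 0 t) ]. Qed.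

Lemma cder_line (p v : C) (t : R) : cder (fun s => p + v * RtoC s)%C t v.
Proof.
  eapply cder_eq; [ apply cder_plus; [ apply cder_const | apply cder_scal, cder_RtoC ] | ring ].
Qed.

(* Project on the direction [v = k b - k a] and apply the real mean value theorem. *)
Lemma curve_MVT (k k' : R -> C) (P p : R -> R) (a b : R) : a <= b ->
  (forall t, a <= t <= b -> cder k t (k' t) /\ is_derive P t (p t) /\ Cmod (k' t) <= p t) ->
  Cmod (k b - k a) <= P b - P a.
Proof.
  intros Hab H. set (v := (k b - k a)%C).
  assert (D : forall t, a <= t <= b ->
    is_derive (fun s => Cmod v * P s - (Re v * Re (k s) + Im v * Im (k s))) t
      (Cmod v * p t - (Re v * Re (k' t) + Im v * Im (k' t)))).
  { intros t Ht; destruct (H t Ht) as [[K1 K2] [K3 _]].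
    apply (is_derive_minus (fun s => Cmod v * P s) (fun s => Re v * Re (k s) + Im v * Im (k s))).
    - apply is_derive_scal; auto.
    - apply (is_derive_plus (fun s => Re v * Re (k s)) (fun s => Im v * Im (k s)));
        apply is_derive_scal; auto. }
  destruct (MVT_gen _ a b _ (fun x Hx => D x ltac:(rewrite Rmin_left, Rmax_right in Hx; lra)))
    as [c [Hc E]].
  { intros x Hx; rewrite Rmin_left, Rmax_right in Hx by lra.
    apply derivable_continuous_pt; eexists; apply is_derive_Reals, D; lra. }
  rewrite Rmin_left, Rmax_right in Hc by lra.
  destruct (H c Hc) as [_ [_ Kc]].
  assert (CS : Re v * Re (k' c) + Im v * Im (k' c) <= Cmod v * Cmod (k' c)).
  { rewrite <- (Cmod_conj v), <- Cmod_mult.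
    eapply Rle_trans; [ | apply re_le_Cmod ].
    eapply Rle_trans; [ | apply Rle_abs ].
    right; unfold Re, Im, Cconj, Cmult; simpl; ring. }
  assert (Hv := Cmod_ge_0 v).
  assert (E2 : Re v * (Re (k b) - Re (k a)) + Im v * (Im (k b) - Im (k a)) = Cmod v * Cmod v).
  { replace (Cmod v * Cmod v) with (Cmod v ^ 2) by ring. rewrite Cmod2_alt.
    change (Re v) with (Re (k b) - Re (k a)). change (Im v) with (Im (k b) - Im (k a)). ring. }
  assert (Nn : 0 <= (Cmod v * p c - (Re v * Re (k' c) + Im v * Im (k' c))) * (b - a)).
  { apply Rmult_le_pos; [ | lra ].
    assert (Cmod v * Cmod (k' c) <= Cmod v * p c) by (apply Rmult_le_compat_l; auto). lra. }
  assert (F : Cmod v * Cmod v <= Cmod v * (P b - P a)) by lra.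
  (* When v = 0 there is nothing to divide by. The claim is then that P does not decrease, which
     holds because [p] bounds a modulus and is therefore nonnegative. *)
  destruct (Req_dec (Cmod v) 0) as [Z | Z].
  - rewrite Z. assert (is_derive P a (p a)) by (apply H; lra).
    destruct (MVT_gen P a b p) as [c' [Hc' E']].
    + intros x Hx; rewrite Rmin_left, Rmax_right in Hx by lra; apply H; lra.
    + intros x Hx; rewrite Rmin_left, Rmax_right in Hx by lra.
      apply derivable_continuous_pt; exists (p x); apply is_derive_Reals, H; lra.
    + rewrite Rmin_left, Rmax_right in Hc' by lra.
      rewrite E'; apply Rmult_le_pos; [ | lra ].
      eapply Rle_trans; [ apply Cmod_ge_0 | apply H; auto ].
  - apply Rmult_le_reg_l with (Cmod v); lra.
Qed.

Lemma curve_lip (k k' : R -> C) (B a b : R) : a <= b ->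
  (forall t, a <= t <= b -> cder k t (k' t) /\ Cmod (k' t) <= B) ->
  Cmod (k b - k a) <= B * (b - a).
Proof.
  intros Hab H. replace (B * (b - a)) with (B * b - B * a) by ring.
  apply (curve_MVT k k' (fun t => B * t) (fun _ => B)); auto.
  intros t Ht; destruct (H t Ht); split; [ | split ]; auto.
  auto_derive; auto; ring.
Qed.

Lemma cder_horiz (x y : R) : cder (fun t => (t, y)) x 1.
Proof. split; [ apply (is_derive_id (K := R_AbsRing)) | exact (is_derive_const (K := R_AbsRing) (V := R_NormedModule) y x) ]. Qed.

Lemma cder_vert (x y : R) : cder (fun t => (x, t)) y Ci.
Proof. split; [ exact (is_derive_const (K := R_AbsRing) (V := R_NormedModule) x y) | apply (is_derive_id (K := R_AbsRing)) ]. Qed.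

(** Go from z to w along a vertical and then a horizontal segment. On both, the derivative stays
    within eps/2 of its value at z by continuity of [g], so the mean value inequality bounds the
    remainder on each. This is the sufficiency of the Cauchy-Riemann equations for continuous
    partial derivatives. *)
Lemma hol_of_partials (h g : C -> C) (z : C) (r : R) : 0 < r -> cts g z ->
  (forall w, Cmod (w - z) < r ->
     cder (fun t => h (t, Im w)) (Re w) (g w) /\ cder (fun t => h (Re w, t)) (Im w) (Ci * g w)) ->
  hol h z (g z).
Proof.
  intros Hr Hg H eps He.
  destruct (Hg (eps / 2)) as [e [He0 K]]; [ lra | ].
  exists (Rmin e r); split; [ apply Rmin_pos; auto | intros w Hw ].
  assert (Hwe := Rlt_le_trans _ _ _ Hw (Rmin_l _ _)).
  assert (Hwr := Rlt_le_trans _ _ _ Hw (Rmin_r _ _)).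
  (* The rectangle with opposite corners z and w, which contains the path, lies in the disc about z
     through w. *)
  assert (near : forall x y, Rmin (Re z) (Re w) <= x <= Rmax (Re z) (Re w) ->
     Rmin (Im z) (Im w) <= y <= Rmax (Im z) (Im w) -> Cmod ((x, y) - z) <= Cmod (w - z)).
  { intros x y Hx Hy. unfold Cmod. apply sqrt_le_1_alt.
    destruct z as [zx zy], w as [wx wy]; unfold Re, Im in *; simpl in *.
    rewrite !Rmult_1_r.
    apply Rplus_le_compat; apply Rsqr_le_abs_1; unfold Rmin, Rmax, Rabs in *;
      repeat destruct Rle_dec; repeat destruct Rcase_abs; lra. }
  assert (gen : forall (k k' : R -> C) (a b : R) (c : C),
     (forall t, Rmin a b <= t <= Rmax a b -> cder k t (k' t) /\ Cmod (k' t - c) <= eps / 2) ->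
     Cmod (k b - k a - c * RtoC (b - a)) <= eps / 2 * Rabs (b - a)).
  { intros k k' a b c HK.
    assert (main : forall a b : R, a <= b ->
      (forall t, a <= t <= b -> cder k t (k' t) /\ Cmod (k' t - c) <= eps / 2) ->
      Cmod (k b - k a - c * RtoC (b - a)) <= eps / 2 * (b - a)).
    { clear a b HK; intros a b Hab HK.
      assert (Q := curve_lip (fun t => k t + (- c) * RtoC t)%C (fun t => k' t + (- c) * 1)%C
                     (eps / 2) a b Hab).
      replace (k b - k a - c * RtoC (b - a))%C
        with (k b + - c * RtoC b - (k a + - c * RtoC a))%C
        by (rewrite RtoC_minus; ring).
      apply Q; intros t Ht; destruct (HK t Ht) as [K1 K2]; split.
      - apply cder_plus; auto. apply cder_scal, cder_RtoC.
      - replace (k' t + - c * 1)%C with (k' t - c)%C by ring; auto. }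
    destruct (Rle_dec a b) as [L | L].
    - rewrite Rabs_pos_eq by lra. rewrite Rmin_left, Rmax_right in HK by lra. auto.
    - rewrite Rabs_left by lra. rewrite Rmin_right, Rmax_left in HK by lra.
      rewrite <- Cmod_opp.
      replace (- (k b - k a - c * RtoC (b - a)))%C with (k a - k b - c * RtoC (a - b))%C
        by (rewrite !RtoC_minus; ring).
      replace (- (b - a)) with (a - b) by ring. apply main; [ lra | auto ]. }
  assert (X := gen (fun t => h (t, Im w)) (fun t => g (t, Im w)) (Re z) (Re w) (g z)).
  assert (Y := gen (fun t => h (Re z, t)) (fun t => Ci * g (Re z, t))%C (Im z) (Im w) (Ci * g z)%C).
  assert (X' := X ltac:(intros t Ht; assert (N := near t (Im w) Ht (conj (Rmin_r _ _) (Rmax_r _ _)));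
     split; [ apply (H (t, Im w)); lra | apply Rlt_le, K; lra ])).
  assert (Y' := Y ltac:(intros t Ht; assert (N := near (Re z) t (conj (Rmin_l _ _) (Rmax_l _ _)) Ht);
     split; [ apply (H (Re z, t)); lra |
       replace (Ci * g (Re z, t) - Ci * g z)%C with (Ci * (g (Re z, t) - g z))%C by ring;
       rewrite Cmod_mult, Cmod_Ci, Rmult_1_l; apply Rlt_le, K; lra ])).
  simpl in X', Y'.
  replace (Re z, Im z) with z in Y' by (destruct z; reflexivity).
  replace (Re w, Im w) with w in X' by (destruct w; reflexivity).
  assert (E : (w - z)%C = (RtoC (Re w - Re z) + Ci * RtoC (Im w - Im z))%C).
  { apply injective_projections; simpl; unfold Re, Im; ring. }
  replace (h w - h z - g z * (w - z))%C with
    ((h w - h (Re z, Im w) - g z * RtoC (Re w - Re z)) +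
     (h (Re z, Im w) - h z - Ci * g z * RtoC (Im w - Im z)))%C by (rewrite E; ring).
  eapply Rle_trans; [ apply Cmod_triangle | ].
  assert (B1 := re_le_Cmod (w - z)). assert (B2 := im_le_Cmod (w - z)).
  change (Re (w - z)%C) with (Re w - Re z) in B1. change (Im (w - z)%C) with (Im w - Im z) in B2.
  nra.
Qed.

(** * Goursat's theorem and primitives *)

Definition Cint (g : R -> C) (a b : R) : C :=
  (RInt (fun t => Re (g t)) a b, RInt (fun t => Im (g t)) a b).

Definition ccts_on (g : R -> C) (a b : R) : Prop :=
  forall t, Rmin a b <= t <= Rmax a b -> ccts g t.

Lemma ccts_on_re (g : R -> C) (a b : R) : ccts_on g a b -> ex_RInt (fun t => Re (g t)) a b.
Proof. intros H; apply (ex_RInt_continuous (V := R_CompleteNormedModule)); intros t Ht; exact (proj1 (H t Ht)). Qed.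

Lemma ccts_on_im (g : R -> C) (a b : R) : ccts_on g a b -> ex_RInt (fun t => Im (g t)) a b.
Proof. intros H; apply (ex_RInt_continuous (V := R_CompleteNormedModule)); intros t Ht; exact (proj2 (H t Ht)). Qed.

Lemma RInt_lin (u v : R -> R) (p q a b : R) : ex_RInt u a b -> ex_RInt v a b ->
  is_RInt (fun t => p * u t + q * v t) a b (p * RInt u a b + q * RInt v a b).
Proof.
  intros U V.
  exact (is_RInt_plus (V := R_NormedModule) _ _ _ _ _ _
    (is_RInt_scal (V := R_NormedModule) _ _ _ p _ (RInt_correct (V := R_CompleteNormedModule) _ _ _ U))
    (is_RInt_scal (V := R_NormedModule) _ _ _ q _ (RInt_correct (V := R_CompleteNormedModule) _ _ _ V))).
Qed.

Lemma RInt_lin_eq (u v w : R -> R) (p q a b : R) : ex_RInt u a b -> ex_RInt v a b ->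
  (forall t, w t = p * u t + q * v t) -> RInt w a b = p * RInt u a b + q * RInt v a b.
Proof.
  intros U V E. rewrite <- (is_RInt_unique _ _ _ _ (RInt_lin u v p q a b U V)).
  apply RInt_ext; intros; apply E.
Qed.

Lemma Cint_ext (g h : R -> C) (a b : R) :
  (forall t, Rmin a b <= t <= Rmax a b -> g t = h t) -> Cint g a b = Cint h a b.
Proof.
  intros H; unfold Cint; f_equal; apply RInt_ext; intros t Ht; rewrite H; auto; lra.
Qed.

Lemma Cint_FTC (k g : R -> C) (a b : R) :
  (forall t, Rmin a b <= t <= Rmax a b -> cder k t (g t)) -> ccts_on g a b ->
  Cint g a b = (k b - k a)%C.
Proof.
  intros H G; unfold Cint.
  apply injective_projections; apply is_RInt_unique.
  - exact (is_RInt_derive (V := R_CompleteNormedModule) (fun t => Re (k t)) _ a b (fun t Ht => proj1 (H t Ht)) (fun t Ht => proj1 (G t Ht))).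
  - exact (is_RInt_derive (V := R_CompleteNormedModule) (fun t => Im (k t)) _ a b (fun t Ht => proj2 (H t Ht)) (fun t Ht => proj2 (G t Ht))).
Qed.

Lemma Cint_cder (g : R -> C) (lo hi a b : R) : lo < a < hi -> lo < b < hi ->
  (forall t, lo < t < hi -> ccts g t) -> cder (fun s => Cint g a s) b (g b).
Proof.
  intros Ha Hb H.
  assert (Hr : 0 < Rmin (b - lo) (hi - b)) by (apply Rmin_pos; lra).
  assert (N : forall s, ball b (mkposreal _ Hr) s -> ccts_on g a s).
  { intros s Hs t Ht; apply H.
    change (Rabs (s - b) < Rmin (b - lo) (hi - b)) in Hs.
    assert (A1 := Rmin_l (b - lo) (hi - b)). assert (A2 := Rmin_r (b - lo) (hi - b)).
    apply Rabs_def2 in Hs. unfold Rmin, Rmax in Ht; repeat destruct Rle_dec; lra. }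
  split.
  - apply (is_derive_RInt (fun t => Re (g t)) _ a b).
    + exists (mkposreal _ Hr); intros s Hs; apply (RInt_correct (fun t => Re (g t))), ccts_on_re, N; auto.
    + exact (proj1 (H b Hb)).
  - apply (is_derive_RInt (fun t => Im (g t)) _ a b).
    + exists (mkposreal _ Hr); intros s Hs; apply (RInt_correct (fun t => Im (g t))), ccts_on_im, N; auto.
    + exact (proj2 (H b Hb)).
Qed.

Lemma Cint_scal (c : C) (g : R -> C) (a b : R) : ccts_on g a b ->
  Cint (fun t => c * g t)%C a b = (c * Cint g a b)%C.
Proof.
  intros H. assert (R1 := ccts_on_re _ _ _ H). assert (I1 := ccts_on_im _ _ _ H).
  unfold Cint; apply injective_projections; simpl.
  - rewrite (RInt_lin_eq _ _ _ (Re c) (- Im c) a b R1 I1) by (intros; unfold Re, Im; simpl; ring).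
    unfold Re, Im; simpl; ring.
  - rewrite (RInt_lin_eq _ _ _ (Im c) (Re c) a b R1 I1) by (intros; unfold Re, Im; simpl; ring).
    unfold Re, Im; simpl; ring.
Qed.

Lemma Cint_plus (g h : R -> C) (a b : R) : ccts_on g a b -> ccts_on h a b ->
  Cint (fun t => g t + h t)%C a b = (Cint g a b + Cint h a b)%C.
Proof.
  intros H H'. unfold Cint; apply injective_projections; simpl.
  - rewrite (RInt_lin_eq _ _ _ 1 1 a b (ccts_on_re _ _ _ H) (ccts_on_re _ _ _ H')); [ ring | ].
    intros; unfold Re, Im; simpl; ring.
  - rewrite (RInt_lin_eq _ _ _ 1 1 a b (ccts_on_im _ _ _ H) (ccts_on_im _ _ _ H')); [ ring | ].
    intros; unfold Re, Im; simpl; ring.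
Qed.

Lemma Cint_Chasles (g : R -> C) (a b c : R) : ccts_on g a b -> ccts_on g b c ->
  (Cint g a b + Cint g b c)%C = Cint g a c.
Proof.
  intros H H'. unfold Cint; apply injective_projections; simpl.
  - apply (RInt_Chasles (V := R_CompleteNormedModule) (fun t => Re (g t))); apply ccts_on_re; auto.
  - apply (RInt_Chasles (V := R_CompleteNormedModule) (fun t => Im (g t))); apply ccts_on_im; auto.
Qed.

(** Pairing the integrand with the value v of the integral produces a real integral equal to |v|^2;
    Cauchy-Schwarz bounds it by |v| times the integral of [p], and |v| cancels unless it is zero. *)
Lemma Cint_le_RInt (g : R -> C) (p : R -> R) (a b : R) : a <= b -> ccts_on g a b ->
  ex_RInt p a b -> (forall t, a <= t <= b -> Cmod (g t) <= p t) ->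
  Cmod (Cint g a b) <= RInt p a b.
Proof.
  intros Hab H Hp HM. set (v := Cint g a b).
  assert (R1 := ccts_on_re _ _ _ H). assert (I1 := ccts_on_im _ _ _ H).
  assert (E : is_RInt (fun t => Re v * Re (g t) + Im v * Im (g t)) a b (Cmod v * Cmod v)).
  { replace (Cmod v * Cmod v) with (Cmod v ^ 2) by ring. rewrite Cmod2_alt.
    replace (Re v ^ 2 + Im v ^ 2) with (Re v * Re v + Im v * Im v) by ring.
    exact (RInt_lin _ _ _ _ _ _ R1 I1). }
  assert (F : is_RInt (fun t => Cmod v * p t) a b (Cmod v * RInt p a b))
    by (apply (is_RInt_scal (V := R_NormedModule)); apply (RInt_correct p); auto).
  assert (Q : Cmod v * Cmod v <= Cmod v * RInt p a b).
  { refine (is_RInt_le _ _ a b _ _ Hab E F _). intros t Ht.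
    assert (CS : Re v * Re (g t) + Im v * Im (g t) <= Cmod v * Cmod (g t)).
    { rewrite <- (Cmod_conj v), <- Cmod_mult.
      eapply Rle_trans; [ | apply re_le_Cmod ]. eapply Rle_trans; [ | apply Rle_abs ].
      right; unfold Re, Im, Cconj, Cmult; simpl; ring. }
    eapply Rle_trans; [ exact CS | apply Rmult_le_compat_l; [ apply Cmod_ge_0 | apply HM; lra ] ]. }
  assert (V0 := Cmod_ge_0 v).
  destruct (Req_dec (Cmod v) 0) as [Z | Z].
  - rewrite Z. apply RInt_ge_0; auto. intros; eapply Rle_trans; [ apply Cmod_ge_0 | apply HM; lra ].
  - apply Rmult_le_reg_l with (Cmod v); lra.
Qed.

Lemma Cint_le (g : R -> C) (M a b : R) : a <= b -> ccts_on g a b ->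
  (forall t, a <= t <= b -> Cmod (g t) <= M) -> Cmod (Cint g a b) <= M * (b - a).
Proof.
  intros Hab H HM.
  replace (M * (b - a)) with (RInt (fun _ => M) a b)
    by (rewrite (RInt_const (V := R_CompleteNormedModule)); apply Rmult_comm).
  apply Cint_le_RInt; auto. apply (ex_RInt_const (V := R_NormedModule)).
Qed.

(** The contour integral over the boundary of a rectangle, counterclockwise when x1 <= x2 and y1 <=
    y2. The factor [Ci] is dw/dt on the vertical sides. *)
Definition rect (h : C -> C) (x1 x2 y1 y2 : R) : C :=
  (Cint (fun t => h (t, y1)) x1 x2 + Ci * Cint (fun t => h (x2, t)) y1 y2
   - Cint (fun t => h (t, y2)) x1 x2 - Ci * Cint (fun t => h (x1, t)) y1 y2)%C.

(** The height [c] is a parameter so that the same lemmas serve the upper half-plane (c = 0) and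
    entire functions (any c below the contour). *)
Definition cts_above (c : R) (h : C -> C) : Prop := forall z, c < Im z -> cts h z.

Lemma cts_above_horiz (c : R) (h : C -> C) (y a b : R) :
  cts_above c h -> c < y -> ccts_on (fun t => h (t, y)) a b.
Proof.
  intros H Hy t _; apply (cts_ccts h (fun t => (t, y))).
  - eapply cder_ccts; apply cder_horiz.
  - apply H; exact Hy.
Qed.

Lemma cts_above_vert (c : R) (h : C -> C) (x a b : R) :
  cts_above c h -> c < a -> c < b -> ccts_on (fun t => h (x, t)) a b.
Proof.
  intros H Ha Hb t Ht; apply (cts_ccts h (fun t => (x, t))).
  - eapply cder_ccts; apply cder_vert.
  - apply H; simpl. unfold Rmin in Ht; destruct Rle_dec; lra.
Qed.

Lemma rect_split_x (c : R) (h : C -> C) (x1 x x2 y1 y2 : R) : cts_above c h -> c < y1 -> c < y2 ->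
  rect h x1 x2 y1 y2 = (rect h x1 x y1 y2 + rect h x x2 y1 y2)%C.
Proof.
  intros H H1 H2; unfold rect.
  rewrite <- (Cint_Chasles (fun t => h (t, y1)) x1 x x2) by (eapply cts_above_horiz; eauto).
  rewrite <- (Cint_Chasles (fun t => h (t, y2)) x1 x x2) by (eapply cts_above_horiz; eauto).
  ring.
Qed.

Lemma rect_split_y (c : R) (h : C -> C) (x1 x2 y1 y y2 : R) : cts_above c h ->
  c < y1 -> c < y -> c < y2 ->
  rect h x1 x2 y1 y2 = (rect h x1 x2 y1 y + rect h x1 x2 y y2)%C.
Proof.
  intros H H1 Hy H2; unfold rect.
  rewrite <- (Cint_Chasles (fun t => h (x1, t)) y1 y y2) by (eapply cts_above_vert; eauto).
  rewrite <- (Cint_Chasles (fun t => h (x2, t)) y1 y y2) by (eapply cts_above_vert; eauto).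
  ring.
Qed.

Lemma rect_primitive (c : R) (Q g : C -> C) (x1 x2 y1 y2 : R) : cts_above c g ->
  (forall w, c < Im w -> hol Q w (g w)) -> c < y1 -> c < y2 -> rect g x1 x2 y1 y2 = 0.
Proof.
  intros G H H1 H2; unfold rect.
  assert (X : forall y, c < y -> Cint (fun t => g (t, y)) x1 x2 = (Q (x2, y) - Q (x1, y))%C).
  { intros y Hy; apply (Cint_FTC (fun t => Q (t, y))).
    - intros t _; eapply cder_eq.
      + apply (cder_hol Q (fun s => (s, y))); [ apply cder_horiz | apply H; exact Hy ].
      + ring.
    - eapply cts_above_horiz; eauto. }
  assert (Y : forall x, (Ci * Cint (fun t => g (x, t)) y1 y2)%C = (Q (x, y2) - Q (x, y1))%C).
  { intros x. rewrite <- Cint_scal by (eapply cts_above_vert; eauto).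
    apply (Cint_FTC (fun t => Q (x, t))).
    - intros t Ht; eapply cder_eq.
      + apply (cder_hol Q (fun s => (x, s))); [ apply cder_vert | apply H; simpl ].
        unfold Rmin in Ht; destruct Rle_dec; lra.
      + simpl; ring.
    - intros t Ht; apply ccts_mult; [ apply ccts_const | exact (cts_above_vert c g x y1 y2 G H1 H2 t Ht) ]. }
  rewrite !X, !Y by auto. ring.
Qed.

Lemma cts_plus (h g : C -> C) (z : C) : cts h z -> cts g z -> cts (fun w => h w + g w)%C z.
Proof.
  intros H G eps He.
  destruct (H (eps / 2)) as [e1 [H1 K1]]; [ lra | ].
  destruct (G (eps / 2)) as [e2 [H2 K2]]; [ lra | ].
  exists (Rmin e1 e2); split; [ apply Rmin_pos; auto | intros w Hw ].
  specialize (K1 w (Rlt_le_trans _ _ _ Hw (Rmin_l _ _))).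
  specialize (K2 w (Rlt_le_trans _ _ _ Hw (Rmin_r _ _))).
  replace (h w + g w - (h z + g z))%C with ((h w - h z) + (g w - g z))%C by ring.
  eapply Rle_lt_trans; [ apply Cmod_triangle | lra ].
Qed.

Lemma rect_plus (c : R) (h g : C -> C) (x1 x2 y1 y2 : R) : cts_above c h -> cts_above c g ->
  c < y1 -> c < y2 ->
  rect (fun w => h w + g w)%C x1 x2 y1 y2 = (rect h x1 x2 y1 y2 + rect g x1 x2 y1 y2)%C.
Proof.
  intros H G H1 H2; unfold rect.
  rewrite (Cint_plus (fun t => h (t, y1)) (fun t => g (t, y1))) by (eapply cts_above_horiz; eauto).
  rewrite (Cint_plus (fun t => h (t, y2)) (fun t => g (t, y2))) by (eapply cts_above_horiz; eauto).
  rewrite (Cint_plus (fun t => h (x1, t)) (fun t => g (x1, t))) by (eapply cts_above_vert; eauto).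
  rewrite (Cint_plus (fun t => h (x2, t)) (fun t => g (x2, t))) by (eapply cts_above_vert; eauto).
  ring.
Qed.

Lemma rect_le (c : R) (h : C -> C) (M x1 x2 y1 y2 : R) : cts_above c h -> c < y1 ->
  x1 <= x2 -> y1 <= y2 ->
  (forall x y, x1 <= x <= x2 -> y1 <= y <= y2 -> Cmod (h (x, y)) <= M) ->
  Cmod (rect h x1 x2 y1 y2) <= 2 * M * ((x2 - x1) + (y2 - y1)).
Proof.
  intros H H1 Hx Hy HM; unfold rect, Cminus.
  eapply Rle_trans; [ apply Cmod_triangle | ].
  eapply Rle_trans; [ apply Rplus_le_compat_r, Cmod_tri3 | ].
  rewrite !Cmod_opp, !Cmod_mult, Cmod_Ci, !Rmult_1_l.
  assert (A1 := Cint_le (fun t => h (t, y1)) M x1 x2 Hx ltac:(eapply cts_above_horiz; eauto)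
    ltac:(intros; apply HM; lra)).
  assert (A2 := Cint_le (fun t => h (t, y2)) M x1 x2 Hx ltac:(eapply cts_above_horiz; eauto; lra)
    ltac:(intros; apply HM; lra)).
  assert (A3 := Cint_le (fun t => h (x1, t)) M y1 y2 Hy ltac:(eapply cts_above_vert; eauto; lra)
    ltac:(intros; apply HM; lra)).
  assert (A4 := Cint_le (fun t => h (x2, t)) M y1 y2 Hy ltac:(eapply cts_above_vert; eauto; lra)
    ltac:(intros; apply HM; lra)).
  lra.
Qed.

Lemma nested_intervals (a b : nat -> R) :
  (forall n, a n <= a (S n)) -> (forall n, b (S n) <= b n) -> (forall n, a n <= b n) ->
  exists x, forall n, a n <= x <= b n.
Proof.
  intros Ha Hb Hab.
  assert (Ga : forall n m, (n <= m)%nat -> a n <= a m).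
  { intros n m L; induction L; [ lra | eapply Rle_trans; eauto ]. }
  assert (Gb : forall n m, (n <= m)%nat -> b m <= b n).
  { intros n m L; induction L; [ lra | eapply Rle_trans; eauto ]. }
  assert (G : forall n m, a n <= b m).
  { intros n m; eapply Rle_trans; [ apply (Ga n (max n m)), Nat.le_max_l | ].
    eapply Rle_trans; [ apply Hab | apply Gb, Nat.le_max_r ]. }
  destruct (completeness (fun r => exists n, r = a n)) as [x [U L]].
  - exists (b O); intros r [n ->]; apply G.
  - exists (a O); exists O; reflexivity.
  - exists x; intros n; split; [ apply U; exists n; reflexivity | ].
    apply L; intros r [m ->]; apply G.
Qed.

Lemma small_pow2 (L d : R) : 0 < d -> exists n, L / 2 ^ n < d.
Proof.
  intros Hd.
  destruct (pow_lt_1_zero (/ 2) ltac:(rewrite Rabs_pos_eq; lra) (d / (Rabs L + 1))) as [n Hn].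
  { apply Rdiv_lt_0_compat; auto. assert (Q := Rabs_pos L); lra. }
  exists n. specialize (Hn n (le_n n)). rewrite pow_inv, Rabs_pos_eq in Hn
    by (apply Rlt_le, Rinv_0_lt_compat, pow_lt; lra).
  assert (Q := Rabs_pos L). assert (Q1 := Rle_abs L).
  assert (P : 0 < / 2 ^ n) by (apply Rinv_0_lt_compat, pow_lt; lra).
  apply Rle_lt_trans with ((Rabs L + 1) * / 2 ^ n).
  - unfold Rdiv; apply Rmult_le_compat_r; lra.
  - apply (Rmult_lt_compat_l (Rabs L + 1)) in Hn; [ | lra ].
    replace ((Rabs L + 1) * (d / (Rabs L + 1))) with d in Hn by (field; lra). exact Hn.
Qed.

(** Lower left corner of a quarter, with sides [w] and [v], whose boundary integral has at least a
    quarter of the modulus of the whole. The last quarter is the default. *)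
Definition best_quarter (h : C -> C) (w v : R) (p : C) : C :=
  let '(x, y) := p in
  let I q := Cmod (rect h (fst q) (fst q + w) (snd q) (snd q + v)) in
  let T := Cmod (rect h x (x + 2 * w) y (y + 2 * v)) in
  if Rle_dec T (4 * I (x, y)) then (x, y)
  else if Rle_dec T (4 * I (x + w, y)) then (x + w, y)
  else if Rle_dec T (4 * I (x, y + v)) then (x, y + v)
  else (x + w, y + v).

(** The four boundary integrals add up to the whole, so if three of them are too small the triangle
    inequality makes the default choice correct. *)
Lemma best_quarter_spec (c : R) (h : C -> C) (w v : R) (p : C) : cts_above c h ->
  c < Im p -> 0 <= v ->
  let q := best_quarter h w v p in
  (Re q = Re p \/ Re q = Re p + w) /\ (Im q = Im p \/ Im q = Im p + v) /\
  Cmod (rect h (Re p) (Re p + 2 * w) (Im p) (Im p + 2 * v)) <=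
    4 * Cmod (rect h (Re q) (Re q + w) (Im q) (Im q + v)).
Proof.
  intros H Hp Hv. destruct p as [x y]; unfold best_quarter; simpl in *.
  destruct Rle_dec as [L1 | L1]; simpl; [ auto | ].
  destruct Rle_dec as [L2 | L2]; simpl; [ auto | ].
  destruct Rle_dec as [L3 | L3]; simpl; [ auto | ].
  split; [ auto | split; [ auto | ] ].
  assert (E : rect h x (x + 2 * w) y (y + 2 * v) =
    (rect h x (x + w) y (y + v) + rect h (x + w) (x + w + w) y (y + v) +
     rect h x (x + w) (y + v) (y + v + v) +
     rect h (x + w) (x + w + w) (y + v) (y + v + v))%C).
  { rewrite (rect_split_x c h x (x + w)) by (auto; lra).
    rewrite (rect_split_y c h x (x + w) y (y + v)) by (auto; lra).
    rewrite (rect_split_y c h (x + w) (x + 2 * w) y (y + v)) by (auto; lra).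
    replace (x + 2 * w) with (x + w + w) by ring.
    replace (y + 2 * v) with (y + v + v) by ring. ring. }
  assert (T := Cmod_tri3 (rect h x (x + w) y (y + v) + rect h (x + w) (x + w + w) y (y + v))
     (rect h x (x + w) (y + v) (y + v + v))
     (rect h (x + w) (x + w + w) (y + v) (y + v + v))).
  rewrite <- E in T.
  assert (T2 := Cmod_triangle (rect h x (x + w) y (y + v)) (rect h (x + w) (x + w + w) y (y + v))).
  unfold Re, Im; simpl. lra.
Qed.

(** Bisection: the integral over the n-th rectangle loses at most a factor 4^n. Near the limit point
    [h] is affine up to an error eps times the diameter, so that integral is at most of order eps /
    4^n. *)
Lemma goursat (c : R) (h : C -> C) (x1 x2 y1 y2 : R) : cts_above c h -> c < y1 ->
  x1 <= x2 -> y1 <= y2 ->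
  (forall w, x1 <= Re w <= x2 -> y1 <= Im w <= y2 -> exists d, hol h w d) ->
  rect h x1 x2 y1 y2 = 0.
Proof.
  intros H Hc Hx Hy Hh.
  set (W := x2 - x1). set (V := y2 - y1).
  assert (HW : 0 <= W) by (unfold W; lra). assert (HV : 0 <= V) by (unfold V; lra).
  set (wd := fun n : nat => W / 2 ^ n). set (hd := fun n : nat => V / 2 ^ n).
  assert (P2 : forall n, 0 < 2 ^ n) by (intros; apply pow_lt; lra).
  assert (wdS : forall n, wd n = 2 * wd (S n)) by (intros n; unfold wd; simpl; field; apply Rgt_not_eq, P2).
  assert (hdS : forall n, hd n = 2 * hd (S n)) by (intros n; unfold hd; simpl; field; apply Rgt_not_eq, P2).
  assert (wd0 : forall n, 0 <= wd n) by (intros n; apply Rdiv_le_0_compat; auto).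
  assert (hd0 : forall n, 0 <= hd n) by (intros n; apply Rdiv_le_0_compat; auto).
  set (s := fix s (n : nat) : C := match n with
              | O => (x1, y1)
              | S m => best_quarter h (wd (S m)) (hd (S m)) (s m) end).
  set (I := fun n => Cmod (rect h (Re (s n)) (Re (s n) + wd n) (Im (s n)) (Im (s n) + hd n))).
  assert (Inv : forall n, y1 <= Im (s n) /\ x1 <= Re (s n) /\ Re (s n) + wd n <= x2 /\ Im (s n) + hd n <= y2 /\
     Cmod (rect h x1 x2 y1 y2) <= 4 ^ n * I n).
  { induction n as [ | n [A [A1 [A2 [A3 B]]]]].
    - unfold I, wd, hd; simpl; rewrite !Rdiv_1_r, Rmult_1_l.
      replace (x1 + W) with x2 by (unfold W; ring). replace (y1 + V) with y2 by (unfold V; ring).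
      repeat split; lra.
    - destruct (best_quarter_spec c h (wd (S n)) (hd (S n)) (s n) H ltac:(lra) (hd0 _)) as [Q1 [Q2 Q3]].
      rewrite <- wdS, <- hdS in Q3. fold (I n) in Q3.
      change (best_quarter h (wd (S n)) (hd (S n)) (s n)) with (s (S n)) in *.
      assert (z1 := wdS n). assert (z2 := hdS n). assert (z3 := wd0 (S n)). assert (z4 := hd0 (S n)).
      repeat split; try (destruct Q1, Q2; lra).
      fold (I (S n)) in Q3. eapply Rle_trans; [ exact B | ].
      change (4 ^ S n) with (4 * 4 ^ n). assert (0 < 4 ^ n) by (apply pow_lt; lra). nra. }
  assert (Mono : forall n, (Re (s n) <= Re (s (S n)) /\ Re (s (S n)) + wd (S n) <= Re (s n) + wd n) /\
                           (Im (s n) <= Im (s (S n)) /\ Im (s (S n)) + hd (S n) <= Im (s n) + hd n)).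
  { intros n; destruct (Inv n) as [A _].
    destruct (best_quarter_spec c h (wd (S n)) (hd (S n)) (s n) H ltac:(lra) (hd0 _)) as [Q1 [Q2 _]].
    change (best_quarter h (wd (S n)) (hd (S n)) (s n)) with (s (S n)) in *.
    assert (z1 := wdS n). assert (z2 := hdS n). assert (z3 := wd0 (S n)). assert (z4 := hd0 (S n)).
    destruct Q1, Q2; lra. }
  destruct (nested_intervals (fun n => Re (s n)) (fun n => Re (s n) + wd n)) as [px Hpx];
    try (intros n; apply Mono); [ intros n; assert (Q := wd0 n); lra | ].
  destruct (nested_intervals (fun n => Im (s n)) (fun n => Im (s n) + hd n)) as [py Hpy];
    try (intros n; apply Mono); [ intros n; assert (Q := hd0 n); lra | ].
  assert (InR : (x1 <= px <= x2) /\ (y1 <= py <= y2)).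
  { destruct (Inv O) as [A [A1 [A2 [A3 _]]]]. assert (B1 := Hpx O). assert (B2 := Hpy O).
    cbv beta in B1, B2. lra. }
  destruct (Hh (px, py) (proj1 InR) (proj2 InR)) as [d Hd].
  set (L := W + V).
  apply Cmod_eq_0, Rle_antisym; [ | apply Cmod_ge_0 ].
  apply le_epsilon; intros e He. rewrite Rplus_0_l.
  (* The final bound is 4^n * 2 eps (L / 2^n)^2 = 2 eps L^2; the added 1 covers the degenerate case
     L = 0. *)
  set (eps := e / (2 * L * L + 1)).
  assert (HL : 0 <= L) by (unfold L; lra).
  assert (HL2 : 0 <= L * L) by (apply Rmult_le_pos; auto).
  assert (Heps : 0 < eps) by (apply Rdiv_lt_0_compat; lra).
  destruct (Hd eps Heps) as [del [Hdel K]].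
  destruct (small_pow2 L del Hdel) as [n Hn].
  destruct (Inv n) as [A [A1 [A2 [A3 B]]]].
  (* Minus the affine approximation of [h] at the limit point. It has a quadratic primitive, so
     adding it leaves the integral unchanged and replaces [h] by the remainder. *)
  set (g := fun w : C => ((- (h (px, py) - d * (px, py))) * 1 + (- d) * w)%C).
  assert (Hg : forall w, c < Im w -> hol (fun w => (- (h (px, py) - d * (px, py))) * w + (- d / 2) * (w * w))%C w (g w)).
  { intros w _. eapply hol_eq; [ apply hol_plus; [ apply hol_scal, hol_id | apply hol_scal, hol_sqr ] | ].
    unfold g; field. }
  assert (Cg : cts_above c g).
  { intros w _. eapply hol_cts. unfold g. apply hol_plus; [ apply hol_const | apply hol_scal, hol_id ]. }
  assert (E : rect h (Re (s n)) (Re (s n) + wd n) (Im (s n)) (Im (s n) + hd n) =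
              rect (fun w => h w + g w)%C (Re (s n)) (Re (s n) + wd n) (Im (s n)) (Im (s n) + hd n)).
  { rewrite (rect_plus c) by (auto; assert (Q := hd0 n); lra).
    rewrite (rect_primitive c _ g _ _ _ _ Cg Hg) by (assert (Q := hd0 n); lra). ring. }
  assert (LE : L / 2 ^ n = wd n + hd n) by (unfold L, wd, hd; field; apply Rgt_not_eq, P2).
  assert (Bn : I n <= 2 * (eps * (L / 2 ^ n)) * (L / 2 ^ n)).
  { unfold I; rewrite E, LE.
    eapply Rle_trans; [ apply (rect_le c _ (eps * (wd n + hd n))) | ].
    - intros w Hw; apply cts_plus; [ apply H | apply Cg ]; auto.
    - lra.
    - assert (Q := wd0 n); lra.
    - assert (Q := hd0 n); lra.
    - intros x y Hxx Hyy.
      assert (D : Cmod ((x, y) - (px, py)) <= wd n + hd n).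
      { eapply Rle_trans; [ apply Cmod_le_abs | ]. assert (B1 := Hpx n). assert (B2 := Hpy n).
        cbv beta in B1, B2. unfold Re at 1, Im at 1; simpl.
        apply Rplus_le_compat; apply Rabs_le; lra. }
      assert (K' := K (x, y) ltac:(lra)).
      replace (h (x, y) + g (x, y))%C with (h (x, y) - h (px, py) - d * ((x, y) - (px, py)))%C
        by (unfold g; ring).
      eapply Rle_trans; [ exact K' | apply Rmult_le_compat_l; lra ].
    - right; ring. }
  eapply Rle_trans; [ exact B | ].
  assert (P4 : 4 ^ n = 2 ^ n * 2 ^ n) by (rewrite <- Rpow_mult_distr; f_equal; ring).
  apply Rle_trans with (4 ^ n * (2 * (eps * (L / 2 ^ n)) * (L / 2 ^ n))).
  { apply Rmult_le_compat_l; [ apply pow_le; lra | exact Bn ]. }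
  rewrite P4.
  replace (2 ^ n * 2 ^ n * (2 * (eps * (L / 2 ^ n)) * (L / 2 ^ n))) with (eps * (2 * L * L))
    by (field; apply Rgt_not_eq, P2).
  apply Rle_trans with (eps * (2 * L * L + 1)); [ apply Rmult_le_compat_l; lra | ].
  right; unfold eps; field. lra.
Qed.

Lemma Cint_point (g : R -> C) (a : R) : Cint g a a = 0.
Proof. unfold Cint; apply injective_projections; simpl; exact (RInt_point _ _). Qed.

Lemma rect_swap_x (c : R) (h : C -> C) (x1 x2 y1 y2 : R) : cts_above c h -> c < y1 -> c < y2 ->
  rect h x2 x1 y1 y2 = (- rect h x1 x2 y1 y2)%C.
Proof.
  intros H H1 H2.
  assert (E : rect h x1 x1 y1 y2 = 0) by (unfold rect; rewrite !Cint_point; ring).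
  rewrite (rect_split_x c h x1 x2) in E by auto.
  replace (rect h x2 x1 y1 y2) with (rect h x1 x2 y1 y2 + rect h x2 x1 y1 y2 - rect h x1 x2 y1 y2)%C by ring.
  rewrite E; ring.
Qed.

Lemma rect_swap_y (c : R) (h : C -> C) (x1 x2 y1 y2 : R) : cts_above c h -> c < y1 -> c < y2 ->
  rect h x1 x2 y2 y1 = (- rect h x1 x2 y1 y2)%C.
Proof.
  intros H H1 H2.
  assert (E : rect h x1 x2 y1 y1 = 0) by (unfold rect; rewrite !Cint_point; ring).
  rewrite (rect_split_y c h x1 x2 y1 y2) in E by auto.
  replace (rect h x1 x2 y2 y1) with (rect h x1 x2 y1 y2 + rect h x1 x2 y2 y1 - rect h x1 x2 y1 y2)%C by ring.
  rewrite E; ring.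
Qed.

(** Compactness of the vertical segment; used to compare two neighbouring vertical sides of a
    rectangle. *)
Lemma cts_line_unif (h : C -> C) (x a b : R) : (forall y, a <= y <= b -> cts h (x, y)) ->
  forall eps, 0 < eps -> exists del, 0 < del /\
    forall s y, a <= y <= b -> Rabs (s - x) < del -> Cmod (h (s, y) - h (x, y)) < eps.
Proof.
  intros H eps He.
  assert (Q : forall q : C -> R, (forall z w, Rabs (q z - q w) <= Cmod (z - w)) ->
    forall y, a <= y <= b -> continuity_2d_pt (fun u v => q (h (u, v))) x y).
  { intros q Hq y Hy e. destruct (H y Hy e (cond_pos e)) as [d [Hd K]].
    assert (Hd2 : 0 < d / 2) by lra.
    exists (mkposreal _ Hd2); simpl; intros u v Hu Hv.
    eapply Rle_lt_trans; [ apply Hq | apply K ].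
    eapply Rle_lt_trans; [ apply Cmod_le_abs | ].
    change (Rabs (u - x) + Rabs (v - y) < d). lra. }
  assert (He2 : 0 < eps / 2) by lra.
  destruct (uniform_continuity_2d_1d' _ a b x
    (Q Re (fun z w => re_le_Cmod (z - w))) (mkposreal _ He2)) as [d1 K1].
  destruct (uniform_continuity_2d_1d' _ a b x
    (Q Im (fun z w => im_le_Cmod (z - w))) (mkposreal _ He2)) as [d2 K2].
  assert (P1 := cond_pos d1). assert (P2 := cond_pos d2).
  exists (Rmin d1 d2); split; [ apply Rmin_pos; auto | intros s y Hy Hs ].
  assert (H1 := Rlt_le_trans _ _ _ Hs (Rmin_l _ _)).
  assert (H2 := Rlt_le_trans _ _ _ Hs (Rmin_r _ _)).
  apply Rabs_def2 in H1. apply Rabs_def2 in H2.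
  assert (Z : y - y = 0) by ring.
  assert (K1' := K1 y x y s Hy ltac:(lra) Hy ltac:(lra) ltac:(rewrite Z, Rabs_R0; auto)).
  assert (K2' := K2 y x y s Hy ltac:(lra) Hy ltac:(lra) ltac:(rewrite Z, Rabs_R0; auto)).
  simpl in K1', K2'.
  eapply Rle_lt_trans; [ apply Cmod_le_abs | ].
  change (Rabs (Re (h (s, y)) - Re (h (x, y))) + Rabs (Im (h (s, y)) - Im (h (x, y))) < eps). lra.
Qed.

(** As the width shrinks, the horizontal sides contribute little because they are short, and the two
    vertical sides nearly cancel by uniform continuity. No derivative is involved, so the strip may
    contain a point where none is known. *)
Lemma thin_rect (c : R) (h : C -> C) (x y1 y2 : R) : cts_above c h -> c < y1 -> y1 <= y2 ->
  forall eps, 0 < eps -> exists del, 0 < del /\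
    forall s, Rabs (s - x) < del -> Cmod (rect h x s y1 y2) <= eps.
Proof.
  intros H H1 H2 eps He.
  assert (HZ : forall y, c < y -> exists del, 0 < del /\
    forall s, Rabs (s - x) < del -> Cmod (Cint (fun t => h (t, y)) x s) < eps / 3).
  { intros y Hy.
    assert (K : ccts (fun s => Cint (fun t => h (t, y)) x s) x).
    { eapply cder_ccts; apply (Cint_cder _ (x - 1) (x + 1)); try lra.
      intros t _; eapply (cts_above_horiz c h y t t); eauto. rewrite Rmin_left, Rmax_left by lra; lra. }
    destruct (proj1 (ccts_eps _ _) K (eps / 3) ltac:(lra)) as [d [Hd Kd]].
    exists d; split; auto; intros s Hs; specialize (Kd s Hs).
    rewrite (Cint_point (fun t => h (t, y)) x) in Kd.
    replace (Cint (fun t : R => h (t, y)) x s - 0)%C with (Cint (fun t : R => h (t, y)) x s) in Kd by ring.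
    exact Kd. }
  destruct (HZ y1 H1) as [d1 [Hd1 K1]]. destruct (HZ y2 ltac:(lra)) as [d2 [Hd2 K2]].
  set (q := eps / (3 * (y2 - y1 + 1))).
  assert (Hq : 0 < q) by (apply Rdiv_lt_0_compat; lra).
  destruct (cts_line_unif h x y1 y2 ltac:(intros; apply H; simpl; lra) q Hq) as [d3 [Hd3 K3]].
  exists (Rmin d1 (Rmin d2 d3)); split; [ repeat apply Rmin_pos; auto | intros s Hs ].
  assert (L := Rmin_l d1 (Rmin d2 d3)). assert (L' := Rmin_r d1 (Rmin d2 d3)).
  assert (L2 := Rmin_l d2 d3). assert (L3 := Rmin_r d2 d3).
  specialize (K1 s ltac:(lra)). specialize (K2 s ltac:(lra)).
  assert (V : Cmod (Cint (fun t => h (s, t) + (-1) * h (x, t))%C y1 y2) <= q * (y2 - y1)).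
  { apply Cint_le; auto.
    - intros t Ht; apply ccts_plus; [ | apply ccts_mult; [ apply ccts_const | ] ];
        apply (cts_above_vert c h _ y1 y2); auto; lra.
    - intros t Ht. replace (h (s, t) + -1 * h (x, t))%C with (h (s, t) - h (x, t))%C by ring.
      apply Rlt_le, K3; auto; lra. }
  assert (C1 : forall r, ccts_on (fun t => h (r, t)) y1 y2)
    by (intros r; apply (cts_above_vert c); auto; lra).
  rewrite (Cint_plus (fun t => h (s, t)) (fun t => -1 * h (x, t))%C), (Cint_scal (-1)) in V; auto.
  2: { intros t Ht; apply ccts_mult; [ apply ccts_const | exact (C1 x t Ht) ]. }
  assert (Q : q * (y2 - y1) <= eps / 3).
  { apply Rle_trans with (q * (y2 - y1 + 1)); [ apply Rmult_le_compat_l; lra | ].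
    right; unfold q; field; lra. }
  unfold rect.
  replace (Cint (fun t => h (t, y1)) x s + Ci * Cint (fun t => h (s, t)) y1 y2 -
     Cint (fun t => h (t, y2)) x s - Ci * Cint (fun t => h (x, t)) y1 y2)%C
   with (Cint (fun t => h (t, y1)) x s + - Cint (fun t => h (t, y2)) x s +
      Ci * (Cint (fun t => h (s, t)) y1 y2 + -1 * Cint (fun t => h (x, t)) y1 y2))%C by ring.
  eapply Rle_trans; [ apply Cmod_tri3 | rewrite Cmod_opp, Cmod_mult, Cmod_Ci ]. lra.
Qed.

(** Cut the rectangle along the vertical line through [p]. Each half is a thin strip next to this
    line, negligible by [thin_rect], and a rectangle that avoids [p]. *)
Lemma goursat_except (c : R) (h : C -> C) (p : C) (x1 x2 y1 y2 : R) : cts_above c h ->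
  (forall w, c < Im w -> w <> p -> exists d, hol h w d) ->
  c < y1 -> y1 <= y2 -> x1 <= x2 -> rect h x1 x2 y1 y2 = 0.
Proof.
  intros H Hh H1 H2 Hx.
  assert (G : forall a b, a <= b -> Re p < a \/ b < Re p -> rect h a b y1 y2 = 0).
  { intros a b Hab Hp; apply (goursat c); auto. intros w Hw Hw'; apply Hh; [ lra | ].
    intros ->; lra. }
  assert (Lft : forall b, Re p <= b -> rect h (Re p) b y1 y2 = 0).
  { intros b Hb. apply Cmod_eq_0, Rle_antisym; [ | apply Cmod_ge_0 ].
    apply le_epsilon; intros e He; rewrite Rplus_0_l.
    destruct (thin_rect c h (Re p) y1 y2 H H1 H2 e He) as [d [Hd K]].
    destruct (Rle_lt_dec (b - Re p) (d / 2)) as [L | L].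
    - apply K. rewrite Rabs_pos_eq; lra.
    - rewrite (rect_split_x c h _ (Re p + d / 2)) by (auto; lra).
      rewrite (G (Re p + d / 2) b) by lra.
      replace (rect h (Re p) (Re p + d / 2) y1 y2 + 0)%C with (rect h (Re p) (Re p + d / 2) y1 y2) by ring.
      apply K. rewrite Rabs_pos_eq; lra. }
  assert (Rgt : forall a, a <= Re p -> rect h a (Re p) y1 y2 = 0).
  { intros b Hb. apply Cmod_eq_0, Rle_antisym; [ | apply Cmod_ge_0 ].
    apply le_epsilon; intros e He; rewrite Rplus_0_l.
    destruct (thin_rect c h (Re p) y1 y2 H H1 H2 e He) as [d [Hd K]].
    destruct (Rle_lt_dec (Re p - b) (d / 2)) as [L | L].
    - rewrite (rect_swap_x c), Cmod_opp by (auto; lra). apply K. rewrite Rabs_left1; lra.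
    - rewrite (rect_split_x c h _ (Re p - d / 2)) by (auto; lra).
      rewrite (G b (Re p - d / 2)) by lra.
      rewrite (rect_swap_x c h (Re p) (Re p - d / 2)) by (auto; lra).
      replace (0 + - rect h (Re p) (Re p - d / 2) y1 y2)%C with (- rect h (Re p) (Re p - d / 2) y1 y2)%C by ring.
      rewrite Cmod_opp. apply K. rewrite Rabs_left1; lra. }
  destruct (Rle_lt_dec (Re p) x1) as [L | L].
  - assert (E := Lft x2 ltac:(lra)).
    rewrite (rect_split_x c h _ x1), Lft in E by (auto; lra). rewrite <- E; ring.
  - destruct (Rle_lt_dec x2 (Re p)) as [L' | L'].
    + assert (E := Rgt x1 ltac:(lra)).
      rewrite (rect_split_x c h _ x2), (Rgt x2) in E by (auto; lra). rewrite <- E; ring.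
    + rewrite (rect_split_x c h _ (Re p)), Rgt, Lft by (auto; lra). ring.
Qed.

Lemma cder_ext (g k : R -> C) (t : R) (l : C) : (forall s, g s = k s) -> cder g t l -> cder k t l.
Proof.
  intros E [A B]; split; eapply is_derive_ext; try eassumption; intros; simpl; rewrite E; auto.
Qed.

(** Integrate from (0, c + 1) horizontally and then vertically. Since rectangle integrals vanish,
    the other order gives the same value; one expression yields the vertical partial derivative, the
    other the horizontal one. *)
Lemma primitive_except (c : R) (h : C -> C) (p : C) : cts_above c h ->
  (forall w, c < Im w -> w <> p -> exists d, hol h w d) ->
  exists Q, forall w, c < Im w -> hol Q w (h w).
Proof.
  intros H Hh.
  assert (Z : forall x1 x2 y1 y2, c < y1 -> c < y2 -> rect h x1 x2 y1 y2 = 0).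
  { assert (Z1 : forall x1 x2 y1 y2, c < y1 -> y1 <= y2 -> rect h x1 x2 y1 y2 = 0).
    { intros x1 x2 y1 y2 H1 H2. destruct (Rle_dec x1 x2) as [L | L].
      - apply (goursat_except c h p); auto.
      - rewrite (rect_swap_x c), (goursat_except c h p) by (auto; lra). ring. }
    intros x1 x2 y1 y2 H1 H2. destruct (Rle_dec y1 y2) as [L | L]; [ auto | ].
    rewrite (rect_swap_y c), Z1 by (auto; lra). ring. }
  set (Q := fun w : C => (Cint (fun t => h (t, c + 1)%R) 0 (Re w) +
                      Ci * Cint (fun t => h (Re w, t)) (c + 1) (Im w))%C).
  assert (Q2 : forall x y, c < y -> Q (x, y) =
     (Ci * Cint (fun t => h (0, t)) (c + 1) y + Cint (fun t => h (t, y)) 0 x)%C).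
  { intros x y Hy. assert (E := Z 0 x (c + 1) y ltac:(lra) Hy). unfold rect in E. unfold Q; simpl.
    match goal with |- ?a = ?b => replace a with (a - 0)%C by ring end.
    rewrite <- E; ring. }
  exists Q; intros z Hz.
  apply (hol_of_partials Q h z (Im z - c)); [ lra | apply H; auto | ].
  intros w Hw.
  assert (Hwc : c < Im w).
  { assert (B := im_le_Cmod (w - z)). change (Im (w - z)%C) with (Im w - Im z) in B.
    assert (B' := Rle_abs (- (Im w - Im z))). rewrite Rabs_Ropp in B'. lra. }
  split.
  - apply (cder_ext (fun t => Ci * Cint (fun t => h (0, t)) (c + 1) (Im w) + Cint (fun t => h (t, Im w)) 0 t)%C).
    { intros s; rewrite Q2; auto. }
    eapply cder_eq; [ apply cder_plus; [ apply cder_const | ] | ].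
    + apply (Cint_cder (fun t => h (t, Im w)) (- (Rabs (Re w) + 1)) (Rabs (Re w) + 1)).
      * assert (B := Rabs_pos (Re w)); lra.
      * assert (B1 := Rle_abs (Re w)). assert (B2 := Rle_abs (- Re w)). rewrite Rabs_Ropp in B2. lra.
      * intros t _; eapply (cts_above_horiz c h (Im w) t t); auto. rewrite Rmin_left, Rmax_left by lra; lra.
    + simpl. replace (Re w, Im w) with w by (destruct w; reflexivity). ring.
  - eapply cder_eq.
    + apply (cder_plus (fun _ => Cint (fun t => h (t, c + 1)%R) 0 (Re w))); [ apply cder_const | ].
      apply cder_scal. apply (Cint_cder (fun t => h (Re w, t)) c (Rmax (c + 1) (Im w) + 1)).
      * assert (B := Rmax_l (c + 1) (Im w)); lra.
      * assert (B := Rmax_r (c + 1) (Im w)); simpl; lra.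
      * intros t Ht; eapply (cts_above_vert c h (Re w) t t); try tauto. rewrite Rmin_left, Rmax_left by lra; lra.
    + simpl. replace (Re w, Im w) with w by (destruct w; reflexivity). ring.
Qed.

Lemma holo_primitive (c : R) (h : C -> C) : (forall w, c < Im w -> exists d, hol h w d) ->
  exists Q, forall w, c < Im w -> hol Q w (h w).
Proof.
  (* There is no exceptional point here; 0 is an arbitrary choice. *)
  intros H; apply (primitive_except c h 0); [ | auto ].
  intros w Hw; destruct (H w Hw) as [d Hd]; eapply hol_cts; exact Hd.
Qed.

(** * Cauchy's integral formula *)

Lemma ccts_inv (g : R -> C) (t : R) : ccts g t -> g t <> 0 -> ccts (fun s => / g s)%C t.
Proof. intros H N; apply (cts_ccts Cinv); auto. eapply hol_cts; apply hol_inv; auto. Qed.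

Lemma hol_pow (n : nat) (z : C) : hol (fun w => w ^ S n)%C z (INR (S n) * z ^ n)%C.
Proof.
  induction n as [ | n IH].
  - apply (hol_ext_loc (fun w => w)) with (r := 1); [ lra | intros; simpl; ring | ].
    eapply hol_eq; [ apply hol_id | simpl; ring ].
  - apply (hol_ext_loc (fun w => w * w ^ S n)%C) with (r := 1); [ lra | reflexivity | ].
    eapply hol_eq; [ apply hol_mult; [ apply hol_id | exact IH ] | ].
    rewrite (S_INR (S n)), RtoC_plus. simpl; ring.
Qed.

Lemma ccts_pow (g : R -> C) (n : nat) (t : R) : ccts g t -> ccts (fun s => g s ^ n)%C t.
Proof.
  intros H; induction n as [ | n IH]; [ apply ccts_const | ].
  apply (ccts_mult g (fun s => g s ^ n)%C); auto.
Qed.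

Definition circ (R0 t : R) : C := (R0 * cos t, R0 * sin t).

Lemma circ_cder (R0 t : R) : cder (circ R0) t (Ci * circ R0 t).
Proof. split; unfold circ; simpl; auto_derive; auto; ring. Qed.

Lemma circ_mod (R0 t : R) : 0 < R0 -> Cmod (circ R0 t) = R0.
Proof.
  intros H; unfold Cmod, circ; simpl.
  replace (R0 * cos t * (R0 * cos t * 1) + R0 * sin t * (R0 * sin t * 1))
    with (R0 * R0 * (Rsqr (sin t) + Rsqr (cos t))) by (unfold Rsqr; ring).
  rewrite sin2_cos2, Rmult_1_r. apply sqrt_square; lra.
Qed.

Lemma circ_neq (R0 t : R) (u : C) : Cmod u < R0 -> (circ R0 t - u)%C <> 0.
Proof.
  intros H E. assert (Q : Cmod (circ R0 t) = Cmod u) by (f_equal; rewrite <- (Cplus_0_l u), <- E; ring).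
  assert (B := Cmod_ge_0 u). rewrite circ_mod in Q; lra.
Qed.

Lemma circ_neq0 (R0 t : R) : 0 < R0 -> circ R0 t <> 0.
Proof. intros H; apply Cmod_gt_0; rewrite circ_mod; auto. Qed.

Lemma circ_per (R0 : R) : circ R0 (2 * PI) = circ R0 0.
Proof. unfold circ. rewrite cos_2PI, sin_2PI, cos_0, sin_0; auto. Qed.

(** With zeta = [circ R0 t] and d zeta = i zeta dt, this is 1/i times the contour integral of F
    zeta^(-n) / (zeta - u). At u = 0 it is 2 pi times the n-th Taylor coefficient when [F] is the
    boundary value of a holomorphic function. *)
Definition cauchy_int (R0 : R) (F : R -> C) (n : nat) (u : C) : C :=
  Cint (fun t => F t * (/ circ R0 t) ^ n * (circ R0 t / (circ R0 t - u)))%C 0 (2 * PI).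

Lemma cauchy_int_ccts (R0 : R) (F : R -> C) (n : nat) (u : C) : 0 < R0 -> Cmod u < R0 ->
  ccts_on F 0 (2 * PI) ->
  ccts_on (fun t => F t * (/ circ R0 t) ^ n * (circ R0 t / (circ R0 t - u)))%C 0 (2 * PI).
Proof.
  intros HR Hu HF t Ht.
  assert (E : ccts (circ R0) t) by (eapply cder_ccts; apply circ_cder).
  apply ccts_mult; [ apply ccts_mult; [ exact (HF t Ht) | ] | apply ccts_mult; [ exact E | ] ].
  - apply ccts_pow, ccts_inv; auto. apply circ_neq0; auto.
  - apply (ccts_inv (fun s => circ R0 s - u)%C); [ | apply circ_neq; auto ].
    apply ccts_plus; [ exact E | apply ccts_const ].
Qed.

(** One step of the geometric series, zeta / (zeta - u) = 1 + (u / zeta) * zeta / (zeta - u): a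
    Taylor expansion with one term and an exact remainder. *)
Lemma cauchy_int_rec (R0 : R) (F : R -> C) (n : nat) (u : C) : 0 < R0 -> Cmod u < R0 ->
  ccts_on F 0 (2 * PI) ->
  cauchy_int R0 F n u = (cauchy_int R0 F n 0 + u * cauchy_int R0 F (S n) u)%C.
Proof.
  intros HR Hu HF; unfold cauchy_int.
  assert (H0 : Cmod 0 < R0) by (rewrite Cmod_0; auto).
  rewrite <- Cint_scal by (apply cauchy_int_ccts; auto).
  rewrite <- Cint_plus.
  - apply Cint_ext; intros t _.
    assert (N1 := circ_neq0 R0 t HR). assert (N2 := circ_neq R0 t u Hu). simpl.
    assert (N3 : (circ R0 t - 0)%C <> 0) by (replace (circ R0 t - 0)%C with (circ R0 t) by ring; auto).
    field; auto.
  - apply cauchy_int_ccts; auto.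
  - intros t Ht; apply ccts_mult; [ apply ccts_const | apply (cauchy_int_ccts R0 F (S n) u); auto ].
Qed.

Lemma cauchy_int_le (R0 B : R) (F : R -> C) (n : nat) (u : C) : 0 < R0 -> Cmod u < R0 ->
  ccts_on F 0 (2 * PI) -> (forall t, 0 <= t <= 2 * PI -> Cmod (F t) <= B) ->
  Cmod (cauchy_int R0 F n u) <= B * (/ R0) ^ n * (R0 / (R0 - Cmod u)) * (2 * PI).
Proof.
  intros HR Hu HF HB.
  assert (P := PI_RGT_0).
  replace (B * (/ R0) ^ n * (R0 / (R0 - Cmod u)) * (2 * PI)) with
    (B * (/ R0) ^ n * (R0 / (R0 - Cmod u)) * (2 * PI - 0)) by ring.
  apply Cint_le; [ lra | apply cauchy_int_ccts; auto | ].
  intros t Ht. assert (N1 := circ_neq0 R0 t HR). assert (N2 := circ_neq R0 t u Hu).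
  assert (B0 : 0 <= B) by (eapply Rle_trans; [ apply Cmod_ge_0 | apply (HB t Ht) ]).
  unfold Cdiv; rewrite !Cmod_mult, Cmod_pow, !Cmod_inv, !circ_mod by auto.
  assert (L : R0 - Cmod u <= Cmod (circ R0 t - u)).
  { rewrite <- (circ_mod R0 t) at 1 by auto. apply Cmod_sub_ge. }
  assert (0 < / R0) by (apply Rinv_0_lt_compat; auto).
  assert (0 < (/ R0) ^ n) by (apply pow_lt; auto).
  apply Rmult_le_compat.
  - apply Rmult_le_pos; [ apply Cmod_ge_0 | lra ].
  - apply Rmult_le_pos; [ lra | apply Rlt_le, Rinv_0_lt_compat; lra ].
  - apply Rmult_le_compat_r; [ lra | auto ].
  - apply Rmult_le_compat_l; [ lra | apply Rinv_le_contravar; lra ].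
Qed.

Lemma ccts_on_bounded (F : R -> C) (a b : R) : a <= b -> ccts_on F a b ->
  exists B, 0 <= B /\ forall t, a <= t <= b -> Cmod (F t) <= B.
Proof.
  intros Hab H.
  destruct (continuity_ab_maj (fun t => Cmod (F t)) a b Hab) as [m [Hm _]].
  - intros t Ht. apply continuity_pt_filterlim, continuous_eps.
    intros e He. assert (K := H t ltac:(rewrite Rmin_left, Rmax_right; lra)).
    destruct (proj1 (ccts_eps _ _) K e He) as [d [Hd K']]. exists d; split; auto.
    intros s Hs; eapply Rle_lt_trans; [ | apply (K' s Hs) ].
    apply Rabs_le; split.
    + assert (Q := Cmod_sub_ge (F t) (F s)). rewrite Cmod_sub_sym in Q. lra.
    + apply Cmod_sub_ge.
  - exists (Cmod (F m)); split; [ apply Cmod_ge_0 | auto ].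
Qed.

Lemma geom_small (q C0 e : R) : 0 <= q < 1 -> 0 < e -> exists n, C0 * q ^ n < e.
Proof.
  intros Hq He. destruct (pow_lt_1_zero q ltac:(rewrite Rabs_pos_eq; lra) (e / (Rabs C0 + 1))) as [n Hn].
  { apply Rdiv_lt_0_compat; auto. assert (Q := Rabs_pos C0); lra. }
  exists n; specialize (Hn n (le_n n)). assert (P := pow_le q n (proj1 Hq)).
  rewrite Rabs_pos_eq in Hn by auto.
  assert (Q := Rabs_pos C0). assert (Q1 := Rle_abs C0).
  apply (Rmult_lt_compat_l (Rabs C0 + 1)) in Hn; [ | lra ].
  replace ((Rabs C0 + 1) * (e / (Rabs C0 + 1))) with e in Hn by (field; lra). nra.
Qed.

(** With all coefficients from [m] on equal to zero, iterating the expansion n times leaves only the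
    remainder, which is O((|u| / R0)^n). *)
Lemma cauchy_int_vanish (R0 : R) (F : R -> C) (m : nat) (u : C) : 0 < R0 -> Cmod u < R0 ->
  ccts_on F 0 (2 * PI) -> (forall j, (m <= j)%nat -> cauchy_int R0 F j 0 = 0) ->
  cauchy_int R0 F m u = 0.
Proof.
  intros HR Hu HF Hc.
  assert (P := PI_RGT_0).
  destruct (ccts_on_bounded F 0 (2 * PI) ltac:(lra) HF) as [B [HB0 HB]].
  assert (E : forall n, cauchy_int R0 F m u = (u ^ n * cauchy_int R0 F (m + n) u)%C).
  { induction n as [ | n IH].
    - rewrite Nat.add_0_r; simpl; ring.
    - rewrite IH, (cauchy_int_rec R0 F (m + n)), Hc by (auto; lia).
      replace (m + S n)%nat with (S (m + n)) by lia. simpl; ring. }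
  apply Cmod_eq_0, Rle_antisym; [ | apply Cmod_ge_0 ].
  apply le_epsilon; intros e He; rewrite Rplus_0_l.
  assert (U := Cmod_ge_0 u).
  assert (Ri : 0 < / R0) by (apply Rinv_0_lt_compat; auto).
  destruct (geom_small (Cmod u * / R0) (B * (/ R0) ^ m * (R0 / (R0 - Cmod u)) * (2 * PI)) e) as [n Hn]; auto.
  { split; [ apply Rmult_le_pos; lra | ]. apply (Rmult_lt_reg_r R0); auto.
    rewrite Rmult_assoc, Rinv_l; lra. }
  rewrite (E n), Cmod_mult, Cmod_pow.
  apply Rlt_le; eapply Rle_lt_trans; [ | exact Hn ].
  eapply Rle_trans; [ apply Rmult_le_compat_l; [ apply pow_le; auto | apply cauchy_int_le; eauto ] | ].
  right. rewrite pow_add, Rpow_mult_distr. ring.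
Qed.

(** For j >= 1 the function zeta^(-j) has a 2 pi-periodic primitive in t, so its coefficient
    vanishes; only the constant term contributes. *)
Lemma cauchy_int_one (R0 : R) (u : C) : 0 < R0 -> Cmod u < R0 ->
  cauchy_int R0 (fun _ => RtoC 1) 0 u = RtoC (2 * PI).
Proof.
  intros HR Hu.
  assert (H1 : ccts_on (fun _ => RtoC 1) 0 (2 * PI)) by (intros t _; apply ccts_const).
  assert (H0 : Cmod 0 < R0) by (rewrite Cmod_0; auto).
  assert (Z : forall j, (1 <= j)%nat -> cauchy_int R0 (fun _ => RtoC 1) j 0 = 0).
  { intros [ | j] Hj; [ lia | unfold cauchy_int ].
    assert (Nj : RtoC (INR (S j)) <> 0).
    { intros Q; apply RtoC_inj in Q; revert Q; apply not_0_INR; lia. }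
    assert (NC : Ci <> 0) by (intros Q; apply (f_equal Im) in Q; simpl in Q; lra).
    rewrite (Cint_FTC (fun t => - / (Ci * INR (S j)) * (/ circ R0 t) ^ S j)%C).
    - rewrite circ_per; ring.
    - intros t _. assert (N := circ_neq0 R0 t HR).
      assert (N3 : (circ R0 t - 0)%C <> 0) by (replace (circ R0 t - 0)%C with (circ R0 t) by ring; auto).
      eapply cder_eq.
      + apply cder_scal.
        apply (cder_hol (fun w => (/ w) ^ S j)%C (circ R0) t); [ apply circ_cder | ].
        apply (hol_comp (fun w => w ^ S j)%C Cinv); [ apply hol_inv; auto | apply hol_pow ].
      + change ((/ circ R0 t) ^ S j)%C with (/ circ R0 t * (/ circ R0 t) ^ j)%C.
        field. repeat split; auto.
    - apply cauchy_int_ccts; auto. }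
  rewrite cauchy_int_rec by auto.
  rewrite (cauchy_int_vanish R0 _ 1 u) by auto.
  unfold cauchy_int. rewrite (Cint_ext _ (fun _ => RtoC 1)).
  - rewrite (Cint_FTC RtoC).
    + rewrite RtoC_mult; ring.
    + intros t _; apply cder_RtoC.
    + auto.
  - intros t _. assert (N := circ_neq0 R0 t HR). simpl.
    assert (N3 : (circ R0 t - 0)%C <> 0) by (replace (circ R0 t - 0)%C with (circ R0 t) by ring; auto).
    field; auto.
Qed.

Lemma circ_above (c R0 t : R) (z0 : C) : 0 < R0 -> c < Im z0 - R0 -> c < Im (z0 + circ R0 t)%C.
Proof.
  intros HR Hc. assert (B := im_le_Cmod (circ R0 t)). rewrite circ_mod in B by auto.
  assert (B' := Rle_abs (- Im (circ R0 t))). rewrite Rabs_Ropp in B'.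
  change (c < Im z0 + Im (circ R0 t)). lra.
Qed.

Lemma holo_circ_ccts (c R0 : R) (D : C -> C) (z0 : C) : 0 < R0 -> c < Im z0 - R0 ->
  (forall w, c < Im w -> exists d, hol D w d) ->
  ccts_on (fun t => D (z0 + circ R0 t)%C) 0 (2 * PI).
Proof.
  intros HR Hc H t _. apply (cts_ccts D (fun t => z0 + circ R0 t)%C).
  - apply ccts_plus; [ apply ccts_const | eapply cder_ccts; apply circ_cder ].
  - destruct (H (z0 + circ R0 t)%C) as [d Hd]; [ apply circ_above; auto | ].
    eapply hol_cts; exact Hd.
Qed.

(* The difference quotient [(D w - D z) / (w - z)], extended by [D' z] at [z], is continuous and
   holomorphic off [z], hence has a primitive, hence integrates to zero around the circle. *)
Lemma cauchy_formula (c R0 : R) (D : C -> C) (z0 u : C) : 0 < R0 -> c < Im z0 - R0 ->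
  Cmod u < R0 -> (forall w, c < Im w -> exists d, hol D w d) ->
  cauchy_int R0 (fun t => D (z0 + circ R0 t)%C) 0 u = (RtoC (2 * PI) * D (z0 + u))%C.
Proof.
  intros HR Hc Hu H. set (z := (z0 + u)%C).
  assert (Hz : c < Im z).
  { assert (B := im_le_Cmod u). assert (B' := Rle_abs (- Im u)). rewrite Rabs_Ropp in B'.
    change (c < Im z0 + Im u). lra. }
  destruct (H z Hz) as [d Hd].
  set (G := fun w => if Ceq_dec w z then d else ((D w - D z) / (w - z))%C).
  assert (Goff : forall w, w <> z -> G w = ((D w - D z) / (w - z))%C).
  { intros w Hw; unfold G; destruct (Ceq_dec w z); [ contradiction | reflexivity ]. }
  assert (Gz : G z = d) by (unfold G; destruct (Ceq_dec z z); [ reflexivity | contradiction ]).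
  assert (NZ : forall w, w <> z -> (w - z)%C <> 0).
  { intros w Hw E; apply Hw. replace w with (w - z + z)%C by ring. rewrite E; ring. }
  assert (Hol : forall w, c < Im w -> w <> z -> exists e, hol G w e).
  { intros w Hw Nw. destruct (H w Hw) as [e He].
    assert (Pw : 0 < Cmod (w - z)) by (apply Cmod_gt_0; auto).
    eexists. apply (hol_ext_loc (fun v => (D v - D z) * / (v - z))%C) with (r := Cmod (w - z)); auto.
    - intros v Hv. rewrite Goff; auto. intros ->. rewrite Cmod_sub_sym in Hv. lra.
    - apply hol_mult.
      + apply hol_minus; [ exact He | apply hol_const ].
      + apply (hol_comp Cinv (fun v => v - z)%C).
        * apply hol_minus; [ apply hol_id | apply hol_const ].
        * apply hol_inv; auto. }
  assert (GC : cts_above c G).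
  { intros w Hw. destruct (Ceq_dec w z) as [-> | N].
    - intros e He. destruct (Hd (e / 2) ltac:(lra)) as [del [Hdel K]].
      exists del; split; auto; intros v Hv. rewrite Gz. destruct (Ceq_dec v z) as [-> | N].
      + rewrite Gz. replace (d - d)%C with (RtoC 0) by ring. rewrite Cmod_0; auto.
      + rewrite (Goff v N). assert (Pv : 0 < Cmod (v - z)) by (apply Cmod_gt_0; auto).
        replace ((D v - D z) / (v - z) - d)%C with ((D v - D z - d * (v - z)) / (v - z))%C
          by (field; auto).
        rewrite Cmod_div by auto. apply (Rmult_lt_reg_r (Cmod (v - z))); auto.
        unfold Rdiv; rewrite Rmult_assoc, Rinv_l, Rmult_1_r by lra.
        eapply Rle_lt_trans; [ apply K; auto | ]. apply Rmult_lt_compat_r; lra.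
    - destruct (Hol w Hw N) as [e He]; eapply hol_cts; exact He. }
  destruct (primitive_except c G z GC Hol) as [Q HQ].
  assert (FC := holo_circ_ccts c R0 D z0 HR Hc H).
  assert (OC : ccts_on (fun _ => RtoC 1) 0 (2 * PI)) by (intros t _; apply ccts_const).
  assert (GG : ccts_on (fun t => G (z0 + circ R0 t)%C) 0 (2 * PI)).
  { intros t _. apply (cts_ccts G (fun t => z0 + circ R0 t)%C).
    - apply ccts_plus; [ apply ccts_const | eapply cder_ccts; apply circ_cder ].
    - apply GC, circ_above; auto. }
  assert (I0 : Cint (fun t => Ci * (G (z0 + circ R0 t) * circ R0 t))%C 0 (2 * PI) = 0).
  { rewrite (Cint_FTC (fun t => Q (z0 + circ R0 t)%C)).
    - rewrite circ_per; ring.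
    - intros t _. eapply cder_eq.
      + apply (cder_hol Q (fun t => z0 + circ R0 t)%C).
        * apply cder_plus; [ apply cder_const | apply circ_cder ].
        * apply HQ, circ_above; auto.
      + ring.
    - intros t Ht; apply ccts_mult; [ apply ccts_const | apply ccts_mult ].
      + apply GG; auto.
      + eapply cder_ccts; apply circ_cder. }
  rewrite Cint_scal in I0.
  2: { intros t Ht; apply ccts_mult; [ apply GG; auto | eapply cder_ccts; apply circ_cder ]. }
  assert (I1 : Cint (fun t => G (z0 + circ R0 t) * circ R0 t)%C 0 (2 * PI) = 0).
  { replace (Cint (fun t => G (z0 + circ R0 t) * circ R0 t)%C 0 (2 * PI)) with
      (- Ci * (Ci * Cint (fun t => G (z0 + circ R0 t) * circ R0 t)%C 0 (2 * PI)))%C.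
    - rewrite I0; ring.
    - assert (E : (Ci * Ci = -1)%C) by (apply injective_projections; simpl; ring).
      replace (- Ci * (Ci * Cint (fun t => G (z0 + circ R0 t) * circ R0 t)%C 0 (2 * PI)))%C
       with (- (Ci * Ci) * Cint (fun t => G (z0 + circ R0 t) * circ R0 t)%C 0 (2 * PI))%C by ring.
      rewrite E; ring. }
  (* On the circle the difference quotient separates into the Cauchy kernel applied to [D] and -D z
     times the kernel applied to 1, which is known. *)
  rewrite (Cint_ext _ (fun t => D (z0 + circ R0 t)%C * (/ circ R0 t) ^ 0 * (circ R0 t / (circ R0 t - u))
       + (- D z) * (1 * (/ circ R0 t) ^ 0 * (circ R0 t / (circ R0 t - u))))%C) in I1.
  - rewrite Cint_plus in I1.
    + rewrite Cint_scal in I1 by (apply (cauchy_int_ccts R0 (fun _ => RtoC 1) 0 u); auto).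
      fold (cauchy_int R0 (fun t => D (z0 + circ R0 t)%C) 0 u) in I1.
      fold (cauchy_int R0 (fun _ => RtoC 1) 0 u) in I1.
      rewrite cauchy_int_one in I1 by auto.
      replace (cauchy_int R0 (fun t => D (z0 + circ R0 t)%C) 0 u) with
       (cauchy_int R0 (fun t => D (z0 + circ R0 t)%C) 0 u + - D z * RtoC (2 * PI) + D z * RtoC (2 * PI))%C by ring.
      rewrite I1; ring.
    + apply cauchy_int_ccts; auto.
    + intros t Ht; apply ccts_mult; [ apply ccts_const | ].
      apply (cauchy_int_ccts R0 (fun _ => RtoC 1) 0 u); auto.
  - intros t _. assert (N2 := circ_neq R0 t u Hu). rewrite Goff.
    + unfold z at 2. replace (z0 + circ R0 t - (z0 + u))%C with (circ R0 t - u)%C by ring.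
      simpl. field; auto.
    + intros E. apply N2. unfold z in E.
      replace (circ R0 t - u)%C with (z0 + circ R0 t - (z0 + u))%C by ring. rewrite E; ring.
Qed.

(** The difference D(z0 + u) - D(z0) is u times the remainder integral of index 1. The factor 2,
    absent from the sharp estimate, bounds R0 / (R0 - |u|) for |u| <= R0 / 2; it then passes to the
    derivative by a small real increment. *)
Lemma cauchy_estimate (c R0 B : R) (D : C -> C) (z0 d : C) : 0 < R0 -> c < Im z0 - R0 ->
  (forall w, c < Im w -> exists d, hol D w d) ->
  (forall w, Cmod (w - z0) = R0 -> Cmod (D w) <= B) ->
  hol D z0 d -> Cmod d <= 2 * B / R0.
Proof.
  intros HR Hc H HB Hd. assert (P := PI_RGT_0).
  assert (FC := holo_circ_ccts c R0 D z0 HR Hc H).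
  assert (L : forall u, Cmod u <= R0 / 2 -> Cmod (D (z0 + u)%C - D z0) <= Cmod u * (2 * B / R0)).
  { intros u Hu.
    assert (E := cauchy_formula c R0 D z0 u HR Hc ltac:(lra) H).
    assert (H0 : Cmod 0 < R0) by (rewrite Cmod_0; auto).
    assert (E0 := cauchy_formula c R0 D z0 0 HR Hc H0 H).
    rewrite cauchy_int_rec, E0 in E by (auto; lra).
    replace (z0 + 0)%C with z0 in E by ring.
    assert (Q : (RtoC (2 * PI) * (D (z0 + u)%C - D z0) = u * cauchy_int R0 (fun t => D (z0 + circ R0 t)%C) 1 u)%C).
    { replace (RtoC (2 * PI) * (D (z0 + u)%C - D z0))%C with
        (RtoC (2 * PI) * D (z0 + u)%C - RtoC (2 * PI) * D z0)%C by ring.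
      rewrite <- E; ring. }
    apply (f_equal Cmod) in Q. rewrite !Cmod_mult, Cmod_R, Rabs_pos_eq in Q by lra.
    assert (K := cauchy_int_le R0 B (fun t => D (z0 + circ R0 t)%C) 1 u HR ltac:(lra) FC).
    assert (K' := K ltac:(intros t _; apply HB; replace (z0 + circ R0 t - z0)%C with (circ R0 t) by ring;
                          apply circ_mod; auto)).
    assert (B0 : 0 <= B).
    { eapply Rle_trans; [ apply Cmod_ge_0 | apply (HB (z0 + RtoC R0)%C) ].
      replace (z0 + R0 - z0)%C with (RtoC R0) by ring. rewrite Cmod_R; apply Rabs_pos_eq; lra. }
    assert (U := Cmod_ge_0 u).
    apply (Rmult_le_reg_l (2 * PI)); [ lra | ]. rewrite Q.
    replace (2 * PI * (Cmod u * (2 * B / R0))) with (Cmod u * (B * / R0 * 2 * (2 * PI))) by (field; lra).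
    apply Rmult_le_compat_l; auto.
    eapply Rle_trans; [ exact K' | ]. simpl. rewrite Rmult_1_r.
    apply Rmult_le_compat_r; [ lra | ]. apply Rmult_le_compat_l.
    - apply Rmult_le_pos; auto. apply Rlt_le, Rinv_0_lt_compat; auto.
    - apply (Rmult_le_reg_r (R0 - Cmod u)); [ lra | ]. unfold Rdiv.
      rewrite Rmult_assoc, Rinv_l by lra. lra. }
  apply le_epsilon; intros e He.
  destruct (Hd e He) as [del [Hdel K]].
  set (r := Rmin (del / 2) (R0 / 2)).
  assert (Hr : 0 < r) by (apply Rmin_pos; lra).
  assert (R1 : r <= del / 2) by apply Rmin_l. assert (R2 : r <= R0 / 2) by apply Rmin_r.
  assert (Mr : Cmod (RtoC r) = r) by (rewrite Cmod_R; apply Rabs_pos_eq; lra).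
  specialize (K (z0 + RtoC r)%C). specialize (L (RtoC r) ltac:(lra)).
  replace (z0 + r - z0)%C with (RtoC r) in K by ring. rewrite Mr in K, L.
  specialize (K ltac:(lra)).
  apply (Rmult_le_reg_r r); auto.
  replace (Cmod d * r) with (Cmod (d * RtoC r)%C) by (rewrite Cmod_mult, Mr; reflexivity).
  replace (d * RtoC r)%C with ((D (z0 + r)%C - D z0) + - (D (z0 + r)%C - D z0 - d * r))%C by ring.
  eapply Rle_trans; [ apply Cmod_triangle | rewrite Cmod_opp ]. lra.
Qed.

(** By induction on n, the n-th remainder integral vanishes at every real r in (0, R0): letting r
    tend to 0 kills the n-th coefficient, and then division by r gives the statement for n + 1. Once
    all coefficients vanish, so does [D] in the disc. *)
Lemma entire_identity (D : C -> C) (s0 : R) : (forall w, exists d, hol D w d) ->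
  (forall x : R, s0 < x -> D (RtoC x) = 0) -> forall x : R, D (RtoC x) = 0.
Proof.
  intros H HZ x. assert (P := PI_RGT_0).
  (* The centre [x1] lies beyond [s0], so [D] vanishes at x1 + r for every r > 0, and the radius is
     large enough for the disc to contain [x]. *)
  set (x1 := Rmax s0 x + 1). set (R0 := Rabs (x - x1) + 1).
  assert (X1 : s0 < x1) by (unfold x1; assert (Q := Rmax_l s0 x); lra).
  assert (HR : 0 < R0) by (unfold R0; assert (Q := Rabs_pos (x - x1)); lra).
  set (F := fun t => D (RtoC x1 + circ R0 t)%C).
  assert (Hc : - (R0 + 1) < Im (RtoC x1) - R0) by (simpl; lra).
  assert (H' : forall w, - (R0 + 1) < Im w -> exists d, hol D w d) by auto.
  assert (FC : ccts_on F 0 (2 * PI)) by exact (holo_circ_ccts _ R0 D x1 HR Hc H').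
  assert (H0 : Cmod 0 < R0) by (rewrite Cmod_0; auto).
  destruct (ccts_on_bounded F 0 (2 * PI) ltac:(lra) FC) as [B [HB0 HB]].
  assert (MR : forall r, 0 < r -> Cmod (RtoC r) = r) by (intros; rewrite Cmod_R; apply Rabs_pos_eq; lra).
  assert (Step : forall n, forall r, 0 < r < R0 -> cauchy_int R0 F n (RtoC r) = 0).
  { induction n as [ | n IH].
    - intros r Hr. unfold F. rewrite (cauchy_formula _ R0 D x1 (RtoC r) HR Hc); auto.
      + rewrite <- RtoC_plus, HZ by lra. ring.
      + rewrite MR; lra.
    (* The recursion at r reads 0 = c_n + r * (remainder), and the remainder is bounded by [K] for r
       <= R0 / 2; let r tend to 0. *)
    - assert (Z : cauchy_int R0 F n 0 = 0).
      { apply Cmod_eq_0, Rle_antisym; [ | apply Cmod_ge_0 ].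
        apply le_epsilon; intros e He; rewrite Rplus_0_l.
        set (K := B * (/ R0) ^ S n * 2 * (2 * PI)).
        assert (Ki : 0 < / R0) by (apply Rinv_0_lt_compat; auto).
        assert (K0 : 0 <= K).
        { unfold K. apply Rmult_le_pos; [ apply Rmult_le_pos; [ apply Rmult_le_pos; [ lra | apply pow_le; lra ] | lra ] | lra ]. }
        set (r := Rmin (R0 / 2) (e / (K + 1))).
        assert (Hr : 0 < r) by (apply Rmin_pos; [ lra | apply Rdiv_lt_0_compat; lra ]).
        assert (R1 : r <= R0 / 2) by apply Rmin_l. assert (R2 : r <= e / (K + 1)) by apply Rmin_r.
        assert (E := IH r ltac:(lra)). rewrite cauchy_int_rec in E by (auto; rewrite MR; lra).
        replace (cauchy_int R0 F n 0) with (- (RtoC r * cauchy_int R0 F (S n) (RtoC r)))%C.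
        2: { replace (cauchy_int R0 F n 0) with (cauchy_int R0 F n 0 +
             RtoC r * cauchy_int R0 F (S n) (RtoC r) - RtoC r * cauchy_int R0 F (S n) (RtoC r))%C by ring.
             rewrite E; ring. }
        rewrite Cmod_opp, Cmod_mult, MR by auto.
        assert (L := cauchy_int_le R0 B F (S n) (RtoC r) HR ltac:(rewrite MR; lra) FC HB).
        rewrite MR in L by auto.
        assert (L2 : B * (/ R0) ^ S n * (R0 / (R0 - r)) * (2 * PI) <= K).
        { unfold K. apply Rmult_le_compat_r; [ lra | ]. apply Rmult_le_compat_l.
          - apply Rmult_le_pos; auto. apply pow_le; lra.
          - apply (Rmult_le_reg_r (R0 - r)); [ lra | ]. unfold Rdiv.
            rewrite Rmult_assoc, Rinv_l by lra. lra. }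
        apply Rle_trans with (e / (K + 1) * (K + 1)).
        - apply Rmult_le_compat; try lra. apply Cmod_ge_0.
        - right; field; lra. }
      intros r Hr. assert (E := IH r Hr).
      rewrite cauchy_int_rec, Z in E by (auto; rewrite MR; lra).
      assert (Nr : RtoC r <> 0) by (apply Cmod_gt_0; rewrite MR by lra; lra).
      replace (cauchy_int R0 F (S n) (RtoC r)) with
        (/ RtoC r * (0 + RtoC r * cauchy_int R0 F (S n) (RtoC r)))%C by (field; auto).
      rewrite E; ring. }
  assert (Z : forall j, cauchy_int R0 F j 0 = 0).
  { intros j. assert (E := Step j (R0 / 2) ltac:(lra)).
    rewrite cauchy_int_rec, (Step (S j) (R0 / 2)) in E by (auto; try rewrite MR; lra).
    replace (cauchy_int R0 F j 0) with (cauchy_int R0 F j 0 + RtoC (R0 / 2) * 0)%C by ring. exact E. }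
  assert (Hu : Cmod (RtoC (x - x1)) < R0) by (rewrite Cmod_R; unfold R0; lra).
  assert (V := cauchy_int_vanish R0 F 0 (RtoC (x - x1)) HR Hu FC (fun j _ => Z j)).
  unfold F in V. rewrite (cauchy_formula _ R0 D x1 _ HR Hc) in V by auto.
  rewrite <- RtoC_plus in V. replace (x1 + (x - x1)) with x in V by ring.
  assert (N : RtoC (2 * PI) <> 0) by (apply Cmod_gt_0; rewrite MR by lra; lra).
  replace (D (RtoC x)) with (/ RtoC (2 * PI) * (RtoC (2 * PI) * D (RtoC x)))%C by (field; auto).
  rewrite V; ring.
Qed.

(** * Decay of periodic holomorphic functions *)

(** Supplies the derivative as a function of t, as [curve_lip] expects, where only its existence at
    each point is known. *)
Lemma cder_Derive (k : R -> C) (t : R) (l : C) : cder k t l ->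
  (Derive (fun s => Re (k s)) t, Derive (fun s => Im (k s)) t) = l.
Proof.
  intros [A B]; apply injective_projections; simpl; apply is_derive_unique; auto.
Qed.

Lemma hol_lip_ex (h : C -> C) (z w : C) (B : R) :
  (forall t, 0 <= t <= 1 -> exists d, hol h (z + (w - z) * RtoC t)%C d /\ Cmod d <= B) ->
  Cmod (h w - h z) <= B * Cmod (w - z).
Proof.
  intros H. set (k := fun t : R => h (z + (w - z) * RtoC t)%C).
  assert (Q := curve_lip k
    (fun t => (Derive (fun s => Re (k s)) t, Derive (fun s => Im (k s)) t)) (B * Cmod (w - z)) 0 1 ltac:(lra)).
  replace (k 1) with (h w) in Q by (unfold k; f_equal; ring).
  replace (k 0) with (h z) in Q by (unfold k; f_equal; ring).
  replace (B * Cmod (w - z) * (1 - 0)) with (B * Cmod (w - z)) in Q by ring.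
  apply Q; intros t Ht; destruct (H t Ht) as [d [H1 H2]].
  assert (K : cder k t (d * (w - z))%C)
    by (apply (cder_hol h (fun s => z + (w - z) * RtoC s)%C); [ apply cder_line | exact H1 ]).
  rewrite (cder_Derive _ _ _ K); split; auto.
  rewrite Cmod_mult; apply Rmult_le_compat_r; [ apply Cmod_ge_0 | exact H2 ].
Qed.

Lemma Im_segment (z w : C) (t : R) : Im (z + (w - z) * RtoC t)%C = (1 - t) * Im z + t * Im w.
Proof. unfold Im; simpl; ring. Qed.

Lemma segment_above (c t : R) (z w : C) : c < Im z -> c < Im w -> 0 <= t <= 1 ->
  c < Im (z + (w - z) * RtoC t)%C.
Proof. intros H1 H2 Ht; rewrite Im_segment; destruct (Rle_dec (Im z) (Im w)); nra. Qed.

Lemma hol_const_upper (g : C -> C) : (forall z, 0 < Im z -> hol g z 0) ->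
  forall z w, 0 < Im z -> 0 < Im w -> g w = g z.
Proof.
  intros G z w Hz Hw.
  assert (E : Cmod (g w - g z) = 0).
  { apply Rle_antisym; [ | apply Cmod_ge_0 ]. rewrite <- (Rmult_0_l (Cmod (w - z))).
    apply hol_lip_ex. intros t Ht. exists 0; split.
    - apply G, segment_above; auto.
    - rewrite Cmod_0; lra. }
  apply Cmod_eq_0 in E. replace (g w) with (g w - g z + g z)%C by ring. rewrite E; ring.
Qed.

Section Decay.

Variable f : C -> C.
Hypothesis fH : forall z, 0 < Im z -> exists d, hol f z d.
Hypothesis fT : forall z, 0 < Im z -> f (z + 1)%C = f z.
Hypothesis f0 : forall eps, 0 < eps -> exists Y, forall z, Y < Im z -> Cmod (f z) < eps.

(** F(z + 1) - F(z) is constant, since its derivative is f(z + 1) - f(z) = 0. It is the integral of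
    [f] over one period, hence arbitrarily small high up: the constant Fourier coefficient of [f] is
    zero. *)
Lemma periodic_primitive : exists F, (forall z, 0 < Im z -> hol F z (f z)) /\
  (forall z, 0 < Im z -> F (z + 1)%C = F z).
Proof.
  destruct (holo_primitive 0 f fH) as [F HF]. exists F; split; auto.
  assert (HI : forall z, Im (z + 1)%C = Im z) by (intros; unfold Im; simpl; ring).
  set (g := fun z => (F (z + 1)%C - F z)%C).
  assert (G : forall z, 0 < Im z -> hol g z 0).
  { intros z Hz. eapply hol_eq.
    - apply hol_minus; [ | apply HF; auto ].
      apply (hol_comp F (fun w => w + 1)%C).
      + apply hol_plus; [ apply hol_id | apply hol_const ].
      + apply HF; rewrite HI; auto.
    - rewrite fT by auto; ring. }
  assert (Gc := hol_const_upper g G).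
  intros z Hz.
  assert (E : Cmod (g z) = 0).
  { apply Rle_antisym; [ | apply Cmod_ge_0 ]. apply le_epsilon; intros e He; rewrite Rplus_0_l.
    destruct (f0 e He) as [Y HY].
    set (w := (0, Rmax Y 0 + 1) : C).
    assert (B1 := Rmax_l Y 0). assert (B2 := Rmax_r Y 0).
    assert (Hw : Im w = Rmax Y 0 + 1) by reflexivity.
    rewrite <- (Gc z w) by (auto; lra). unfold g.
    replace e with (e * Cmod (w + 1 - w)%C).
    2: { replace (w + 1 - w)%C with (RtoC 1) by ring. rewrite Cmod_1; ring. }
    apply hol_lip_ex. intros t Ht.
    assert (HI' : Im (w + (w + 1 - w) * RtoC t)%C = Im w) by (unfold Im; simpl; ring).
    eexists; split; [ apply HF | apply Rlt_le, HY ]; rewrite HI'; lra. }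
  apply Cmod_eq_0 in E. replace (F (z + 1)%C) with (g z + F z)%C by (unfold g; ring). rewrite E; ring.
Qed.

(** The parameter [q] is [Re] or [Im]. As q(F) takes the same value at both ends of a period,
    Rolle's theorem gives a zero of its derivative q(f). *)
Lemma rolle_component (q : C -> R) (z : C) :
  (forall k t l, cder k t l -> is_derive (fun s => q (k s)) t (q l)) ->
  0 < Im z -> exists t, 0 <= t <= 1 /\ q (f (z + RtoC t)%C) = 0.
Proof.
  intros Hq Hz. destruct periodic_primitive as [F [HF HP]].
  assert (HI : forall t, Im (z + RtoC t)%C = Im z) by (intros; unfold Im; simpl; ring).
  assert (D : forall t, is_derive (fun s => q (F (z + RtoC s)%C)) t (q (f (z + RtoC t)%C))).
  { intros t; apply Hq. eapply cder_eq.
    - apply (cder_hol F (fun s => z + RtoC s)%C).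
      + apply cder_plus; [ apply cder_const | apply cder_RtoC ].
      + apply HF; rewrite HI; auto.
    - ring. }
  destruct (MVT_gen (fun s => q (F (z + RtoC s)%C)) 0 1 (fun t => q (f (z + RtoC t)%C))) as [t [Ht E]].
  - intros; apply D.
  - intros x _; apply derivable_continuous_pt; eexists; apply is_derive_Reals, D.
  - rewrite Rmin_left, Rmax_right in Ht by lra. exists t; split; auto.
    rewrite HP in E by auto. replace (z + 0)%C with z in E by ring. lra.
Qed.

(* A bound O(y^-K) gives O(y^-(K+1)) for f' by Cauchy's estimate; the real and imaginary parts of f
   vanish somewhere on each horizontal period, so f inherits the bound of f'. *)
Lemma decay (K : nat) : exists B Y, 0 <= B /\ 0 < Y /\
  forall z, Y < Im z -> Cmod (f z) <= B / Im z ^ K.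
Proof.
  induction K as [ | K [B [Y [HB [HY IH]]]]].
  - destruct (f0 1 Rlt_0_1) as [Y HY]. exists 1, (Rmax Y 1).
    assert (Q1 := Rmax_l Y 1). assert (Q2 := Rmax_r Y 1).
    repeat split; try lra. intros z Hz; simpl. rewrite Rdiv_1_r. apply Rlt_le, HY; lra.
  (* Cauchy's estimate is used on the circle of radius y/2, where Im w >= y/2: this gives 2^K from
     the inductive bound and 4 from 2 / (y/2). The outer 2 counts the real and imaginary parts, and
     [2 * Y] keeps the circle above [Y]. *)
  - exists (2 * (B * 2 ^ K * 4)), (2 * Y).
    assert (P2 : 0 < 2 ^ K) by (apply pow_lt; lra).
    assert (B2 : 0 <= B * 2 ^ K) by (apply Rmult_le_pos; lra).
    repeat split; try lra. intros z Hz. set (y := Im z) in *.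
    assert (Py : 0 < y ^ K) by (apply pow_lt; lra).
    set (E := B * 2 ^ K * 4 / y ^ S K).
    assert (D : forall p d, Im p = y -> hol f p d -> Cmod d <= E).
    { intros p d Hp Hd.
      replace E with (2 * (B * 2 ^ K / y ^ K) / (y / 2)) by (unfold E; simpl; field; lra).
      apply (cauchy_estimate 0 (y / 2) (B * 2 ^ K / y ^ K) f p d); auto; try lra.
      intros w Hw.
      assert (Iw : y / 2 <= Im w).
      { assert (Q := im_le_Cmod (w - p)). rewrite Hw in Q.
        change (Im (w - p)%C) with (Im w - Im p) in Q.
        assert (Q' := Rle_abs (- (Im w - Im p))). rewrite Rabs_Ropp in Q'. lra. }
      eapply Rle_trans; [ apply IH; lra | ].
      replace (B * 2 ^ K / y ^ K) with (B / (y / 2) ^ K)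
        by (unfold Rdiv; rewrite Rpow_mult_distr, pow_inv; field; split; lra).
      apply Rmult_le_compat_l; auto. apply Rinv_le_contravar.
      - apply pow_lt; lra.
      - apply pow_incr; lra. }
    assert (E0 : 0 <= E).
    { unfold E. apply Rdiv_le_0_compat; [ lra | apply pow_lt; lra ]. }
    assert (V : forall t, 0 <= t <= 1 -> Cmod (f z - f (z + RtoC t)%C) <= E).
    { intros t Ht. rewrite Cmod_sub_sym. replace E with (E * 1) by ring.
      eapply Rle_trans; [ apply (hol_lip_ex f z (z + RtoC t) E) | ].
      - intros s Hs.
        assert (Is : Im (z + (z + RtoC t - z) * RtoC s)%C = y) by (unfold y, Im; simpl; ring).
        destruct (fH (z + (z + RtoC t - z) * RtoC s)%C) as [d Hd]; [ rewrite Is; lra | ].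
        exists d; split; auto. eapply D; eauto.
      - apply Rmult_le_compat_l; auto. replace (z + t - z)%C with (RtoC t) by ring.
        rewrite Cmod_R, Rabs_pos_eq; lra. }
    destruct (rolle_component Re z) as [t1 [T1 Z1]]; [ intros k t l Q; apply Q | unfold y in *; lra | ].
    destruct (rolle_component Im z) as [t2 [T2 Z2]]; [ intros k t l Q; apply Q | unfold y in *; lra | ].
    assert (V1 := Rle_trans _ _ _ (re_le_Cmod _) (V t1 T1)).
    assert (V2 := Rle_trans _ _ _ (im_le_Cmod _) (V t2 T2)).
    change (Rabs (Re (f z) - Re (f (z + RtoC t1)%C)) <= E) in V1.
    change (Rabs (Im (f z) - Im (f (z + RtoC t2)%C)) <= E) in V2.
    rewrite Z1, Rminus_0_r in V1. rewrite Z2, Rminus_0_r in V2.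
    eapply Rle_trans; [ apply Cmod_le_abs | ].
    replace (2 * (B * 2 ^ K * 4) / y ^ S K) with (E + E) by (unfold E; field; apply pow_nonzero; lra).
    lra.
Qed.

End Decay.

(** * Principal logarithm and powers *)

Lemma exp_mono (x y : R) : x <= y -> exp x <= exp y.
Proof. intros [H | ->]; [ left; apply exp_increasing; auto | right; reflexivity ]. Qed.

Lemma Cexp_plus (z w : C) : Cexp (z + w) = (Cexp z * Cexp w)%C.
Proof.
  unfold Cexp; apply injective_projections; unfold Re, Im; simpl;
    rewrite exp_plus, ?cos_plus, ?sin_plus; ring.
Qed.

Lemma Cexp_0 : Cexp 0 = 1.
Proof. unfold Cexp; apply injective_projections; simpl; rewrite exp_0, ?cos_0, ?sin_0; ring. Qed.

Lemma Cexp_R (x : R) : Cexp (RtoC x) = RtoC (exp x).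
Proof. unfold Cexp; apply injective_projections; simpl; rewrite ?cos_0, ?sin_0; ring. Qed.

Lemma Cexp_mod (z : C) : Cmod (Cexp z) = exp (Re z).
Proof.
  unfold Cmod, Cexp; simpl.
  replace (_ + _) with (exp (Re z) * exp (Re z) * (Rsqr (sin (Im z)) + Rsqr (cos (Im z)))) by (unfold Rsqr; ring).
  rewrite sin2_cos2, Rmult_1_r. apply sqrt_square, Rlt_le, exp_pos.
Qed.

Lemma Cexp_neq0 (z : C) : Cexp z <> 0.
Proof. apply Cmod_gt_0; rewrite Cexp_mod; apply exp_pos. Qed.

Lemma Cexp_opp (z : C) : Cexp (- z) = (/ Cexp z)%C.
Proof.
  assert (N := Cexp_neq0 z). replace (Cexp (- z)) with (/ Cexp z * (Cexp z * Cexp (- z)))%C by (field; auto).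
  rewrite <- Cexp_plus. replace (z + - z)%C with (RtoC 0) by ring. rewrite Cexp_0; ring.
Qed.

Lemma Cexp_pow (z : C) (n : nat) : (Cexp z ^ n)%C = Cexp (RtoC (INR n) * z).
Proof.
  induction n as [ | n IH].
  - simpl. rewrite <- Cexp_0. f_equal; ring.
  - rewrite S_INR, RtoC_plus. simpl. rewrite IH, <- Cexp_plus. f_equal; ring.
Qed.

Lemma Cexp_2PI : Cexp (Ci * RtoC (2 * PI)) = 1.
Proof.
  unfold Cexp; apply injective_projections; simpl;
    replace (0 * 0 + 1 * (2 * PI)) with (2 * PI) by ring;
    replace (0 * (2 * PI) - 1 * 0) with 0 by ring; rewrite exp_0, ?cos_2PI, ?sin_2PI; ring.
Qed.

Lemma cder_Cexp_line (u : C) (t : R) :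
  cder (fun s => Cexp (u * RtoC s)) t (u * Cexp (u * RtoC t)).
Proof.
  destruct u as [p q]; split; unfold Cexp, Re, Im; simpl; auto_derive; auto; unfold Rminus; ring.
Qed.

(** Two mean value inequalities along t |-> e^(ut): one bounds e^(ut) - 1, the next the remainder.
    Serves both the derivative of [Cexp] and differentiation under the Mellin integral. *)
Lemma Cexp_bound (u : C) : Cmod (Cexp u - 1 - u) <= Cmod u * Cmod u * exp (Cmod u).
Proof.
  assert (U := Cmod_ge_0 u).
  assert (M : forall t, 0 <= t <= 1 -> Cmod (Cexp (u * RtoC t)) <= exp (Cmod u)).
  { intros t Ht; rewrite Cexp_mod. apply exp_mono.
    eapply Rle_trans; [ apply Rle_abs | ]. eapply Rle_trans; [ apply re_le_Cmod | ].
    rewrite Cmod_mult, Cmod_R, Rabs_pos_eq by lra. nra. }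
  assert (B1 : forall t, 0 <= t <= 1 -> Cmod (Cexp (u * RtoC t) - 1) <= Cmod u * exp (Cmod u)).
  { intros t Ht. replace (RtoC 1) with (Cexp (u * RtoC 0)) by (replace (u * RtoC 0)%C with (RtoC 0) by ring; apply Cexp_0).
    assert (E := exp_pos (Cmod u)).
    eapply Rle_trans; [ apply (curve_lip (fun s => Cexp (u * RtoC s)) (fun s => u * Cexp (u * RtoC s))%C
       (Cmod u * exp (Cmod u)) 0 t) | ]; try lra.
    - intros s Hs; split; [ apply cder_Cexp_line | ].
      rewrite Cmod_mult; apply Rmult_le_compat_l; auto. apply M; lra.
    - assert (0 <= Cmod u * exp (Cmod u)) by (apply Rmult_le_pos; lra). nra. }
  assert (Q := curve_lip (fun s => Cexp (u * RtoC s) + (- u) * RtoC s)%C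
    (fun s => u * Cexp (u * RtoC s) + (- u) * 1)%C (Cmod u * Cmod u * exp (Cmod u)) 0 1 ltac:(lra)).
  cbv beta in Q.
  replace (Cexp (u * 1) + - u * 1 - (Cexp (u * 0) + - u * 0))%C with (Cexp u - 1 - u)%C in Q.
  2: { replace (u * 1)%C with u by ring. replace (u * 0)%C with (RtoC 0) by ring. rewrite Cexp_0; ring. }
  replace (Cmod u * Cmod u * exp (Cmod u) * (1 - 0)) with (Cmod u * Cmod u * exp (Cmod u)) in Q by ring.
  apply Q; intros t Ht; split.
  - apply cder_plus; [ apply cder_Cexp_line | apply cder_scal, cder_RtoC ].
  - replace (u * Cexp (u * t) + - u * 1)%C with (u * (Cexp (u * t) - 1))%C by ring.
    rewrite Cmod_mult, Rmult_assoc. apply Rmult_le_compat_l; auto.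
Qed.

Lemma hol_Cexp (z : C) : hol Cexp z (Cexp z).
Proof.
  intros e He. assert (P := exp_pos (Re z)). assert (P1 := exp_pos 1).
  exists (Rmin 1 (e / (exp (Re z) * exp 1))); split.
  { apply Rmin_pos; [ lra | apply Rdiv_lt_0_compat; auto; apply Rmult_lt_0_compat; auto ]. }
  intros w Hw. assert (L1 := Rlt_le_trans _ _ _ Hw (Rmin_l _ _)).
  assert (L2 := Rlt_le_trans _ _ _ Hw (Rmin_r _ _)).
  set (u := (w - z)%C) in *. assert (U := Cmod_ge_0 u).
  replace w with (z + u)%C by (unfold u; ring). rewrite Cexp_plus.
  replace (Cexp z * Cexp u - Cexp z - Cexp z * u)%C with (Cexp z * (Cexp u - 1 - u))%C by ring.
  rewrite Cmod_mult, Cexp_mod.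
  apply Rle_trans with (exp (Re z) * (Cmod u * Cmod u * exp 1)).
  - apply Rmult_le_compat_l; [ lra | ].
    eapply Rle_trans; [ apply Cexp_bound | ].
    apply Rmult_le_compat_l; [ apply Rmult_le_pos; auto | apply exp_mono; lra ].
  - replace (exp (Re z) * (Cmod u * Cmod u * exp 1)) with (exp (Re z) * exp 1 * Cmod u * Cmod u) by ring.
    apply Rmult_le_compat_r; auto.
    apply (Rmult_lt_compat_l (exp (Re z) * exp 1)) in L2; [ | apply Rmult_lt_0_compat; auto ].
    replace (exp (Re z) * exp 1 * (e / (exp (Re z) * exp 1))) with e in L2 by (field; split; lra).
    lra.
Qed.

(** The principal logarithm on the upper half-plane. Dividing by Im w rather than Re w gives one
    formula that is smooth across the imaginary axis, where [Carg] changes case. *)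
Definition logH (w : C) : C := (ln (Cmod w), PI / 2 - atan (Re w / Im w)).

Lemma Carg_right (z : C) : 0 < Re z -> Carg z = atan (Im z / Re z).
Proof. intros H; unfold Carg; destruct Rlt_dec; [ reflexivity | contradiction ]. Qed.

Lemma atan_inv_neg (x : R) : x < 0 -> atan (/ x) = - (PI / 2) - atan x.
Proof.
  intros H. replace (/ x) with (- / - x) by (field; lra).
  rewrite atan_opp, atan_inv, atan_opp by lra. ring.
Qed.

Lemma Carg_upper (z : C) : 0 < Im z -> Carg z = PI / 2 - atan (Re z / Im z).
Proof.
  intros H; unfold Carg.
  destruct (Rlt_dec 0 (Re z)) as [L | L].
  - rewrite <- atan_inv by (apply Rdiv_lt_0_compat; auto). f_equal; field; split; lra.
  - destruct (Rlt_dec (Re z) 0) as [L' | L'].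
    + destruct (Rle_dec 0 (Im z)); [ | lra ].
      replace (Im z / Re z) with (/ (Re z / Im z)) by (field; split; lra).
      rewrite atan_inv_neg; [ lra | ].
      apply Ropp_lt_cancel; rewrite Ropp_0. replace (- (Re z / Im z)) with (- Re z / Im z) by (field; lra).
      apply Rdiv_lt_0_compat; lra.
    + destruct (Rlt_dec 0 (Im z)); [ | lra ].
      replace (Re z) with 0 by lra. unfold Rdiv; rewrite Rmult_0_l, atan_0; ring.
Qed.

Lemma Carg_lower (z : C) : Im z < 0 -> Carg z = - (PI / 2) - atan (Re z / Im z).
Proof.
  intros H; unfold Carg.
  destruct (Rlt_dec 0 (Re z)) as [L | L].
  - replace (Im z / Re z) with (/ (Re z / Im z)) by (field; split; lra).
    rewrite atan_inv_neg; [ lra | ].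
    apply Ropp_lt_cancel; rewrite Ropp_0. replace (- (Re z / Im z)) with (Re z / - Im z) by (field; lra).
    apply Rdiv_lt_0_compat; lra.
  - destruct (Rlt_dec (Re z) 0) as [L' | L'].
    + destruct (Rle_dec 0 (Im z)); [ lra | ].
      replace (Im z / Re z) with (/ (Re z / Im z)) by (field; split; lra).
      rewrite atan_inv; [ lra | ].
      replace (Re z / Im z) with (- Re z / - Im z) by (field; lra). apply Rdiv_lt_0_compat; lra.
    + destruct (Rlt_dec 0 (Im z)); [ lra | ]. destruct (Rlt_dec (Im z) 0); [ | lra ].
      replace (Re z) with 0 by lra. unfold Rdiv; rewrite Rmult_0_l, atan_0; ring.
Qed.

Lemma Im_pos_neq0 (w : C) : 0 < Im w -> w <> 0.
Proof. intros H E; rewrite E in H; simpl in H; lra. Qed.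

Lemma Clog_H (w : C) : 0 < Im w -> Clog w = logH w.
Proof. intros H; unfold Clog, logH; rewrite Carg_upper; auto. Qed.

(** Multiplication by -N maps to the lower half-plane, where the principal argument is arg w - pi;
    the other candidate arg w + pi would exceed pi. *)
Lemma Clog_neg (N : R) (w : C) : 0 < N -> 0 < Im w ->
  Clog (RtoC (- N) * w) = (RtoC (ln N) + logH w - Ci * RtoC PI)%C.
Proof.
  intros HN H. unfold Clog.
  assert (M : 0 < Cmod w) by (apply Cmod_gt_0, Im_pos_neq0; auto).
  assert (R1 : Re (RtoC (- N) * w)%C = - N * Re w) by (unfold Re; simpl; ring).
  assert (I1 : Im (RtoC (- N) * w)%C = - N * Im w) by (unfold Im; simpl; ring).
  assert (I0 : 0 < N * Im w) by (apply Rmult_lt_0_compat; auto).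
  rewrite Carg_lower by (rewrite I1; lra). rewrite R1, I1, Cmod_mult, Cmod_R, Rabs_Ropp, Rabs_pos_eq by lra.
  rewrite ln_mult by auto.
  replace (- N * Re w / (- N * Im w)) with (Re w / Im w) by (field; split; lra).
  unfold logH; apply injective_projections; simpl; lra.
Qed.

Lemma Clog_rot (s : R) (w : C) : 0 < s -> 0 < Im w ->
  Clog (- Ci * RtoC s * w) = (RtoC (ln s) + logH w - Ci * RtoC (PI / 2))%C.
Proof.
  intros HN H. unfold Clog.
  assert (M : 0 < Cmod w) by (apply Cmod_gt_0, Im_pos_neq0; auto).
  assert (R1 : Re (- Ci * RtoC s * w)%C = s * Im w) by (unfold Re, Im; simpl; ring).
  assert (I1 : Im (- Ci * RtoC s * w)%C = - s * Re w) by (unfold Re, Im; simpl; ring).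
  assert (I0 : 0 < s * Im w) by (apply Rmult_lt_0_compat; auto).
  rewrite Carg_right by (rewrite R1; lra).
  rewrite R1, I1, !Cmod_mult, Cmod_opp, Cmod_Ci, Cmod_R, Rabs_pos_eq, Rmult_1_l by lra.
  rewrite ln_mult by auto.
  replace (- s * Re w / (s * Im w)) with (- (Re w / Im w)) by (field; split; lra).
  rewrite atan_opp. unfold logH; apply injective_projections; simpl; lra.
Qed.

(** The map w |-> -1/(Nw) preserves the half-plane and reflects the argument to pi - arg w, which
    again lies in (0, pi), so no branch correction occurs. *)
Lemma logH_inv (N : R) (w : C) : 0 < N -> 0 < Im w ->
  0 < Im (- / (RtoC N * w))%C /\
  logH (- / (RtoC N * w)) = (- RtoC (ln N) - logH w + Ci * RtoC PI)%C.
Proof.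
  intros HN H.
  assert (Nw : w <> 0) by (apply Im_pos_neq0; auto).
  assert (M : 0 < Cmod w) by (apply Cmod_gt_0; auto).
  assert (NN : RtoC N <> 0) by (intros E; apply RtoC_inj in E; lra).
  set (q := N * (Re w ^ 2 + Im w ^ 2)).
  assert (Hq : 0 < q) by (unfold q; apply Rmult_lt_0_compat; auto; nra).
  assert (E : (- / (RtoC N * w))%C = (- Re w / q, Im w / q)).
  { destruct w as [x y]; unfold q, Re, Im in *; simpl in *.
    apply injective_projections; simpl; field; nra. }
  assert (I1 : Im (- / (RtoC N * w))%C = Im w / q) by (rewrite E; reflexivity).
  assert (R1 : Re (- / (RtoC N * w))%C = - Re w / q) by (rewrite E; reflexivity).
  split.
  - rewrite I1. apply Rdiv_lt_0_compat; auto.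
  - unfold logH. rewrite I1, R1, Cmod_opp, Cmod_inv, Cmod_mult, Cmod_R, Rabs_pos_eq
      by (try apply Cmult_neq_0; auto; lra).
    rewrite ln_Rinv, ln_mult by (auto; apply Rmult_lt_0_compat; auto).
    replace (- Re w / q / (Im w / q)) with (- (Re w / Im w)) by (field; split; lra).
    rewrite atan_opp. apply injective_projections; simpl; lra.
Qed.

Lemma Cexp_logH (w : C) : 0 < Im w -> Cexp (logH w) = w.
Proof.
  intros H. unfold Cexp, logH; simpl.
  assert (M : 0 < Cmod w) by (apply Cmod_gt_0, Im_pos_neq0; auto).
  rewrite exp_ln, cos_shift, sin_shift by auto.
  assert (S1 : sqrt (1 + (Re w / Im w)²) = Cmod w / Im w).
  { replace (1 + (Re w / Im w)²) with ((Re w ^ 2 + Im w ^ 2) / Rsqr (Im w)) by (unfold Rsqr; field; lra).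
    rewrite sqrt_div_alt by (apply Rlt_0_sqr; lra). rewrite sqrt_Rsqr by lra. reflexivity. }
  rewrite sin_atan, cos_atan, S1.
  destruct w as [x y]; unfold Re, Im in *; simpl in *.
  apply injective_projections; simpl; field; split; lra.
Qed.

Lemma hol_logH (w : C) : 0 < Im w -> hol logH w (/ w)%C.
Proof.
  intros H. apply (hol_of_partials logH Cinv w (Im w)); auto.
  - eapply hol_cts, hol_inv, Im_pos_neq0; auto.
  - intros v Hv.
    assert (Iv : 0 < Im v).
    { assert (B := im_le_Cmod (v - w)). change (Im (v - w)%C) with (Im v - Im w) in B.
      assert (B' := Rle_abs (- (Im v - Im w))). rewrite Rabs_Ropp in B'. lra. }
    destruct v as [x y]; unfold Re, Im in Iv |- *; simpl in Iv |- *.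
    assert (Q : 0 < x * x + y * y) by nra.
    assert (S0 : 0 < sqrt (x * (x * 1) + y * (y * 1))) by (apply sqrt_lt_R0; lra).
    assert (SS : sqrt (x * (x * 1) + y * (y * 1)) * sqrt (x * (x * 1) + y * (y * 1)) = x * x + y * y)
      by (rewrite sqrt_sqrt; lra).
    split; split; unfold logH, Cmod, Re, Im; simpl; auto_derive; try (repeat split; lra);
      try rewrite !Rmult_1_l.
    + set (s := sqrt (x * (x * 1) + y * (y * 1))) in *.
      replace (x * (x * 1) + y * (y * 1)) with (s * s) by lra. field; lra.
    + field; repeat split; nra.
    + set (s := sqrt (x * (x * 1) + y * (y * 1))) in *.
      replace (x * (x * 1) + y * (y * 1)) with (s * s) by lra. field; lra.
    + field; repeat split; nra.
Qed.

Lemma cpow_Cexp (z w : C) : z <> 0 -> cpow z w = Cexp (w * Clog z).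
Proof.
  intros H; unfold cpow; destruct (Req_EM_T (Cmod z) 0) as [E | E]; [ | reflexivity ].
  apply Cmod_eq_0 in E; contradiction.
Qed.

Lemma Cexp_PI2 : Cexp (Ci * RtoC (PI / 2)) = Ci.
Proof.
  unfold Cexp; apply injective_projections; simpl;
    replace (0 * 0 + 1 * (PI / 2)) with (PI / 2) by ring;
    replace (0 * (PI / 2) - 1 * 0) with 0 by ring; rewrite exp_0, ?cos_PI2, ?sin_PI2; ring.
Qed.

Lemma Clog_Ci : Clog Ci = (Ci * RtoC (PI / 2))%C.
Proof.
  rewrite Clog_H by (simpl; lra). unfold logH. rewrite Cmod_Ci, ln_1; simpl.
  unfold Rdiv at 2; rewrite Rmult_0_l, atan_0. apply injective_projections; simpl; ring.
Qed.

Lemma Ci_neq0 : Ci <> 0.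
Proof. intros E; apply (f_equal Im) in E; simpl in E; lra. Qed.

Lemma cpow_Ci (s : R) : cpow Ci (RtoC s) = Cexp (RtoC s * (Ci * RtoC (PI / 2))).
Proof. rewrite cpow_Cexp, Clog_Ci by apply Ci_neq0; reflexivity. Qed.

(** * Mellin transforms *)

(** The limit at +oo, not a limit inferior. *)
Definition lim_inf (G : R -> C) (l : C) : Prop :=
  forall eps, 0 < eps -> exists T, forall t, T < t -> Cmod (G t - l) < eps.

Definition lim_zero (G : R -> C) (l : C) : Prop :=
  forall eps, 0 < eps -> exists d, 0 < d /\ forall t, 0 < t < d -> Cmod (G t - l) < eps.

(* [mint g l]: the improper integral of [g] over (0,oo) converges to [l], phrased by a primitive. *)
Definition mint (g : R -> C) (l : C) : Prop :=
  exists G l0 l1, (forall t, 0 < t -> cder G t (g t)) /\ (forall t, 0 < t -> ccts g t) /\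
    lim_zero G l0 /\ lim_inf G l1 /\ l = (l1 - l0)%C.

Lemma RInt_gen_primitive (F f : R -> R) (l0 l1 : R) :
  (forall t, 0 < t -> is_derive F t (f t)) -> (forall t, 0 < t -> continuous f t) ->
  (forall eps, 0 < eps -> exists d, 0 < d /\ forall t, 0 < t < d -> Rabs (F t - l0) < eps) ->
  (forall eps, 0 < eps -> exists T, forall t, T < t -> Rabs (F t - l1) < eps) ->
  RInt_gen f (at_right 0) (Rbar_locally p_infty) = l1 - l0.
Proof.
  intros HD HC H0 H1. apply (is_RInt_gen_unique (V := R_CompleteNormedModule)).
  intros P [e HP].
  destruct (H0 (e / 2)) as [d [Hd K0]]; [ destruct e; simpl; lra | ].
  destruct (H1 (e / 2)) as [T K1]; [ destruct e; simpl; lra | ].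
  apply (Filter_prod _ _ _ (fun a => 0 < a < d) (fun b => Rmax T d < b)).
  - exists (mkposreal d Hd); intros y Hy Hy0; simpl in *.
    assert (B := Rle_abs (y - 0)). change (Rabs (y - 0) < d) in Hy. lra.
  - exists (Rmax T d); auto.
  - intros a b Ha Hb. assert (B1 := Rmax_l T d). assert (B2 := Rmax_r T d).
    exists (F b - F a); split.
    + apply (is_RInt_derive (V := R_CompleteNormedModule) F f a b); simpl; intros x Hx;
        rewrite Rmin_left in Hx by lra; [ apply HD | apply HC ]; lra.
    + apply HP. change (Rabs (F b - F a - (l1 - l0)) < e).
      specialize (K0 a Ha). specialize (K1 b ltac:(lra)).
      apply Rabs_def2 in K0. apply Rabs_def2 in K1. apply Rabs_def1; lra.
Qed.

Lemma mint_CInt (g : R -> C) (l : C) : mint g l -> CInt0inf g = l.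
Proof.
  intros (G & l0 & l1 & HD & HC & H0 & H1 & ->).
  unfold CInt0inf; apply injective_projections; simpl.
  - apply (RInt_gen_primitive (fun t => Re (G t))).
    + intros t Ht; apply HD; auto.
    + intros t Ht; exact (proj1 (HC t Ht)).
    + intros e He; destruct (H0 e He) as [d [Hd K]]; exists d; split; auto; intros t Ht.
      eapply Rle_lt_trans; [ apply (re_le_Cmod (G t - l0)) | apply K; auto ].
    + intros e He; destruct (H1 e He) as [T K]; exists T; intros t Ht.
      eapply Rle_lt_trans; [ apply (re_le_Cmod (G t - l1)) | apply K; auto ].
  - apply (RInt_gen_primitive (fun t => Im (G t))).
    + intros t Ht; apply HD; auto.
    + intros t Ht; exact (proj2 (HC t Ht)).
    + intros e He; destruct (H0 e He) as [d [Hd K]]; exists d; split; auto; intros t Ht.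
      eapply Rle_lt_trans; [ apply (im_le_Cmod (G t - l0)) | apply K; auto ].
    + intros e He; destruct (H1 e He) as [T K]; exists T; intros t Ht.
      eapply Rle_lt_trans; [ apply (im_le_Cmod (G t - l1)) | apply K; auto ].
Qed.

(** [is_Lambda] speaks of an improper integral with values in C, whereas [CInt0inf] is a pair of
    real improper integrals; the projections are 1-Lipschitz and commute with the integral. *)
Lemma CInt0inf_of_RInt_gen (g : R -> C) (l : C) :
  is_RInt_gen (V := C_R_NormedModule) g (at_right 0) (Rbar_locally p_infty) l -> CInt0inf g = l.
Proof.
  intros H.
  assert (K : forall q : C -> R, (forall z w, Rabs (q z - q w) <= Cmod (z - w)) ->
    (forall a b y, is_RInt (V := C_R_NormedModule) g a b y -> is_RInt (fun t => q (g t)) a b (q y)) ->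
    RInt_gen (fun t => q (g t)) (at_right 0) (Rbar_locally p_infty) = q l).
  { intros q Hq Hi. apply (is_RInt_gen_unique (V := R_CompleteNormedModule)).
    intros P [e HP].
    destruct (H (fun z => Cmod (z - l) < e)) as [Q R0 HQ HR HQR].
    - apply (locally_le_locally_norm (V := C_NormedModule)). exists e; intros y Hy; exact Hy.
    - apply (Filter_prod _ _ _ Q R0 HQ HR). intros a b Ha Hb.
      destruct (HQR a b Ha Hb) as [y [Hy Hy']]. exists (q y); split; [ apply Hi; exact Hy | ].
      apply HP. change (Rabs (q y - q l) < e). eapply Rle_lt_trans; [ apply Hq | exact Hy' ]. }
  unfold CInt0inf; apply injective_projections; simpl.
  - apply (K Re); [ intros z w; exact (re_le_Cmod (z - w)) | ].
    intros a b y Hy; exact (is_RInt_fct_extend_fst _ _ _ _ Hy).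
  - apply (K Im); [ intros z w; exact (im_le_Cmod (z - w)) | ].
    intros a b y Hy; exact (is_RInt_fct_extend_snd _ _ _ _ Hy).
Qed.

Lemma lim_plus_lin (G H : R -> C) (a b l m : C) :
  (lim_zero G l -> lim_zero H m -> lim_zero (fun t => a * G t + b * H t)%C (a * l + b * m)%C) /\
  (lim_inf G l -> lim_inf H m -> lim_inf (fun t => a * G t + b * H t)%C (a * l + b * m)%C).
Proof.
  assert (A := Cmod_ge_0 a). assert (B := Cmod_ge_0 b).
  assert (E : forall e, 0 < e -> exists e', 0 < e' /\ forall u v, Cmod (u - l) < e' -> Cmod (v - m) < e' ->
     Cmod (a * u + b * v - (a * l + b * m)) < e).
  { intros e He. exists (e / (Cmod a + Cmod b + 1)).
    assert (P : 0 < e / (Cmod a + Cmod b + 1)) by (apply Rdiv_lt_0_compat; lra).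
    split; auto. set (e' := e / (Cmod a + Cmod b + 1)) in *. intros u v Hu Hv.
    replace (a * u + b * v - (a * l + b * m))%C with (a * (u - l) + b * (v - m))%C by ring.
    eapply Rle_lt_trans; [ apply Cmod_triangle | rewrite !Cmod_mult ].
    replace e with ((Cmod a + Cmod b + 1) * e') by (unfold e'; field; lra). nra. }
  split; intros H1 H2 e He; destruct (E e He) as [e' [He' K]];
    destruct (H1 e' He') as [x1 K1]; destruct (H2 e' He') as [x2 K2].
  - destruct K1 as [P1 K1]; destruct K2 as [P2 K2]. exists (Rmin x1 x2).
    split; [ apply Rmin_pos; auto | ]. intros t Ht.
    assert (B1 := Rmin_l x1 x2). assert (B2 := Rmin_r x1 x2).
    apply K; [ apply K1 | apply K2 ]; lra.
  - exists (Rmax x1 x2). intros t Ht.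
    assert (B1 := Rmax_l x1 x2). assert (B2 := Rmax_r x1 x2).
    apply K; [ apply K1 | apply K2 ]; lra.
Qed.

Lemma mint_lin (g h : R -> C) (a b l m : C) : mint g l -> mint h m ->
  mint (fun t => a * g t + b * h t)%C (a * l + b * m)%C.
Proof.
  intros (G & l0 & l1 & HD & HC & H0 & H1 & ->) (H & m0 & m1 & HD' & HC' & H0' & H1' & ->).
  exists (fun t => a * G t + b * H t)%C, (a * l0 + b * m0)%C, (a * l1 + b * m1)%C.
  split; [ | split; [ | split; [ | split ] ] ].
  - intros t Ht; apply cder_plus; apply cder_scal; auto.
  - intros t Ht; apply ccts_plus; (apply ccts_mult; [ apply ccts_const | auto ]).
  - apply lim_plus_lin; auto.
  - apply lim_plus_lin; auto.
  - ring.
Qed.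

Lemma ccts_ext_pos (g h : R -> C) (t : R) : 0 < t -> (forall s, 0 < s -> g s = h s) ->
  ccts g t -> ccts h t.
Proof.
  rewrite !ccts_eps; intros Ht E H e He; destruct (H e He) as [d [Hd K]].
  exists (Rmin d t); split; [ apply Rmin_pos; auto | intros s Hs ].
  assert (B1 := Rmin_l d t). assert (B2 := Rmin_r d t).
  rewrite <- !E; [ apply K; lra | auto | ]. apply Rabs_def2 in Hs; lra.
Qed.

Lemma mint_ext (g h : R -> C) (l : C) : (forall t, 0 < t -> g t = h t) -> mint g l -> mint h l.
Proof.
  intros E (G & l0 & l1 & HD & HC & H). exists G, l0, l1; split; [ | split; auto ].
  - intros t Ht; rewrite <- E; auto.
  - intros t Ht; apply (ccts_ext_pos g); auto.
Qed.

Lemma mint_0 : mint (fun _ => RtoC 0) 0.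
Proof.
  exists (fun _ => RtoC 0), 0, 0. split; [ | split; [ | split; [ | split ] ] ].
  - intros; apply cder_const.
  - intros; apply ccts_const.
  - intros e He; exists 1; split; [ lra | intros; replace (0 - 0)%C with (RtoC 0) by ring; rewrite Cmod_0; auto ].
  - intros e He; exists 1; intros; replace (0 - 0)%C with (RtoC 0) by ring; rewrite Cmod_0; auto.
  - ring.
Qed.

Lemma mint_scal (g : R -> C) (a l : C) : mint g l -> mint (fun t => a * g t)%C (a * l)%C.
Proof.
  intros H. replace (a * l)%C with (a * l + 0 * 0)%C by ring.
  apply (mint_ext (fun t => a * g t + 0 * 0)%C); [ intros; ring | apply mint_lin; auto; apply mint_0 ].
Qed.

Lemma mint_sum (g : nat -> R -> C) (l : nat -> C) (M : nat) : (forall n, (n <= M)%nat -> mint (g n) (l n)) ->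
  mint (fun t => Csum M (fun n => g n t)) (Csum M l).
Proof.
  induction M as [ | M IH]; intros H; simpl; [ apply H; auto | ].
  replace (Csum M l + l (S M))%C with (1 * Csum M l + 1 * l (S M))%C by ring.
  apply (mint_ext (fun t => 1 * Csum M (fun n => g n t) + 1 * g (S M) t)%C); [ intros; ring | ].
  apply mint_lin; auto.
Qed.

Lemma lim_inf_exists (G : R -> C) : (forall eps, 0 < eps -> exists T, forall s t, T < s -> T < t ->
  Cmod (G s - G t) < eps) -> exists l, lim_inf G l.
Proof.
  intros H.
  destruct (proj1 (filterlim_locally_cauchy (U := C_R_CompleteNormedModule)
     (F := Rbar_locally p_infty) (FF := Rbar_locally_filter p_infty) G)) as [l Hl].
  - intros e. destruct (H e (cond_pos e)) as [T HT].
    exists (fun t => T < t); split; [ exists T; auto | intros u v Hu Hv ].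
    apply C_NormedModule_mixin_compat1. change (Cmod (G v - G u) < e). apply HT; auto.
  - exists l. intros e He.
    destruct (Hl (fun z => Cmod (z - l) < e)) as [T HT].
    + apply (locally_le_locally_norm (V := C_NormedModule)). exists (mkposreal e He); intros y Hy; exact Hy.
    + exists T; intros t Ht; apply HT; auto.
Qed.

Lemma lim_zero_inv (G : R -> C) (l : C) : lim_inf (fun t => G (/ t)) l -> lim_zero G l.
Proof.
  intros H e He; destruct (H e He) as [T K].
  assert (P : 0 < Rabs T + 1) by (assert (Q := Rabs_pos T); lra).
  exists (/ (Rabs T + 1)); split; [ apply Rinv_0_lt_compat; auto | intros t Ht ].
  rewrite <- (Rinv_inv t). apply K. apply Rle_lt_trans with (Rabs T); [ apply Rle_abs | ].
  assert (Q : Rabs T + 1 < / t).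
  { rewrite <- (Rinv_inv (Rabs T + 1)). apply Rinv_lt_contravar; [ | lra ].
    apply Rmult_lt_0_compat; [ lra | apply Rinv_0_lt_compat; auto ]. }
  lra.
Qed.

Lemma lim_inf_lip (G : R -> C) (B Y : R) : 0 < Y ->
  (forall s t, Y < s -> s <= t -> Cmod (G t - G s) <= B * (/ s - / t)) -> exists l, lim_inf G l.
Proof.
  intros HY H. apply lim_inf_exists. intros e He.
  set (T := Rmax Y (Rabs B / e)). exists T.
  assert (B1 := Rmax_l Y (Rabs B / e)). assert (B2 := Rmax_r Y (Rabs B / e)). fold T in B1, B2.
  assert (K : forall s t, T < s -> s <= t -> Cmod (G t - G s) < e).
  { intros s t Hs Hst. eapply Rle_lt_trans; [ apply H; lra | ].
    assert (P1 : 0 < / t) by (apply Rinv_0_lt_compat; lra).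
    assert (P2 : / t <= / s) by (apply Rinv_le_contravar; lra).
    assert (Q := Rle_abs B). assert (Q' := Rabs_pos B).
    apply Rle_lt_trans with (Rabs B * / s); [ nra | ].
    apply (Rmult_lt_reg_r s); [ lra | ]. rewrite Rmult_assoc, Rinv_l, Rmult_1_r by lra.
    apply Rle_lt_trans with (Rabs B / e * e); [ right; field; lra | ].
    rewrite (Rmult_comm e s). apply Rmult_lt_compat_r; lra. }
  intros s t Hs Ht. destruct (Rle_dec s t); [ rewrite Cmod_sub_sym | ]; apply K; lra.
Qed.

(** The inequality 1/(1 + x^2) <= 1/x^2 integrated from s to t. It converts [atan] bounds into the
    hypothesis of [lim_inf_lip]. *)
Lemma atan_add_inv_le (s t : R) : 0 < s -> s <= t -> atan t - atan s <= / s - / t.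
Proof.
  intros Hs Hst.
  destruct (MVT_gen (fun x => - / x - atan x) s t (fun x => / (x * x) - / (1 + x ^ 2))) as [c [Hc E]].
  - intros x Hx; rewrite Rmin_left in Hx by lra. auto_derive; [ lra | field; split; [ nra | lra ] ].
  - intros x Hx; rewrite Rmin_left in Hx by lra. apply continuity_pt_minus.
    + apply continuity_pt_opp, continuity_pt_inv; [ apply derivable_continuous_pt, derivable_pt_id | lra ].
    + apply derivable_continuous_pt, derivable_pt_atan.
  - rewrite Rmin_left in Hc by lra.
    assert (P : 0 <= / (c * c) - / (1 + c ^ 2)).
    { assert (/ (1 + c ^ 2) <= / (c * c)) by (apply Rinv_le_contravar; nra). lra. }
    assert (0 <= (/ (c * c) - / (1 + c ^ 2)) * (t - s)) by (apply Rmult_le_pos; lra).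
    lra.
Qed.

(** The increments of a primitive are bounded by those of B atan. The end at 0 reduces to the end at
    infinity by t |-> 1/t, because atan(1/t) = pi/2 - atan t. *)
Lemma mint_exists (g : R -> C) (B : R) : (forall t, 0 < t -> ccts g t) ->
  (forall t, 0 < t -> Cmod (g t) <= B / (1 + t ^ 2)) -> exists l, mint g l.
Proof.
  intros HC HB.
  assert (B0 : 0 <= B).
  { assert (Q := Rle_trans _ _ _ (Cmod_ge_0 _) (HB 1 Rlt_0_1)). replace (B / (1 + 1 ^ 2)) with (B / 2) in Q by field. lra. }
  set (G := fun t => Cint g 1 t).
  assert (HD : forall t, 0 < t -> cder G t (g t)).
  { intros t Ht. apply (Cint_cder g 0 (Rmax 1 t + 1)).
    - assert (Q := Rmax_l 1 t); lra.
    - assert (Q := Rmax_r 1 t); lra.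
    - intros s Hs; apply HC; lra. }
  assert (L : forall s t, 0 < s -> s <= t -> Cmod (G t - G s) <= B * atan t - B * atan s).
  { intros s t Hs Hst. apply (curve_MVT G g (fun t => B * atan t) (fun t => B / (1 + t ^ 2))); auto.
    intros x Hx; split; [ apply HD; lra | split; [ | apply HB; lra ] ].
    auto_derive; auto. field. nra. }
  destruct (lim_inf_lip G B 1 Rlt_0_1) as [l1 H1].
  { intros s t Hs Hst; eapply Rle_trans; [ apply L; lra | ].
    assert (Q := atan_add_inv_le s t ltac:(lra) Hst). nra. }
  destruct (lim_inf_lip (fun t => G (/ t)) B 1 Rlt_0_1) as [l0 H0].
  { intros s t Hs Hst. rewrite Cmod_sub_sym.
    assert (P1 : 0 < / t) by (apply Rinv_0_lt_compat; lra).
    assert (P2 : / t <= / s) by (apply Rinv_le_contravar; lra).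
    eapply Rle_trans; [ apply L; lra | ].
    rewrite !atan_inv by lra.
    assert (Q := atan_add_inv_le s t ltac:(lra) Hst). nra. }
  exists (l1 - l0)%C, G, l0, l1. split; [ auto | split; [ auto | split; [ | split; auto ] ] ].
  apply lim_zero_inv; auto.
Qed.

(** The increments of B atan over any interval are at most B pi. The sharp constant on the half-line
    is pi/2, but only some fixed constant matters. *)
Lemma mint_le (g : R -> C) (B : R) (l : C) : mint g l ->
  (forall t, 0 < t -> Cmod (g t) <= B / (1 + t ^ 2)) -> Cmod l <= B * PI.
Proof.
  intros (G & l0 & l1 & HD & HC & H0 & H1 & ->) HB.
  assert (B0 : 0 <= B).
  { assert (Q := Rle_trans _ _ _ (Cmod_ge_0 _) (HB 1 Rlt_0_1)). replace (B / (1 + 1 ^ 2)) with (B / 2) in Q by field. lra. }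
  apply le_epsilon; intros e He.
  destruct (H0 (e / 2) ltac:(lra)) as [d [Hd K0]]. destruct (H1 (e / 2) ltac:(lra)) as [T K1].
  set (a := d / 2). set (b := Rmax T a + 1).
  assert (Q1 := Rmax_l T a). assert (Q2 := Rmax_r T a).
  specialize (K0 a ltac:(unfold a; lra)). specialize (K1 b ltac:(unfold b; lra)).
  assert (L : Cmod (G b - G a) <= B * atan b - B * atan a).
  { apply (curve_MVT G g (fun t => B * atan t) (fun t => B / (1 + t ^ 2))); [ unfold b; lra | ].
    intros x Hx; unfold a in *; split; [ apply HD; lra | split; [ | apply HB; lra ] ].
    auto_derive; auto. field. nra. }
  replace (l1 - l0)%C with ((G b - G a) + - (G b - l1) + (G a - l0))%C by ring.
  eapply Rle_trans; [ apply Cmod_tri3 | rewrite Cmod_opp ].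
  assert (A1 := atan_bound b). assert (A2 := atan_bound a).
  assert (B * atan b - B * atan a <= B * PI) by nra. lra.
Qed.

Section Mellin.

Variable phi : R -> C.
Hypothesis phiC : forall t, 0 < t -> ccts phi t.
(** Large positive [sg] expresses rapid decay at infinity, large negative [sg] rapid decay at 0. *)
Hypothesis phiB : forall sg, exists B, forall t, 0 < t -> Cmod (phi t) * Rpower t sg <= B.

Definition mellin_kernel (s : C) (t : R) : C := (phi t * Cexp ((s - 1) * RtoC (ln t)))%C.

Lemma Rpower_S (t sg : R) : 0 < t -> Rpower t (sg + 1) = Rpower t sg * t.
Proof. intros H; rewrite Rpower_plus, Rpower_1; auto. Qed.

Lemma Rpower_pred (t sg : R) : 0 < t -> Rpower t (sg - 1) = Rpower t sg * / t.
Proof. intros H; unfold Rminus; rewrite Rpower_plus, Rpower_Ropp, Rpower_1; auto. Qed.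

(** Multiplying by t + 1/t shifts [sg] by 1 in both directions, so induction reduces any power of it
    to [phiB]; the denominator 1 + t^2 costs one more shift by 2. The weight dominates |ln t| and
    e^|ln t|. *)
Lemma mellin_weight (n : nat) (sg : R) : exists B, forall t, 0 < t ->
  Cmod (phi t) * Rpower t sg * (t + / t) ^ n <= B / (1 + t ^ 2).
Proof.
  assert (W : forall sg, exists B, forall t, 0 < t -> Cmod (phi t) * Rpower t sg * (t + / t) ^ n <= B).
  { clear sg; induction n as [ | n IH]; intros sg.
    - destruct (phiB sg) as [B HB]; exists B; intros t Ht; simpl; rewrite Rmult_1_r; auto.
    - destruct (IH (sg + 1)) as [B1 H1]. destruct (IH (sg - 1)) as [B2 H2].
      exists (B1 + B2); intros t Ht. specialize (H1 t Ht). specialize (H2 t Ht).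
      rewrite Rpower_S in H1 by auto. rewrite Rpower_pred in H2 by auto. simpl.
      replace (Cmod (phi t) * Rpower t sg * ((t + / t) * (t + / t) ^ n)) with
        (Cmod (phi t) * (Rpower t sg * t) * (t + / t) ^ n + Cmod (phi t) * (Rpower t sg * / t) * (t + / t) ^ n)
        by ring. lra. }
  destruct (W sg) as [B1 H1]. destruct (W (sg + 1 + 1)) as [B2 H2].
  exists (B1 + B2); intros t Ht. specialize (H1 t Ht). specialize (H2 t Ht).
  rewrite !Rpower_S in H2 by auto.
  apply (Rmult_le_reg_r (1 + t ^ 2)); [ nra | ].
  replace ((B1 + B2) / (1 + t ^ 2) * (1 + t ^ 2)) with (B1 + B2) by (field; nra).
  replace (Cmod (phi t) * Rpower t sg * (t + / t) ^ n * (1 + t ^ 2)) with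
    (Cmod (phi t) * Rpower t sg * (t + / t) ^ n + Cmod (phi t) * (Rpower t sg * t * t) * (t + / t) ^ n) by ring.
  lra.
Qed.

Lemma mellin_kernel_mod (s : C) (t : R) : 0 < t ->
  Cmod (mellin_kernel s t) = Cmod (phi t) * Rpower t (Re s - 1).
Proof.
  intros Ht; unfold mellin_kernel. rewrite Cmod_mult, Cexp_mod. f_equal.
  unfold Rpower; f_equal. unfold Re; simpl; ring.
Qed.

Lemma ccts_RtoC_ln (t : R) : 0 < t -> ccts (fun s => RtoC (ln s)) t.
Proof.
  intros Ht; split; simpl; [ | apply continuous_const ].
  apply (ex_derive_continuous (V := R_NormedModule)). auto_derive; auto.
Qed.

Lemma mellin_kernel_ccts (s : C) (t : R) : 0 < t -> ccts (mellin_kernel s) t.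
Proof.
  intros Ht; unfold mellin_kernel; apply ccts_mult; [ auto | ].
  apply (cts_ccts Cexp (fun t => (s - 1) * RtoC (ln t))%C).
  - apply ccts_mult; [ apply ccts_const | apply ccts_RtoC_ln; auto ].
  - eapply hol_cts, hol_Cexp.
Qed.

Lemma mellin_exists (s : C) : exists l, mint (mellin_kernel s) l.
Proof.
  destruct (mellin_weight 0 (Re s - 1)) as [B HB].
  apply (mint_exists _ B); [ apply mellin_kernel_ccts | ].
  intros t Ht; rewrite mellin_kernel_mod by auto. specialize (HB t Ht). simpl in HB.
  rewrite Rmult_1_r in HB; exact HB.
Qed.

Definition mellin (s : C) : C := CInt0inf (mellin_kernel s).

Lemma mellin_mint (s : C) : mint (mellin_kernel s) (mellin s).
Proof.
  destruct (mellin_exists s) as [l Hl]. unfold mellin; rewrite (mint_CInt _ _ Hl); exact Hl.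
Qed.

Lemma exp_abs_ln (t : R) : 0 < t -> exp (Rabs (ln t)) <= t + / t.
Proof.
  intros Ht. assert (P : 0 < / t) by (apply Rinv_0_lt_compat; auto).
  unfold Rabs; destruct Rcase_abs; [ rewrite exp_Ropp | ]; rewrite exp_ln; lra.
Qed.

Lemma abs_ln_le (t : R) : 0 < t -> Rabs (ln t) <= t + / t.
Proof.
  intros Ht. assert (Q := exp_abs_ln t Ht). assert (Q' := exp_ineq1_le (Rabs (ln t))). lra.
Qed.

(** Differentiation under the integral sign. For |h| <= 1 the remainder e^(h x) - 1 - h x with x =
    ln t is at most |h|^2 x^2 e^|x| <= |h|^2 (t + 1/t)^3, hence the weight 3; the candidate
    derivative carries one factor ln t, hence the weight 1. *)
Lemma mellin_hol (s : C) : exists d, hol mellin s d.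
Proof.
  destruct (mellin_weight 1 (Re s - 1)) as [B1 H1].
  destruct (mellin_weight 3 (Re s - 1)) as [B3 H3].
  destruct (mint_exists (fun t => mellin_kernel s t * RtoC (ln t))%C B1) as [d Hd].
  { intros t Ht; apply ccts_mult; [ apply mellin_kernel_ccts | apply ccts_RtoC_ln ]; auto. }
  { intros t Ht; rewrite Cmod_mult, Cmod_R, mellin_kernel_mod by auto.
    eapply Rle_trans; [ | apply (H1 t Ht) ]. rewrite pow_1.
    apply Rmult_le_compat_l; [ | apply abs_ln_le; auto ].
    apply Rmult_le_pos; [ apply Cmod_ge_0 | apply Rlt_le, exp_pos ]. }
  exists d; intros e He.
  assert (Pi0 := PI_RGT_0).
  exists (Rmin 1 (e / (Rabs B3 * PI + 1))).
  assert (A3 := Rabs_pos B3).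
  assert (A4 : 0 <= Rabs B3 * PI) by (apply Rmult_le_pos; lra).
  split; [ apply Rmin_pos; [ lra | apply Rdiv_lt_0_compat; lra ] | ].
  intros w Hw. assert (L1 := Rlt_le_trans _ _ _ Hw (Rmin_l _ _)).
  assert (L2 := Rlt_le_trans _ _ _ Hw (Rmin_r _ _)).
  set (h := (w - s)%C) in *. assert (H0 := Cmod_ge_0 h).
  assert (MI : mint (fun t => 1 * (1 * mellin_kernel w t + -1 * mellin_kernel s t) +
                  (- h) * (mellin_kernel s t * RtoC (ln t)))%C
               (1 * (1 * mellin w + -1 * mellin s) + (- h) * d)%C).
  { apply mint_lin; [ | exact Hd ]. apply mint_lin; apply mellin_mint. }
  replace (mellin w - mellin s - d * h)%C with (1 * (1 * mellin w + -1 * mellin s) + (- h) * d)%C by ring.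
  eapply Rle_trans; [ apply (mint_le _ (Cmod h * Cmod h * B3) _ MI) | ].
  - intros t Ht.
    replace (1 * (1 * mellin_kernel w t + -1 * mellin_kernel s t) + (- h) * (mellin_kernel s t * RtoC (ln t)))%C
      with (mellin_kernel s t * (Cexp (h * RtoC (ln t)) - 1 - h * RtoC (ln t)))%C.
    2: { unfold mellin_kernel. replace ((w - 1) * RtoC (ln t))%C with ((s - 1) * RtoC (ln t) + h * RtoC (ln t))%C
           by (unfold h; ring). rewrite Cexp_plus. ring. }
    rewrite Cmod_mult, mellin_kernel_mod by auto.
    assert (N0 : 0 <= Cmod (phi t) * Rpower t (Re s - 1))
      by (apply Rmult_le_pos; [ apply Cmod_ge_0 | apply Rlt_le, exp_pos ]).
    assert (A := abs_ln_le t Ht). assert (A' := exp_abs_ln t Ht). assert (A0 := Rabs_pos (ln t)).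
    assert (Bd : Cmod (Cexp (h * RtoC (ln t)) - 1 - h * RtoC (ln t)) <= Cmod h * Cmod h * (t + / t) ^ 3).
    { eapply Rle_trans; [ apply Cexp_bound | ]. rewrite Cmod_mult, Cmod_R.
      replace (Cmod h * Rabs (ln t) * (Cmod h * Rabs (ln t)) * exp (Cmod h * Rabs (ln t)))
       with (Cmod h * Cmod h * (Rabs (ln t) * Rabs (ln t) * exp (Cmod h * Rabs (ln t)))) by ring.
      apply Rmult_le_compat_l; [ apply Rmult_le_pos; auto | ].
      replace ((t + / t) ^ 3) with ((t + / t) * (t + / t) * (t + / t)) by ring.
      apply Rmult_le_compat.
      - apply Rmult_le_pos; auto.
      - apply Rlt_le, exp_pos.
      - apply Rmult_le_compat; auto.
      - eapply Rle_trans; [ | exact A' ]. apply exp_mono. nra. }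
    eapply Rle_trans; [ apply Rmult_le_compat_l; [ exact N0 | exact Bd ] | ].
    specialize (H3 t Ht).
    replace (Cmod (phi t) * Rpower t (Re s - 1) * (Cmod h * Cmod h * (t + / t) ^ 3)) with
      (Cmod h * Cmod h * (Cmod (phi t) * Rpower t (Re s - 1) * (t + / t) ^ 3)) by ring.
    replace (Cmod h * Cmod h * B3 / (1 + t ^ 2)) with (Cmod h * Cmod h * (B3 / (1 + t ^ 2))) by (field; nra).
    apply Rmult_le_compat_l; [ apply Rmult_le_pos; auto | exact H3 ].
  - replace (Cmod h * Cmod h * B3 * PI) with (Cmod h * (B3 * PI) * Cmod h) by ring.
    apply Rmult_le_compat_r; auto.
    apply Rle_trans with (Cmod h * (Rabs B3 * PI + 1)).
    + apply Rmult_le_compat_l; auto. assert (Q := Rle_abs B3). nra.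
    + apply (Rmult_lt_compat_r (Rabs B3 * PI + 1)) in L2; [ | lra ].
      replace (e / (Rabs B3 * PI + 1) * (Rabs B3 * PI + 1)) with e in L2 by (field; lra). lra.
Qed.

Lemma mellin_real_kernel (s t : R) : 0 < t ->
  mellin_kernel (RtoC s) t = (phi t * RtoC (Rpower t (s - 1)))%C.
Proof.
  intros Ht; unfold mellin_kernel. f_equal.
  replace ((RtoC s - 1) * RtoC (ln t))%C with (RtoC ((s - 1) * ln t)) by (rewrite RtoC_mult, RtoC_minus; reflexivity).
  apply Cexp_R.
Qed.

(** The difference between [Lam] and the Mellin integral is entire and vanishes at all real points
    beyond [s0]. *)
Lemma mellin_continuation (Lam : C -> C) (s0 : R) : (forall s, exists d, hol Lam s d) ->
  (forall s : R, s0 < s -> CInt0inf (fun t => phi t * RtoC (Rpower t (s - 1)))%C = Lam (RtoC s)) ->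
  forall s : R, mint (fun t => phi t * RtoC (Rpower t (s - 1)))%C (Lam (RtoC s)).
Proof.
  intros HL HE.
  assert (MM : forall s : R, mint (fun t => phi t * RtoC (Rpower t (s - 1)))%C (mellin (RtoC s))).
  { intros s; apply (mint_ext (mellin_kernel (RtoC s))); [ apply mellin_real_kernel | apply mellin_mint ]. }
  assert (Z : forall x : R, (Lam (RtoC x) - mellin (RtoC x))%C = 0).
  { apply (entire_identity (fun s => Lam s - mellin s)%C s0).
    - intros w; destruct (HL w) as [d Hd]; destruct (mellin_hol w) as [d' Hd'].
      eexists; apply hol_minus; eassumption.
    - intros x Hx. rewrite <- HE, (mint_CInt _ _ (MM x)) by auto. ring. }
  intros s. replace (Lam (RtoC s)) with (mellin (RtoC s)); [ apply MM | ].
  replace (Lam (RtoC s)) with (Lam (RtoC s) - mellin (RtoC s) + mellin (RtoC s))%C by ring.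
  rewrite Z; ring.
Qed.

End Mellin.

(** * Period polynomials *)

Lemma Csum_ext (M : nat) (g h : nat -> C) : (forall n, (n <= M)%nat -> g n = h n) -> Csum M g = Csum M h.
Proof.
  induction M as [ | M IH]; intros H; simpl; [ apply H; auto | ].
  rewrite IH by (intros; apply H; lia). rewrite H by lia. reflexivity.
Qed.

Lemma Csum_scal (M : nat) (c : C) (g : nat -> C) : (c * Csum M g)%C = Csum M (fun n => c * g n)%C.
Proof. induction M as [ | M IH]; simpl; [ reflexivity | rewrite <- IH; ring ]. Qed.

Lemma Csum_shift (M : nat) (g : nat -> C) : Csum (S M) g = (g O + Csum M (fun n => g (S n)))%C.
Proof. induction M as [ | M IH]; simpl; [ reflexivity | simpl in IH; rewrite IH; ring ]. Qed.

Lemma Csum_rev (M : nat) (g : nat -> C) : Csum M g = Csum M (fun n => g (M - n)%nat).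
Proof.
  induction M as [ | M IH]; [ reflexivity | ].
  rewrite (Csum_shift M (fun n => g (S M - n)%nat)).
  change (Csum (S M) g) with (Csum M g + g (S M))%C. rewrite IH. apply Cplus_comm.
Qed.

(** Here k - 2 = M + 1/2, so M - n and n + 1/2 are complementary and the two Gamma factors of the
    denominator are exchanged. *)
Lemma binom_sym (M n : nat) : (n <= M)%nat ->
  binom (INR M + 5 / 2 - 2) (INR (M - n)) = binom (INR M + 5 / 2 - 2) (INR n + 1 / 2).
Proof.
  intros H; unfold binom. rewrite minus_INR by auto.
  replace (INR M - INR n + 1) with (INR M + 5 / 2 - 2 - (INR n + 1 / 2) + 1) by field.
  replace (INR M + 5 / 2 - 2 - (INR M - INR n) + 1) with (INR n + 1 / 2 + 1) by field.
  rewrite (Rmult_comm (RGamma (INR n + 1 / 2 + 1))). reflexivity.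
Qed.

Lemma binom_sym' (M n : nat) : (n <= M)%nat ->
  binom (INR M + 5 / 2 - 2) (INR (M - n) + 1 / 2) = binom (INR M + 5 / 2 - 2) (INR n).
Proof.
  intros H; rewrite <- binom_sym by lia. do 2 f_equal. lia.
Qed.

(** * Primitives of functions that decay in vertical strips *)

(** The constants may depend on the strip: the powers of w in Phi destroy the periodicity of [f], so
    no bound uniform in Re w is asked for. The exponent 2 is what integrability at i oo requires
    here. *)
Definition strip_decay (g : C -> C) : Prop :=
  (forall w, 0 < Im w -> exists d, hol g w d) /\
  (forall X, exists B Y, 0 < Y /\ forall w, Rabs (Re w) <= X -> Y < Im w -> Cmod (g w) <= B / (Im w * Im w)).

Lemma strip_decay_ext (g h : C -> C) : (forall w, 0 < Im w -> g w = h w) -> strip_decay g -> strip_decay h.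
Proof.
  intros E [H1 H2]; split.
  - intros w Hw; destruct (H1 w Hw) as [d Hd]; exists d.
    apply (hol_ext_loc g h w d (Im w)); auto. intros v Hv; apply E.
    assert (B := im_le_Cmod (v - w)). change (Im (v - w)%C) with (Im v - Im w) in B.
    assert (B' := Rle_abs (- (Im v - Im w))). rewrite Rabs_Ropp in B'. lra.
  - intros X; destruct (H2 X) as (B & Y & HY & K); exists B, Y; split; auto.
    intros w Hw Hw'; rewrite <- E by lra; auto.
Qed.

Lemma strip_decay_lin (g h : C -> C) (a b : C) : strip_decay g -> strip_decay h ->
  strip_decay (fun w => a * g w + b * h w)%C.
Proof.
  intros [H1 H2] [H1' H2']; split.
  - intros w Hw; destruct (H1 w Hw) as [d Hd]; destruct (H1' w Hw) as [d' Hd'].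
    eexists; apply hol_plus; apply hol_scal; eassumption.
  - intros X; destruct (H2 X) as (B & Y & HY & K); destruct (H2' X) as (B' & Y' & HY' & K').
    exists (Cmod a * B + Cmod b * B'), (Rmax Y Y').
    assert (Q1 := Rmax_l Y Y'). assert (Q2 := Rmax_r Y Y'). split; [ lra | intros w Hw Hw' ].
    specialize (K w Hw ltac:(lra)). specialize (K' w Hw ltac:(lra)).
    eapply Rle_trans; [ apply Cmod_triangle | rewrite !Cmod_mult ].
    replace ((Cmod a * B + Cmod b * B') / (Im w * Im w)) with
      (Cmod a * (B / (Im w * Im w)) + Cmod b * (B' / (Im w * Im w))) by (field; lra).
    apply Rplus_le_compat; apply Rmult_le_compat_l; auto; apply Cmod_ge_0.
Qed.

Lemma strip_decay_sum (M : nat) (g : nat -> C -> C) : (forall n, strip_decay (g n)) ->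
  strip_decay (fun w => Csum M (fun n => g n w)).
Proof.
  intros H; induction M as [ | M IH]; simpl; [ apply H | ].
  apply (strip_decay_ext (fun w => 1 * Csum M (fun n => g n w) + 1 * g (S M) w)%C); [ intros; ring | ].
  apply strip_decay_lin; auto.
Qed.

(** Gives a meaning to G(i oo): on the imaginary axis the tails are O(1/t), and the horizontal
    increment from (0, t) to (x, t) is O(|x| / t^2), so every vertical line has the same limit. *)
Lemma strip_decay_limit (g G : C -> C) : strip_decay g -> (forall w, 0 < Im w -> hol G w (g w)) ->
  exists L, forall x, lim_inf (fun t => G (x, t)) L.
Proof.
  intros [_ Hg] HG.
  destruct (Hg 0) as (B & Y & HY & K).
  destruct (lim_inf_lip (fun t => G (0, t)) B Y HY) as [L HL].
  { intros s t Hs Hst.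
    replace (B * (/ s - / t)) with (- B * / t - - B * / s) by ring.
    apply (curve_MVT (fun t => G (0, t)) (fun t => g (0, t) * Ci)%C (fun t => - B * / t) (fun t => B / (t * t))); auto.
    intros x Hx; split; [ | split ].
    - apply (cder_hol G (fun t => (0, t))); [ apply cder_vert | apply HG; simpl; lra ].
    - auto_derive; [ lra | field; lra ].
    - rewrite Cmod_mult, Cmod_Ci, Rmult_1_r. apply (K (0, x)); simpl; [ rewrite Rabs_R0; lra | lra ]. }
  exists L; intros x e He.
  destruct (HL (e / 2) ltac:(lra)) as [T HT].
  destruct (Hg (Rabs x)) as (B' & Y' & HY' & K').
  assert (Ax := Rabs_pos x). assert (AB := Rabs_pos B').
  set (q := Rabs B' * Rabs x).
  assert (Hq : 0 <= q) by (apply Rmult_le_pos; auto).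
  set (T' := Rmax (Rmax T Y') (Rmax 1 (2 * q / e))).
  assert (Q1 := Rmax_l (Rmax T Y') (Rmax 1 (2 * q / e))).
  assert (Q2 := Rmax_r (Rmax T Y') (Rmax 1 (2 * q / e))). fold T' in Q1, Q2.
  assert (Q3 := Rmax_l T Y'). assert (Q4 := Rmax_r T Y').
  assert (Q5 := Rmax_l 1 (2 * q / e)). assert (Q6 := Rmax_r 1 (2 * q / e)).
  exists T'; intros t Ht.
  assert (D : Cmod (G (x, t) - G (0, t)) <= Rabs B' / (t * t) * Cmod ((x, t) - (0, t))).
  { apply hol_lip_ex. intros s Hs.
    assert (Ei : Im ((0, t) + ((x, t) - (0, t)) * RtoC s)%C = t) by (unfold Im; simpl; ring).
    assert (Er : Re ((0, t) + ((x, t) - (0, t)) * RtoC s)%C = s * x) by (unfold Re; simpl; ring).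
    eexists; split; [ apply HG; rewrite Ei; lra | ].
    eapply Rle_trans; [ apply K' | ].
    - rewrite Er, Rabs_mult, (Rabs_pos_eq s) by lra. nra.
    - rewrite Ei; lra.
    - rewrite Ei. apply Rmult_le_compat_r; [ apply Rlt_le, Rinv_0_lt_compat; nra | apply Rle_abs ]. }
  replace ((x, t) - (0, t))%C with (RtoC x) in D by (apply injective_projections; simpl; ring).
  rewrite Cmod_R in D.
  replace (G (x, t) - L)%C with ((G (x, t) - G (0, t)) + (G (0, t) - L))%C by ring.
  eapply Rle_lt_trans; [ apply Cmod_triangle | ].
  specialize (HT t ltac:(lra)).
  assert (S1 : Rabs B' / (t * t) * Rabs x <= e / 2).
  { replace (Rabs B' / (t * t) * Rabs x) with (q * / (t * t)) by (unfold q; field; lra).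
    apply (Rmult_le_reg_r (t * t)); [ nra | ]. rewrite Rmult_assoc, Rinv_l, Rmult_1_r by nra.
    apply Rle_trans with (e / 2 * t); [ | apply Rmult_le_compat_l; nra ].
    apply Rle_trans with (e / 2 * (2 * q / e)); [ right; field; lra | apply Rmult_le_compat_l; lra ]. }
  lra.
Qed.

Lemma ln_le_mono (x y : R) : 0 < x -> x <= y -> ln x <= ln y.
Proof. intros H [L | ->]; [ left; apply ln_increasing; auto | right; reflexivity ]. Qed.

Lemma exp_ln_le_pow (s r : R) (K : nat) : s <= INR K -> 1 <= r -> exp (s * ln r) <= r ^ K.
Proof.
  intros Hs Hr. rewrite <- Rpower_pow by lra. apply exp_mono.
  apply Rmult_le_compat_r; auto. rewrite <- ln_1. apply ln_le_mono; lra.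
Qed.

Lemma nat_above (s : R) : exists K : nat, s <= INR K.
Proof.
  destruct (INR_unbounded s) as [K HK]; exists K; lra.
Qed.

Lemma strip_decay_power (f : C -> C) (s : R) :
  (forall z, 0 < Im z -> exists d, hol f z d) ->
  (forall K, exists B Y, 0 <= B /\ 0 < Y /\ forall z, Y < Im z -> Cmod (f z) <= B / Im z ^ K) ->
  strip_decay (fun w => f w * Cexp (RtoC s * logH w))%C.
Proof.
  intros Hf Hd; split.
  - intros w Hw; destruct (Hf w Hw) as [d H]. eexists. apply hol_mult; [ exact H | ].
    apply (hol_comp Cexp (fun w => RtoC s * logH w)%C); [ apply hol_scal, hol_logH; auto | apply hol_Cexp ].
  - intros X. destruct (nat_above s) as [K HK].
    (* [K] of the powers absorb |w|^s and two remain. For Im w = y above 1 and [X] one has 1 <= y <=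
       |w| <= 2y, so |w|^s <= (2y)^K also when s is negative. *)
    destruct (Hd (K + 2)%nat) as (B & Y & HB & HY & HD).
    exists (B * 2 ^ K), (Rmax Y (Rmax 1 X)).
    assert (Q1 := Rmax_l Y (Rmax 1 X)). assert (Q2 := Rmax_r Y (Rmax 1 X)).
    assert (Q3 := Rmax_l 1 X). assert (Q4 := Rmax_r 1 X).
    split; [ lra | intros w Hw Hy ].
    set (y := Im w) in *.
    assert (W1 : y <= Cmod w) by (eapply Rle_trans; [ apply Rle_abs | apply im_le_Cmod ]).
    assert (W2 : Cmod w <= 2 * y).
    { eapply Rle_trans; [ apply Cmod_le_abs | ]. fold y. rewrite (Rabs_pos_eq y) by lra. lra. }
    rewrite Cmod_mult, Cexp_mod.
    assert (E : Re (RtoC s * logH w)%C = s * ln (Cmod w)) by (unfold Re; simpl; ring).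
    rewrite E.
    assert (P1 : exp (s * ln (Cmod w)) <= (2 * y) ^ K).
    { eapply Rle_trans; [ apply exp_ln_le_pow; eauto; lra | apply pow_incr; lra ]. }
    specialize (HD w ltac:(fold y; lra)). fold y in HD.
    assert (Py : 0 < y ^ K) by (apply pow_lt; lra).
    eapply Rle_trans; [ apply Rmult_le_compat; [ apply Cmod_ge_0 | apply Rlt_le, exp_pos | exact HD | exact P1 ] | ].
    rewrite pow_add, Rpow_mult_distr. right; simpl; field. split; lra.
Qed.

(** * Slash operators in explicit form, and constants as exponentials *)

Lemma moeb_WN (N : nat) (z : C) : (0 < N)%nat -> z <> 0 -> moeb (WN N) z = (- / (RtoC (INR N) * z))%C.
Proof.
  intros HN Hz. unfold moeb, WN, mk, ma, mb, mc, md; simpl.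
  assert (PN : 0 < INR N) by (apply lt_0_INR; auto).
  assert (S0 : 0 < sqrt (INR N)) by (apply sqrt_lt_R0; auto).
  assert (NS : RtoC (sqrt (INR N)) <> 0) by (intros E; apply RtoC_inj in E; lra).
  rewrite <- (sqrt_sqrt (INR N)) at 3 by lra.
  rewrite RtoC_opp, RtoC_inv, RtoC_mult by lra. field; auto.
Qed.

(** In the nonpositive weight -M the automorphy factor is a genuine power with natural exponent, so
    no branch enters. *)
Lemma slash_int_WN (M N : nat) (F : C -> C) (z : C) : (0 < N)%nat -> z <> 0 ->
  slash_int (- Z.of_nat M) (WN N) F z =
  ((RtoC (sqrt (INR N)) * z) ^ M * F (- / (RtoC (INR N) * z)))%C.
Proof.
  intros HN Hz. unfold slash_int. rewrite moeb_WN by auto. f_equal.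
  unfold WN, mk, mc, md; simpl. rewrite Z.opp_involutive.
  replace (RtoC (sqrt (INR N)) * z + 0)%C with (RtoC (sqrt (INR N)) * z)%C by ring.
  destruct M as [ | M]; [ reflexivity | ]. simpl Z.of_nat. unfold Cpowz. rewrite SuccNat2Pos.id_succ. reflexivity.
Qed.

Lemma slash_int_I2 (m : Z) (F : C -> C) (z : C) : slash_int m I2 F z = F z.
Proof.
  unfold slash_int, moeb, I2, mk, ma, mb, mc, md; simpl.
  replace ((1 * z + 0) / (0 * z + 1))%C with z by field.
  replace (0 * z + 1)%C with (RtoC 1) by ring.
  destruct (- m)%Z; simpl; rewrite ?Cpow_1_l; field.
Qed.

Lemma cpow_1_l (w : C) : cpow 1 w = 1.
Proof.
  rewrite cpow_Cexp by (intros E; apply RtoC_inj in E; lra).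
  replace (Clog 1) with (RtoC 0).
  - replace (w * 0)%C with (RtoC 0) by ring. apply Cexp_0.
  - unfold Clog. rewrite Cmod_1, ln_1, Carg_right by (simpl; lra).
    simpl; unfold Rdiv; rewrite Rmult_0_l, atan_0; reflexivity.
Qed.

(** The automorphy factor of degree M turns the pole of order M - n, created by substituting
    -1/(Nz), into z^n; this is why the terms are matched under n |-> M - n. *)
Lemma pow_inversion (M n : nat) (p q z : C) : (n <= M)%nat -> z <> 0 ->
  ((p * z) ^ M * (q * / z) ^ (M - n))%C = (p ^ M * q ^ (M - n) * z ^ n)%C.
Proof.
  intros H Hz. rewrite !Cpow_mult_l, Cpow_inv by auto.
  replace (z ^ M)%C with (z ^ (M - n) * z ^ n)%C by (rewrite <- Cpow_add_r; f_equal; lia).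
  assert (N : (z ^ (M - n))%C <> 0) by (apply Cpow_nz; auto).
  field; auto.
Qed.

Lemma RtoC_Cexp_ln (x : R) : 0 < x -> RtoC x = Cexp (RtoC (ln x)).
Proof. intros H; rewrite Cexp_R, exp_ln; auto. Qed.

Lemma sqrt_Cexp (x : R) : 0 < x -> RtoC (sqrt x) = Cexp (RtoC (ln x / 2)).
Proof.
  intros H; rewrite Cexp_R. f_equal. rewrite <- Rpower_sqrt by auto. unfold Rpower; f_equal; field.
Qed.

Lemma Copp_Ci_Cexp : (- Ci)%C = Cexp (- (Ci * RtoC (PI / 2))).
Proof.
  rewrite Cexp_opp, Cexp_PI2. assert (N := Ci_neq0).
  assert (E : (Ci * Ci = - 1)%C) by (apply injective_projections; simpl; ring).
  replace (- Ci)%C with (/ Ci * - (Ci * Ci))%C by (field; auto). rewrite E; ring.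
Qed.

Lemma Cexp_add_2PI (z w : C) : w = (z + Ci * RtoC (2 * PI))%C -> Cexp w = Cexp z.
Proof. intros ->; rewrite Cexp_plus, Cexp_2PI; ring. Qed.

(** * Periodicity, inversion and decay of the cusp form *)

Lemma cusp_hol (k : R) (N : nat) (f : C -> C) : cusp_form_star k N f ->
  forall z, 0 < Im z -> exists d, hol f z d.
Proof. intros [H _] z Hz; apply hol_of_ex_derive, H; exact Hz. Qed.

Lemma moeb_T (b : R) (z : C) : moeb (mk 1 b 0 1) z = (z + RtoC b)%C.
Proof. unfold moeb, mk, ma, mb, mc, md; simpl. field. Qed.

Lemma cusp_periodic (k : R) (N : nat) (f : C -> C) : cusp_form_star k N f ->
  forall z, 0 < Im z -> f (z + 1)%C = f z.
Proof.
  intros (_ & H & _) z Hz.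
  assert (E := H 1%Z 1%Z 0%Z 1%Z eq_refl ltac:(apply Z.divide_0_r) z Hz).
  unfold slash_half in E. rewrite moeb_T in E.
  (* For the translation c = 0 and d = 1: the Jacobi symbol is an empty product and [epsd 1] is 1,
     so the multiplier is trivial. *)
  replace (kron 0 1) with 1%Z in E by reflexivity.
  replace (epsd 1) with (RtoC 1) in E by reflexivity.
  replace (Cplus (Cmult (IZR 0) z) (IZR 1)) with (RtoC 1) in E by ring.
  rewrite !cpow_1_l in E. rewrite <- E. ring.
Qed.

Lemma cusp_vanish (k : R) (N : nat) (f : C -> C) : cusp_form_star k N f ->
  forall eps, 0 < eps -> exists Y, forall z, Y < Im z -> Cmod (f z) < eps.
Proof.
  intros (_ & _ & _ & H) eps He.
  destruct (H 1%Z 0%Z 0%Z 1%Z eq_refl eps He) as [Y HY].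
  exists Y; intros z Hz; specialize (HY z Hz).
  rewrite moeb_T in HY.
  replace (Cplus (Cmult (IZR 0) z) (IZR 1)) with (RtoC 1) in HY by ring.
  rewrite cpow_1_l in HY. replace (1 * f (z + 0))%C with (f z) in HY; auto.
  replace (z + 0)%C with z by ring. ring.
Qed.

(** The relation f|W_N = f with the factor (-i sqrt N w)^k moved to the other side and written as an
    exponential in [logH w], ready to be combined with the other powers. *)
Lemma cusp_inversion (k : R) (N : nat) (f : C -> C) : (0 < N)%nat -> cusp_form_star k N f ->
  forall w, 0 < Im w -> f (- / (RtoC (INR N) * w))%C =
    (Cexp (RtoC k * (RtoC (ln (INR N) / 2) + logH w - Ci * RtoC (PI / 2))) * f w)%C.
Proof.
  intros HN (_ & _ & H & _) w Hw. specialize (H w Hw).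
  assert (PN : 0 < INR N) by (apply lt_0_INR; auto).
  assert (S0 : 0 < sqrt (INR N)) by (apply sqrt_lt_R0; auto).
  assert (Nw := Im_pos_neq0 w Hw).
  unfold slash_half_W in H. rewrite cpow_Cexp in H.
  2: { repeat apply Cmult_neq_0; auto.
       - intros E; apply Ci_neq0. replace Ci with (- - Ci)%C by ring. rewrite E; ring.
       - intros E; apply RtoC_inj in E; lra. }
  rewrite Clog_rot in H by auto.
  assert (L : ln (sqrt (INR N)) = ln (INR N) / 2).
  { rewrite <- Rpower_sqrt by auto. unfold Rpower; rewrite ln_exp; field. }
  rewrite L in H. rewrite <- H.
  rewrite Cmult_assoc, <- Cexp_plus.
  match goal with |- ?x = _ => rewrite <- (Cmult_1_l x) at 1 end. f_equal.
  rewrite RtoC_opp. rewrite <- Cexp_0. f_equal. ring.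
Qed.

(** The hypothesis [phiB] of the Mellin section for t |-> f(it): decay at i oo for large t,
    inversion for small t, compactness in between. *)
Lemma cusp_bound (k : R) (N : nat) (f : C -> C) : (0 < N)%nat -> cusp_form_star k N f ->
  forall sg, exists B, forall t, 0 < t -> Cmod (f (0, t)) * Rpower t sg <= B.
Proof.
  intros HN Hf sg.
  assert (PN : 0 < INR N) by (apply lt_0_INR; auto).
  assert (Inf : forall sg, exists B Y, 0 < Y /\ forall t, Y < t -> Cmod (f (0, t)) * Rpower t sg <= B).
  { clear sg; intros sg. destruct (nat_above sg) as [K HK].
    destruct (decay f (cusp_hol k N f Hf) (cusp_periodic k N f Hf) (cusp_vanish k N f Hf) K)
      as (B & Y & HB & HY & HD).
    exists B, (Rmax Y 1). assert (Q1 := Rmax_l Y 1). assert (Q2 := Rmax_r Y 1).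
    split; [ lra | intros t Ht ]. specialize (HD (0, t) ltac:(simpl; lra)). simpl in HD.
    assert (Pt : 0 < t ^ K) by (apply pow_lt; lra).
    eapply Rle_trans; [ apply Rmult_le_compat; [ apply Cmod_ge_0 | apply Rlt_le, exp_pos | exact HD | ] | ].
    - apply (exp_ln_le_pow sg t K HK); lra.
    - right; field; lra. }
  destruct (Inf sg) as (B1 & Y1 & HY1 & H1).
  (* Under t = 1/(Nu) the product |f(it)| t^sg becomes N^(k/2 - sg) |f(iu)| u^(k - sg), which is why
     the bound at infinity is taken with the exponent k - sg. *)
  destruct (Inf (k - sg)) as (B2 & Y2 & HY2 & H2).
  set (q := Rpower (INR N) (k / 2 - sg)).
  assert (Hq : 0 < q) by apply exp_pos.
  assert (H0 : forall t, 0 < t < / (INR N * Y2) -> Cmod (f (0, t)) * Rpower t sg <= q * B2).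
  { intros t Ht. set (u := / (INR N * t)).
    assert (Hu : Y2 < u).
    { unfold u. rewrite <- (Rinv_inv Y2). apply Rinv_lt_contravar.
      - apply Rmult_lt_0_compat; [ apply Rmult_lt_0_compat; lra | apply Rinv_0_lt_compat; auto ].
      - destruct Ht as [Ht1 Ht2]. apply (Rmult_lt_compat_l (INR N)) in Ht2; auto.
        replace (INR N * / (INR N * Y2)) with (/ Y2) in Ht2 by (field; lra). exact Ht2. }
    assert (Hu0 : 0 < u) by lra.
    assert (Et : t = / (INR N * u)) by (unfold u; field; lra).
    assert (E : (0, t) = (- / (RtoC (INR N) * (0, u)))%C).
    { rewrite Et. apply injective_projections; simpl; field; lra. }
    assert (Eln : ln t = - ln (INR N) - ln u).
    { rewrite Et, ln_Rinv, ln_mult by (auto; apply Rmult_lt_0_compat; auto). ring. }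
    rewrite E, (cusp_inversion k N f HN Hf) by (simpl; auto).
    rewrite Cmod_mult, Cexp_mod.
    assert (Er : Re (RtoC k * (RtoC (ln (INR N) / 2) + logH (0, u) - Ci * RtoC (PI / 2)))%C =
                 k * (ln (INR N) / 2 + ln u)).
    { unfold logH. replace (Cmod (0, u)) with u; [ unfold Re; simpl; ring | ].
      unfold Cmod; simpl. replace (0 * (0 * 1) + u * (u * 1)) with (u * u) by ring.
      symmetry; apply sqrt_square; lra. }
    rewrite Er. unfold Rpower at 1. rewrite Eln.
    replace (exp (k * (ln (INR N) / 2 + ln u)) * Cmod (f (0, u)) * exp (sg * (- ln (INR N) - ln u)))
      with (Cmod (f (0, u)) * (exp (k * (ln (INR N) / 2 + ln u)) * exp (sg * (- ln (INR N) - ln u)))) by ring.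
    rewrite <- exp_plus.
    replace (k * (ln (INR N) / 2 + ln u) + sg * (- ln (INR N) - ln u))
      with ((k / 2 - sg) * ln (INR N) + (k - sg) * ln u) by field.
    rewrite exp_plus. change (exp ((k / 2 - sg) * ln (INR N))) with q.
    change (exp ((k - sg) * ln u)) with (Rpower u (k - sg)).
    specialize (H2 u Hu).
    replace (Cmod (f (0, u)) * (q * Rpower u (k - sg))) with (q * (Cmod (f (0, u)) * Rpower u (k - sg))) by ring.
    apply Rmult_le_compat_l; lra. }
  set (d := / (INR N * Y2)).
  assert (Hd : 0 < d) by (apply Rinv_0_lt_compat, Rmult_lt_0_compat; auto).
  (* The interval from d/2 to Z + 1 covers the gap between the two ranges and is never empty,
     whichever of [Y1] and [d] is larger. *)
  set (Z := Rmax Y1 d). assert (Q1 := Rmax_l Y1 d). assert (Q2 := Rmax_r Y1 d). fold Z in Q1, Q2.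
  destruct (ccts_on_bounded (fun t => f (0, t) * RtoC (Rpower t sg))%C (d / 2) (Z + 1) ltac:(lra)) as (B3 & P3 & H3).
  { intros t Ht. rewrite Rmin_left, Rmax_right in Ht by lra. apply ccts_mult.
    - apply (cts_ccts f (fun t => (0, t))); [ eapply cder_ccts; apply cder_vert | ].
      destruct (cusp_hol k N f Hf (0, t)) as [e He]; [ simpl; lra | eapply hol_cts; exact He ].
    - split; simpl; [ | apply continuous_const ].
      apply (ex_derive_continuous (V := R_NormedModule)). unfold Rpower; auto_derive; lra. }
  exists (Rabs B1 + Rabs (q * B2) + B3).
  assert (A1 := Rle_abs B1). assert (A2 := Rle_abs (q * B2)).
  assert (A3 := Rabs_pos B1). assert (A4 := Rabs_pos (q * B2)).
  intros t Ht. destruct (Rlt_le_dec t d) as [L | L].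
  - specialize (H0 t (conj Ht L)). lra.
  - destruct (Rlt_le_dec Y1 t) as [L' | L']; [ specialize (H1 t L'); lra | ].
    specialize (H3 t ltac:(lra)). rewrite Cmod_mult, Cmod_R, (Rabs_pos_eq (Rpower t sg)) in H3 by (apply Rlt_le, exp_pos).
    lra.
Qed.

(** * The kernel Phi on the upper half-plane and under inversion *)

Definition coefA (M N : nat) (n : nat) (z : C) : C :=
  (RtoC (binom (INR M + 5 / 2 - 2) (INR n)) * (Ci * RtoC (INR N) * z) ^ n)%C.

Definition coefB (M N : nat) (n : nat) (z : C) : C :=
  (cpow Ci (RtoC (INR M + 5 / 2)) / RtoC (Rpower (INR N) (1 / 4)) *
   (RtoC (binom (INR M + 5 / 2 - 2) (INR n + 1 / 2)) * (Ci * z) ^ n))%C.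

Definition expB (M : nat) (a : R) (n : nat) : R := 2 * (INR M + 5 / 2) - 9 / 2 - a - INR n.

Definition termA (M N : nat) (a : R) (z w : C) (n : nat) : C :=
  (coefA M N n z * Cexp (RtoC (a - INR n) * logH w))%C.

Definition termB (M N : nat) (a : R) (z w : C) (n : nat) : C :=
  (coefB M N n z * Cexp (RtoC (expB M a n) * (RtoC (ln (INR N)) + logH w - Ci * RtoC PI)))%C.

(** Removes all principal powers of w: both families become exponentials in [logH w], the second
    with the shift by -i pi that comes from the base -Nw. *)
Lemma Phi_upper (M N : nat) (a : R) (z w : C) : (0 < N)%nat -> 0 < Im w ->
  Phi M N a z w = Csum M (fun n => termA M N a z w n + termB M N a z w n)%C.
Proof.
  intros HN Hw. assert (PN : 0 < INR N) by (apply lt_0_INR; auto).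
  assert (Nw := Im_pos_neq0 w Hw).
  unfold Phi; apply Csum_ext; intros n _. unfold termA, termB, coefA, coefB, expB.
  rewrite (cpow_Cexp w), Clog_H by auto.
  rewrite (cpow_Cexp (RtoC (- INR N) * w)), Clog_neg by
    (auto; apply Cmult_neq_0; auto; intros E; apply RtoC_inj in E; lra).
  reflexivity.
Qed.

(** For fixed z the integrand is a finite linear combination of functions f(w) w^s with s real. *)
Lemma strip_decay_Psi (M N : nat) (f : C -> C) (a : R) (z : C) : (0 < N)%nat ->
  cusp_form_star (INR M + 5 / 2) N f -> strip_decay (fun w => f w * Phi M N a z w)%C.
Proof.
  intros HN Hf.
  assert (D := decay f (cusp_hol _ N f Hf) (cusp_periodic _ N f Hf) (cusp_vanish _ N f Hf)).
  apply (strip_decay_ext (fun w => Csum M (fun n =>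
     coefA M N n z * (f w * Cexp (RtoC (a - INR n) * logH w)) +
     (coefB M N n z * Cexp (RtoC (expB M a n) * (RtoC (ln (INR N)) - Ci * RtoC PI))) *
       (f w * Cexp (RtoC (expB M a n) * logH w))))%C).
  - intros w Hw; rewrite Phi_upper, Csum_scal by auto. apply Csum_ext; intros n _.
    unfold termA, termB.
    replace (RtoC (expB M a n) * (RtoC (ln (INR N)) + logH w - Ci * RtoC PI))%C with
      (RtoC (expB M a n) * (RtoC (ln (INR N)) - Ci * RtoC PI) + RtoC (expB M a n) * logH w)%C by ring.
    rewrite Cexp_plus. ring.
  - apply (strip_decay_sum M (fun n w => _)); intros n.
    apply strip_decay_lin; apply strip_decay_power; auto; apply (cusp_hol _ N f Hf).
Qed.

Lemma Ci_pow_Cexp (n : nat) : (Ci ^ n)%C = Cexp (RtoC (INR n) * (Ci * RtoC (PI / 2))).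
Proof. rewrite <- Cexp_pow, Cexp_PI2; reflexivity. Qed.

Lemma Copp_Ci_pow_Cexp (n : nat) : ((- Ci) ^ n)%C = Cexp (RtoC (INR n) * - (Ci * RtoC (PI / 2))).
Proof. rewrite <- Cexp_pow, <- Copp_Ci_Cexp; reflexivity. Qed.

Lemma sqrt_pow_Cexp (x : R) (n : nat) : 0 < x ->
  (RtoC (sqrt x) ^ n)%C = Cexp (RtoC (INR n) * RtoC (ln x / 2)).
Proof. intros H; rewrite <- Cexp_pow, <- sqrt_Cexp by auto; reflexivity. Qed.

Lemma RtoC_pow_Cexp (x : R) (n : nat) : 0 < x -> (RtoC x ^ n)%C = Cexp (RtoC (INR n) * RtoC (ln x)).
Proof. intros H; rewrite <- Cexp_pow, <- RtoC_Cexp_ln by auto; reflexivity. Qed.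

Lemma RtoC_inv_pow_Cexp (x : R) (n : nat) : 0 < x ->
  ((/ RtoC x) ^ n)%C = Cexp (RtoC (INR n) * - RtoC (ln x)).
Proof. intros H; rewrite <- Cexp_pow, Cexp_opp, <- RtoC_Cexp_ln by auto; reflexivity. Qed.

Lemma inv_Nsqr_Cexp (x : R) (u : C) : 0 < x -> 0 < Im u ->
  (/ (RtoC x * (u * u)))%C = Cexp (- (RtoC (ln x) + (logH u + logH u))).
Proof.
  intros H Hu. rewrite Cexp_opp, !Cexp_plus, <- RtoC_Cexp_ln, Cexp_logH by auto. reflexivity.
Qed.

Lemma Cdiv_Rpower (x y : R) (w : C) : (w / RtoC (Rpower x y))%C = (w * Cexp (- RtoC (y * ln x)))%C.
Proof. rewrite Cexp_opp, Cexp_R; reflexivity. Qed.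

(** The term of index M - n of the first family, taken at the inverted points, becomes the term of
    index n of the second. The powers of z are settled by [pow_inversion]; every other factor except
    f(u) and the binomial is an exponential, and it remains to add exponents. The last factor on the
    left is the derivative of -1/(Nu). *)
Lemma termA_inversion (M N n : nat) (f : C -> C) (a : R) (z u : C) : (0 < N)%nat ->
  cusp_form_star (INR M + 5 / 2) N f -> z <> 0 -> 0 < Im u -> (n <= M)%nat ->
  ((RtoC (sqrt (INR N)) * z) ^ M *
    (f (- / (RtoC (INR N) * u)) * termA M N a (- / (RtoC (INR N) * z)) (- / (RtoC (INR N) * u)) (M - n))
    * / (RtoC (INR N) * (u * u)))%C
  = ((- Ci) ^ M * (f u * termB M N a z u n))%C.
Proof.
  intros HN Hf Hz Hu Hn.
  assert (PN : 0 < INR N) by (apply lt_0_INR; auto).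
  assert (NN : RtoC (INR N) <> 0) by (intros E; apply RtoC_inj in E; lra).
  rewrite (cusp_inversion _ N f HN Hf u Hu).
  unfold termA, termB, coefA, coefB. rewrite (proj2 (logH_inv (INR N) u PN Hu)), binom_sym by auto.
  replace (Ci * RtoC (INR N) * - / (RtoC (INR N) * z))%C with (- Ci * / z)%C by (field; auto).
  rewrite (inv_Nsqr_Cexp (INR N) u PN Hu), Cdiv_Rpower, (Cpow_mult_l Ci z n), Ci_pow_Cexp, cpow_Ci.
  rewrite (Copp_Ci_pow_Cexp M).
  set (b := RtoC (binom _ _)). set (l := ln (INR N)). set (L := logH u).
  assert (ZP := pow_inversion M n (RtoC (sqrt (INR N))) (- Ci) z Hn Hz).
  rewrite (sqrt_pow_Cexp (INR N) M PN), (Copp_Ci_pow_Cexp (M - n)) in ZP. fold l in ZP.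
  match goal with |- (_ * (?x2 * _ * (_ * ?x3)) * ?x4)%C = (?y1 * (_ * (?y2 * ?y3 * (_ * (?y4 * _)) * ?y5)))%C =>
    set (X2 := x2); set (X3 := x3); set (X4 := x4); set (Y1 := y1); set (Y2 := y2); set (Y3 := y3);
    set (Y4 := y4); set (Y5 := y5) end.
  match type of ZP with _ = (?x0 * ?x1 * _)%C => set (X0 := x0) in ZP; set (X1 := x1) in ZP end.
  (* The exponents on the two sides are not equal: the right one exceeds the left one by exactly 2
     pi i. *)
  assert (EX : (X0 * X1 * X2 * X3 * X4)%C = (Y1 * Y2 * Y3 * Y4 * Y5)%C).
  { unfold X0, X1, X2, X3, X4, Y1, Y2, Y3, Y4, Y5. rewrite <- !Cexp_plus. symmetry.
    apply Cexp_add_2PI. unfold expB. rewrite !minus_INR by auto.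
    destruct L as [Lr Li]. apply injective_projections; simpl; field. }
  transitivity (((RtoC (sqrt (INR N)) * z) ^ M * (- Ci * / z) ^ (M - n)) * (b * f u * X2 * X3 * X4))%C; [ ring | ].
  rewrite ZP. transitivity (b * f u * z ^ n * (X0 * X1 * X2 * X3 * X4))%C; [ ring | ].
  rewrite EX; ring.
Qed.

(** The converse exchange. The +i pi in the logarithm of -1/(Nu) cancels the -i pi from the base
    -Nw, and here the exponents agree exactly. *)
Lemma termB_inversion (M N n : nat) (f : C -> C) (a : R) (z u : C) : (0 < N)%nat ->
  cusp_form_star (INR M + 5 / 2) N f -> z <> 0 -> 0 < Im u -> (n <= M)%nat ->
  ((RtoC (sqrt (INR N)) * z) ^ M *
    (f (- / (RtoC (INR N) * u)) * termB M N a (- / (RtoC (INR N) * z)) (- / (RtoC (INR N) * u)) (M - n))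
    * / (RtoC (INR N) * (u * u)))%C
  = ((- Ci) ^ M * (f u * termA M N a z u n))%C.
Proof.
  intros HN Hf Hz Hu Hn.
  assert (PN : 0 < INR N) by (apply lt_0_INR; auto).
  assert (NN : RtoC (INR N) <> 0) by (intros E; apply RtoC_inj in E; lra).
  rewrite (cusp_inversion _ N f HN Hf u Hu).
  unfold termA, termB, coefA, coefB. rewrite (proj2 (logH_inv (INR N) u PN Hu)), binom_sym' by auto.
  replace (Ci * - / (RtoC (INR N) * z))%C with (- Ci * / RtoC (INR N) * / z)%C by (field; auto).
  rewrite (inv_Nsqr_Cexp (INR N) u PN Hu), Cdiv_Rpower, cpow_Ci.
  rewrite (Cpow_mult_l (Ci * RtoC (INR N)) z n), (Cpow_mult_l Ci (RtoC (INR N)) n), Ci_pow_Cexp.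
  rewrite (RtoC_pow_Cexp (INR N) n PN), (Copp_Ci_pow_Cexp M).
  set (b := RtoC (binom _ _)). set (l := ln (INR N)). set (L := logH u).
  assert (ZP := pow_inversion M n (RtoC (sqrt (INR N))) (- Ci * / RtoC (INR N)) z Hn Hz).
  rewrite (Cpow_mult_l (- Ci) (/ RtoC (INR N)) (M - n)) in ZP.
  rewrite (sqrt_pow_Cexp (INR N) M PN), (Copp_Ci_pow_Cexp (M - n)), (RtoC_inv_pow_Cexp (INR N) (M - n) PN) in ZP.
  fold l in ZP.
  match goal with |- (_ * (?x2 * _ * (?x3 * ?x4 * (_ * _) * ?x5)) * ?x6)%C =
      (?y1 * (_ * (_ * (?y2 * ?y3 * _) * ?y4)))%C =>
    set (X2 := x2); set (X3 := x3); set (X4 := x4); set (X5 := x5); set (X6 := x6);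
    set (Y1 := y1); set (Y2 := y2); set (Y3 := y3); set (Y4 := y4) end.
  match type of ZP with _ = (?x0 * (?x1 * ?x7) * _)%C =>
    set (X0 := x0) in ZP; set (X1 := x1) in ZP; set (X7 := x7) in ZP end.
  assert (EX : (X0 * X1 * X7 * X2 * X3 * X4 * X5 * X6)%C = (Y1 * Y2 * Y3 * Y4)%C).
  { unfold X0, X1, X2, X3, X4, X5, X6, X7, Y1, Y2, Y3, Y4. rewrite <- !Cexp_plus. f_equal.
    unfold expB. rewrite !minus_INR by auto.
    destruct L as [Lr Li]. apply injective_projections; simpl; field. }
  transitivity (((RtoC (sqrt (INR N)) * z) ^ M * (- Ci * / RtoC (INR N) * / z) ^ (M - n)) *
     (b * f u * X2 * X3 * X4 * X5 * X6))%C; [ ring | ].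
  rewrite ZP. transitivity (b * f u * z ^ n * (X0 * X1 * X7 * X2 * X3 * X4 * X5 * X6))%C; [ ring | ].
  rewrite EX; ring.
Qed.

(** Reversing the order of summation aligns the index M - n on the left with n on the right; the two
    families then trade places term by term. *)
Lemma Psi_inversion (M N : nat) (f : C -> C) (a : R) (z u : C) : (0 < N)%nat ->
  cusp_form_star (INR M + 5 / 2) N f -> z <> 0 -> 0 < Im u ->
  let z' := (- / (RtoC (INR N) * z))%C in let v := (- / (RtoC (INR N) * u))%C in
  ((RtoC (sqrt (INR N)) * z) ^ M * (f v * Phi M N a z' v) * / (RtoC (INR N) * (u * u)))%C
  = ((- Ci) ^ M * (f u * Phi M N a z u))%C.
Proof.
  intros HN Hf Hz Hu z' v.
  assert (PN : 0 < INR N) by (apply lt_0_INR; auto).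
  assert (Hv : 0 < Im v) by (apply logH_inv; auto).
  rewrite !Phi_upper, Csum_rev by auto.
  set (X := ((RtoC (sqrt (INR N)) * z) ^ M)%C). set (Y := (/ (RtoC (INR N) * (u * u)))%C).
  match goal with |- (X * (f v * ?S) * Y)%C = (?m * (?fu * ?T))%C =>
    transitivity (X * f v * Y * S)%C; [ ring | transitivity (m * fu * T)%C; [ | ring ] ] end.
  rewrite !Csum_scal. apply Csum_ext; intros n Hn.
  assert (EA := termA_inversion M N n f a z u HN Hf Hz Hu Hn).
  assert (EB := termB_inversion M N n f a z u HN Hf Hz Hu Hn).
  fold z' v X Y in EA, EB.
  transitivity (X * (f v * termA M N a z' v (M - n)) * Y + X * (f v * termB M N a z' v (M - n)) * Y)%C; [ ring | ].
  rewrite EA, EB; ring.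
Qed.

(** * The period integrals as limits of primitives, and their inversion *)

Lemma Ci_mult_R (t : R) : (Ci * RtoC t)%C = (0, t).
Proof. apply injective_projections; simpl; ring. Qed.

Lemma Ci_sqr : (Ci * Ci = -1)%C.
Proof. apply injective_projections; simpl; ring. Qed.

Lemma ccts_upper (g : C -> C) (p : R -> C) (t l : R) (v : C) : cder p t v -> (exists d, hol g (p t) d) ->
  ccts (fun s => g (p s)) t.
Proof.
  intros Hp [d Hd]; apply (cts_ccts g p); [ eapply cder_ccts; exact Hp | eapply hol_cts; exact Hd ].
Qed.

(** The derivative of t |-> G(it) carries a factor i = dw/dt, which [Pa] places in front of the
    integral instead; the factor -i in the proof removes it. The limit at 0 is left as a hypothesis
    because it comes from the inversion. *)
Lemma Pa_value (M N : nat) (f : C -> C) (a : R) (z : C) (G : C -> C) (l0 l1 : C) :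
  strip_decay (fun w => f w * Phi M N a z w)%C ->
  (forall w, 0 < Im w -> hol G w (f w * Phi M N a z w)%C) ->
  lim_zero (fun t => G (0, t)) l0 -> lim_inf (fun t => G (0, t)) l1 ->
  Pa M N f a z = (l1 - l0)%C.
Proof.
  intros [D _] HG H0 H1.
  set (g := fun w => (f w * Phi M N a z w)%C).
  assert (Q : mint (fun t => g (0, t) * Ci)%C (l1 - l0)%C).
  { exists (fun t => G (0, t)), l0, l1. split; [ | split; [ | auto ] ].
    - intros t Ht. apply (cder_hol G (fun t => (0, t))); [ apply cder_vert | apply HG; simpl; auto ].
    - intros t Ht. apply ccts_mult; [ | apply ccts_const ].
      apply (ccts_upper g (fun t => (0, t)) t 0 Ci); [ apply cder_vert | apply D; simpl; auto ]. }
  unfold Pa. rewrite (mint_CInt _ (- Ci * (l1 - l0))%C).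
  - replace (Ci * (- Ci * (l1 - l0)))%C with (- (Ci * Ci) * (l1 - l0))%C by ring. rewrite Ci_sqr; ring.
  - apply (mint_ext (fun t => - Ci * (g (0, t) * Ci))%C); [ | apply mint_scal; exact Q ].
    intros t _. cbv zeta. rewrite Ci_mult_R. unfold g.
    replace (- Ci * (f (0, t) * Phi M N a z (0, t) * Ci))%C
      with (- (Ci * Ci) * (f (0, t) * Phi M N a z (0, t)))%C by ring.
    rewrite Ci_sqr; ring.
Qed.

(** The lower end z is an interior point, so the limit there is just the continuity of [G]; at the
    upper end the limit is taken along the vertical line through z. *)
Lemma Fa_value (M N : nat) (f : C -> C) (a : R) (z : C) (G : C -> C) (L : C) : 0 < Im z ->
  strip_decay (fun w => f w * Phi M N a z w)%C ->
  (forall w, 0 < Im w -> hol G w (f w * Phi M N a z w)%C) ->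
  (forall x, lim_inf (fun t => G (x, t)) L) ->
  Fa M N f a z = (L - G z)%C.
Proof.
  intros Hz [D _] HG HL.
  set (g := fun w => (f w * Phi M N a z w)%C).
  assert (Cl : forall t, cder (fun t => z + Ci * RtoC t)%C t Ci) by (intros; apply cder_line).
  assert (Ip : forall t, 0 < t -> 0 < Im (z + Ci * RtoC t)%C).
  { intros t Ht; rewrite Ci_mult_R. change (0 < Im z + t). lra. }
  assert (Q : mint (fun t => g (z + Ci * RtoC t) * Ci)%C (L - G z)%C).
  { exists (fun t => G (z + Ci * RtoC t)%C), (G z), L. split; [ | split; [ | split; [ | split; [ | auto ] ] ] ].
    - intros t Ht. apply (cder_hol G (fun t => z + Ci * RtoC t)%C); [ apply Cl | apply HG; auto ].
    - intros t Ht. apply ccts_mult; [ | apply ccts_const ].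
      apply (ccts_upper g (fun t => z + Ci * RtoC t)%C t 0 Ci); [ apply Cl | apply D; auto ].
    - intros e He. destruct (hol_cts _ _ _ (HG z Hz) e He) as [d [Hd K]].
      exists d; split; auto. intros t Ht. apply K.
      replace (z + Ci * RtoC t - z)%C with (Ci * RtoC t)%C by ring.
      rewrite Cmod_mult, Cmod_Ci, Cmod_R, Rabs_pos_eq; lra.
    - intros e He. destruct (HL (Re z) e He) as [T HT]. exists T; intros t Ht.
      replace (z + Ci * RtoC t)%C with (Re z, Im z + t).
      + apply HT; lra.
      + rewrite Ci_mult_R. apply injective_projections; simpl; unfold Re, Im; ring. }
  unfold Fa. rewrite (mint_CInt _ (- Ci * (L - G z))%C).
  - replace (Ci * (- Ci * (L - G z)))%C with (- (Ci * Ci) * (L - G z))%C by ring. rewrite Ci_sqr; ring.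
  - apply (mint_ext (fun t => - Ci * (g (z + Ci * RtoC t) * Ci))%C); [ | apply mint_scal; exact Q ].
    intros t _. cbv zeta. unfold g.
    set (w := (z + Ci * RtoC t)%C).
    replace (- Ci * (f w * Phi M N a z w * Ci))%C with (- (Ci * Ci) * (f w * Phi M N a z w))%C by ring.
    rewrite Ci_sqr; ring.
Qed.

Lemma lim_zero_scaled_inv (G : R -> C) (N : R) (L : C) : 0 < N ->
  lim_inf G L -> lim_zero (fun t => G (/ (N * t))) L.
Proof.
  intros HN H. apply (lim_zero_inv (fun t => G (/ (N * t)))). intros e He.
  destruct (H e He) as [T HT]. exists (Rmax 1 (N * T)). intros t Ht.
  assert (Q1 := Rmax_l 1 (N * T)). assert (Q2 := Rmax_r 1 (N * T)).
  replace (/ (N * / t)) with (t / N) by (field; lra). apply HT.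
  apply (Rmult_lt_reg_l N); auto. replace (N * (t / N)) with t by (field; lra). lra.
Qed.

Lemma lim_zero_affine (G : R -> C) (p q L : C) : lim_zero G L ->
  lim_zero (fun t => p * G t + q)%C (p * L + q)%C.
Proof.
  intros H.
  assert (K : lim_zero (fun _ => RtoC 1) 1).
  { intros e He; exists 1; split; [ lra | intros; replace (1 - 1)%C with (RtoC 0) by ring; rewrite Cmod_0; auto ]. }
  assert (Q := proj1 (lim_plus_lin G (fun _ => RtoC 1) p q L 1) H K).
  intros e He; destruct (Q e He) as [d [Hd Kd]]; exists d; split; auto; intros t Ht.
  replace (p * G t + q - (p * L + q))%C with (p * G t + q * 1 - (p * L + q * 1))%C by ring. auto.
Qed.

Lemma lim_zero_ext (G H : R -> C) (L : C) : (forall t, 0 < t -> G t = H t) -> lim_zero G L -> lim_zero H L.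
Proof.
  intros E K e He; destruct (K e He) as [d [Hd Kd]]; exists d; split; auto; intros t Ht.
  rewrite <- E by lra; auto.
Qed.

(* G is a primitive of f Phi(z,.), G' one of f Phi(z',.); by Psi_inversion the function
   (sqrt N z)^M G'(-1/(N u)) - (-i)^M G u is constant, which relates their limits at 0 and i oo. *)
Lemma period_inversion (M N : nat) (f : C -> C) (a : R) (z : C) : (0 < N)%nat ->
  cusp_form_star (INR M + 5 / 2) N f -> 0 < Im z ->
  let z' := (- / (RtoC (INR N) * z))%C in
  let s := ((RtoC (sqrt (INR N)) * z) ^ M)%C in
  (s * Fa M N f a z' = (- Ci) ^ M * (Fa M N f a z - Pa M N f a z))%C /\
  (s * Pa M N f a z' = - ((- Ci) ^ M * Pa M N f a z))%C.
Proof.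
  intros HN Hf Hz z' s.
  assert (PN : 0 < INR N) by (apply lt_0_INR; auto).
  assert (NN : RtoC (INR N) <> 0) by (intros E; apply RtoC_inj in E; lra).
  assert (Nz := Im_pos_neq0 z Hz).
  assert (Hz' : 0 < Im z') by (apply logH_inv; auto).
  assert (S0 : 0 < sqrt (INR N)) by (apply sqrt_lt_R0; auto).
  assert (Ns : s <> 0).
  { apply Cpow_nz, Cmult_neq_0; auto. intros E; apply RtoC_inj in E; lra. }
  set (m := ((- Ci) ^ M)%C).
  assert (Nm : m <> 0).
  { apply Cpow_nz. intros E; apply Ci_neq0. replace Ci with (- - Ci)%C by ring. rewrite E; ring. }
  assert (D := strip_decay_Psi M N f a z HN Hf). assert (D' := strip_decay_Psi M N f a z' HN Hf).
  destruct (holo_primitive 0 _ (proj1 D)) as [G HG].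
  destruct (holo_primitive 0 _ (proj1 D')) as [G' HG'].
  destruct (strip_decay_limit _ G D HG) as [L HL].
  destruct (strip_decay_limit _ G' D' HG') as [L' HL'].
  assert (Hc : forall v w, 0 < Im v -> 0 < Im w ->
     (s * G' (- / (RtoC (INR N) * w)) - m * G w)%C = (s * G' (- / (RtoC (INR N) * v)) - m * G v)%C).
  { apply (hol_const_upper (fun u => s * G' (- / (RtoC (INR N) * u)) - m * G u)%C).
    intros u Hu. assert (Nu := Im_pos_neq0 u Hu).
    eapply hol_eq.
    - apply hol_minus; [ apply hol_scal | apply hol_scal, HG; auto ].
      apply (hol_comp G' (fun u => - / (RtoC (INR N) * u))%C).
      + apply (hol_ext_loc (fun u => -1 * / (RtoC (INR N) * u))%C) with (r := 1); [ lra | intros; ring | ].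
        apply hol_scal. apply (hol_comp Cinv (fun u => RtoC (INR N) * u)%C).
        * apply hol_scal, hol_id.
        * apply hol_inv, Cmult_neq_0; auto.
      + apply HG', logH_inv; auto.
    - assert (E := Psi_inversion M N f a z u HN Hf Nz Hu). cbv zeta in E. fold z' s m in E.
      rewrite <- E. field; auto. }
  (* The base point i is arbitrary. The constant cancels in both conclusions, since each is a
     difference of values of primitives. *)
  set (c := (s * G' (- / (RtoC (INR N) * Ci)) - m * G Ci)%C).
  assert (HC : forall w, 0 < Im w -> (s * G' (- / (RtoC (INR N) * w)))%C = (m * G w + c)%C).
  { intros w Hw. assert (E := Hc Ci w ltac:(simpl; lra) Hw). unfold c; rewrite <- E; ring. }
  assert (Iv : forall t, 0 < t -> (- / (RtoC (INR N) * (0, t)))%C = (0, / (INR N * t))).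
  { intros t Ht; apply injective_projections; simpl; field; lra. }
  assert (Pt : forall t, 0 < t -> 0 < / (INR N * t)).
  { intros t Ht; apply Rinv_0_lt_compat, Rmult_lt_0_compat; auto. }
  (* As t tends to 0, the point -1/(N i t) goes up the imaginary axis, where G' tends to L'. *)
  assert (Z0 : lim_zero (fun t => G (0, t)) (s / m * L' + - c / m)%C).
  { apply (lim_zero_ext (fun t => s / m * G' (0, / (INR N * t))%R + - c / m)%C).
    - intros t Ht. assert (E := HC (0, t) Ht). rewrite Iv in E by auto.
      replace (s / m * G' (0, / (INR N * t))%R)%C with (s * G' (0, / (INR N * t))%R * / m)%C by (field; auto).
      rewrite E. field; auto.
    - apply (lim_zero_affine (fun t => G' (0, / (INR N * t))%R)).
      apply (lim_zero_scaled_inv (fun t => G' (0, t))); auto. }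
  assert (Z0' : lim_zero (fun t => G' (0, t)) (m / s * L + c / s)%C).
  { apply (lim_zero_ext (fun t => m / s * G (0, / (INR N * t))%R + c / s)%C).
    - intros t Ht. assert (E := HC (0, / (INR N * t)) (Pt t Ht)). rewrite Iv in E by auto.
      replace (/ (INR N * / (INR N * t))) with t in E by (field; lra).
      replace (G' (0, t)) with (/ s * (s * G' (0, t)))%C by (field; auto).
      rewrite E. field; auto.
    - apply (lim_zero_affine (fun t => G (0, / (INR N * t))%R)).
      apply (lim_zero_scaled_inv (fun t => G (0, t))); auto. }
  rewrite (Pa_value M N f a z G _ L D HG Z0 (HL 0)), (Pa_value M N f a z' G' _ L' D' HG' Z0' (HL' 0)).
  rewrite (Fa_value M N f a z G L Hz D HG HL), (Fa_value M N f a z' G' L' Hz' D' HG' HL').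
  (* At w = z the inverted point is z', so this relates the two values that occur at the lower ends
     in F_a(z') and F_a(z). *)
  assert (Ez := HC z Hz). fold z' in Ez.
  split.
  - replace (s * (L' - G' z'))%C with (s * L' - s * G' z')%C by ring. rewrite Ez. field; auto.
  - field; auto.
Qed.

(** * Characters, termwise integration and conclusion *)

Lemma Ci_pow_cancel (M : nat) : (Ci ^ M * (- Ci) ^ M)%C = 1.
Proof.
  rewrite <- Cpow_mult_l. replace (Ci * - Ci)%C with (- (Ci * Ci))%C by ring.
  rewrite Ci_sqr. replace (- -1)%C with (RtoC 1) by ring. apply Cpow_1_l.
Qed.

Lemma Cconj_Cexp (w : C) : Cconj (Cexp w) = Cexp (Cconj w).
Proof.
  unfold Cconj, Cexp; simpl. unfold Re, Im; simpl. rewrite cos_neg, sin_neg. f_equal; ring.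
Qed.

(** The identity is idempotent, and a nonzero idempotent of C is 1. *)
Lemma character_I2 (N : nat) (chi : Mat -> C) : is_character N chi -> chi I2 = 1.
Proof.
  intros [H1 H2].
  assert (HI : in_Gamma0star N I2).
  { apply G0s_base. exists 1%Z, 0%Z, 0%Z, 1%Z. repeat split; auto. apply Z.divide_0_r. }
  assert (E := H1 I2 I2 HI HI). assert (N2 := H2 I2 HI).
  replace (mmul I2 I2) with I2 in E.
  - replace (chi I2) with (chi I2 * chi I2 * / chi I2)%C by (field; auto). rewrite <- E. field; auto.
  - unfold mmul, I2, mk, ma, mb, mc, md; simpl. f_equal; [ f_equal; [ f_equal | ] | ]; ring.
Qed.

Lemma logH_vert (t : R) : 0 < t -> logH (0, t) = (RtoC (ln t) + Ci * RtoC (PI / 2))%C.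
Proof.
  intros Ht; unfold logH. replace (Cmod (0, t)) with t.
  - simpl. unfold Rdiv at 2; rewrite Rmult_0_l, atan_0. apply injective_projections; simpl; ring.
  - unfold Cmod; simpl. replace (0 * (0 * 1) + t * (t * 1)) with (t * t) by ring.
    symmetry; apply sqrt_square; lra.
Qed.

(** Extends the integral representation of Lambda from large s to every real s, which the arguments
    in (ii) need. *)
Lemma Lambda_mint (k : R) (N : nat) (f Lam : C -> C) : (0 < N)%nat -> cusp_form_star k N f ->
  is_Lambda f Lam -> forall s : R, mint (fun t => f (0, t) * RtoC (Rpower t (s - 1)))%C (Lam (RtoC s)).
Proof.
  intros HN Hf [HL [s0 HI]].
  apply (mellin_continuation (fun t => f (0, t))) with (s0 := s0).
  - intros t Ht. apply (ccts_upper f (fun t => (0, t)) t 0 Ci); [ apply cder_vert | apply (cusp_hol k N f Hf); auto ].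
  - apply (cusp_bound k N f HN Hf).
  - intros s; apply hol_of_ex_derive, HL.
  - intros s Hs. rewrite <- (CInt0inf_of_RInt_gen _ _ (HI s Hs)).
    unfold CInt0inf; f_equal; f_equal; apply functional_extensionality;
      intros t; rewrite Ci_mult_R; reflexivity.
Qed.

Lemma Pa_formula (M N : nat) (f Lam : C -> C) (a : R) (z : C) : (0 < N)%nat ->
  cusp_form_star (INR M + 5 / 2) N f -> is_Lambda f Lam ->
  let k := INR M + 5 / 2 in
  Pa M N f a z =
  Cmult (cpow Ci (RtoC (a + 1)))
    (Csum M (fun n =>
       Cmult
         (Cplus
            (Cmult (RtoC (binom (k - 2) (INR n) * INR N ^ n))
                   (Lam (RtoC (a + 1 - INR n))))
            (Cmult (Cmult (RtoC (binom (k - 2) (INR n + 1 / 2)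
                                 * Rpower (INR N) (2 * k - a - INR n - 19 / 4)))
                          (cpow Ci (RtoC (2 * INR n - k + 1 / 2))))
                   (Lam (RtoC (2 * k - 7 / 2 - a - INR n)))))
         (Cpow z n))).
Proof.
  intros HN Hf HLam k.
  assert (PN : 0 < INR N) by (apply lt_0_INR; auto).
  assert (HM := Lambda_mint _ N f Lam HN Hf HLam).
  (* On the imaginary axis log(it) = ln t + i pi/2 and log(-N i t) = ln N + ln t - i pi/2. So [p n]
     and [q n] collect all that does not depend on t, leaving real powers t^(s - 1) with s the
     argument of Lambda. *)
  set (p := fun n => (coefA M N n z * Cexp (RtoC (a - INR n) * (Ci * RtoC (PI / 2))))%C).
  set (q := fun n => (coefB M N n z * Cexp (RtoC (expB M a n) * (RtoC (ln (INR N)) - Ci * RtoC (PI / 2))))%C).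
  assert (Q : mint (fun t => Csum M (fun n =>
       p n * (f (0, t) * RtoC (Rpower t (a + 1 - INR n - 1))) +
       q n * (f (0, t) * RtoC (Rpower t (2 * k - 7 / 2 - a - INR n - 1))))%C)
     (Csum M (fun n => p n * Lam (RtoC (a + 1 - INR n)) + q n * Lam (RtoC (2 * k - 7 / 2 - a - INR n)))%C)).
  { apply (mint_sum (fun n t => _)). intros n _. apply mint_lin; apply HM. }
  unfold Pa. rewrite (mint_CInt _ (Csum M (fun n => p n * Lam (RtoC (a + 1 - INR n)) +
     q n * Lam (RtoC (2 * k - 7 / 2 - a - INR n)))%C)).
  2: { revert Q; apply mint_ext. intros t Ht. cbv zeta. rewrite Ci_mult_R, Phi_upper, Csum_scal by auto.
       apply Csum_ext; intros n _. unfold termA, termB, p, q. rewrite logH_vert by auto.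
       assert (R1 : forall x : R, RtoC (Rpower t x) = Cexp (RtoC x * RtoC (ln t))).
       { intros x; rewrite <- RtoC_mult, Cexp_R; reflexivity. }
       rewrite !R1.
       replace (RtoC (a - INR n) * (RtoC (ln t) + Ci * RtoC (PI / 2)))%C with
         (RtoC (a - INR n) * (Ci * RtoC (PI / 2)) + RtoC (a + 1 - INR n - 1) * RtoC (ln t))%C.
       2: { apply injective_projections; simpl; ring. }
       replace (RtoC (expB M a n) * (RtoC (ln (INR N)) + (RtoC (ln t) + Ci * RtoC (PI / 2)) - Ci * RtoC PI))%C with
         (RtoC (expB M a n) * (RtoC (ln (INR N)) - Ci * RtoC (PI / 2)) +
          RtoC (2 * k - 7 / 2 - a - INR n - 1) * RtoC (ln t))%C.
       2: { unfold expB, k; apply injective_projections; simpl; field. }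
       rewrite !Cexp_plus. ring. }
  rewrite !Csum_scal. apply Csum_ext; intros n _.
  unfold p, q, coefA, coefB. rewrite !cpow_Ci, Cdiv_Rpower, !RtoC_mult, RtoC_pow.
  rewrite !Cpow_mult_l, Ci_pow_Cexp.
  fold k.
  set (b := RtoC (binom (k - 2) (INR n))). set (b' := RtoC (binom (k - 2) (INR n + 1 / 2))).
  assert (R1 : forall x : R, RtoC (Rpower (INR N) x) = Cexp (RtoC x * RtoC (ln (INR N)))).
  { intros x; rewrite <- RtoC_mult, Cexp_R; reflexivity. }
  rewrite R1. set (l := ln (INR N)).
  set (L1 := Lam _). set (L2 := Lam _).
  set (I1 := (Ci * RtoC (PI / 2))%C).
  assert (EA : (Ci * (Cexp (RtoC (INR n) * I1) * Cexp (RtoC (a - INR n) * I1)))%C = Cexp (RtoC (a + 1) * I1)).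
  { rewrite <- Cexp_PI2 at 1. fold I1. rewrite <- !Cexp_plus. f_equal.
    unfold I1; apply injective_projections; simpl; ring. }
  (* The exponent of i on the left is a + 2n - k + 11/2, larger by 4 than on the right, hence the
     correction by 2 pi i. The exponent 2k - a - n - 19/4 of N is that of the second family minus
     1/4. *)
  assert (EB : (Ci * (Cexp (RtoC k * I1) * Cexp (- (RtoC (1 / 4) * RtoC l)) * Cexp (RtoC (INR n) * I1) *
      Cexp (RtoC (expB M a n) * (RtoC l - I1))))%C
     = (Cexp (RtoC (a + 1) * I1) * (Cexp (RtoC (2 * k - a - INR n - 19 / 4) * RtoC l) *
         Cexp (RtoC (2 * INR n - k + 1 / 2) * I1)))%C).
  { rewrite <- Cexp_PI2 at 1. fold I1. rewrite <- !Cexp_plus. apply Cexp_add_2PI.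
    unfold expB, k, I1; apply injective_projections; simpl; field. }
  match goal with |- _ = ?r => transitivity
    (Cexp (RtoC (a + 1) * I1) * (b * RtoC (INR N) ^ n * L1 * z ^ n) +
     (Cexp (RtoC (a + 1) * I1) * (Cexp (RtoC (2 * k - a - INR n - 19 / 4) * RtoC l) *
         Cexp (RtoC (2 * INR n - k + 1 / 2) * I1))) * (b' * L2 * z ^ n))%C end; [ | ring ].
  rewrite <- EB, <- EA. ring.
Qed.

(* k = M + 5/2 with M >= 1 (i.e. k in 1/2 + Z, k > 5/2); weight 5/2 - k = -M *)
Theorem theorem3p1 (M N : nat) (f : C -> C) (Lam : C -> C) (a : R) :
  let k := INR M + 5 / 2 in
  (0 < M)%nat -> (0 < N)%nat -> Nat.divide 4 N ->
  cusp_form_star k N f ->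
  is_Lambda f Lam ->
  0 <= a <= 2 * k - 9 / 2 ->
  (* (i) *)
  (forall z, in_H z ->
     Cplus (Copp (Cmult (Cpow Ci M) (slash_int (- Z.of_nat M) (WN N) (Fa M N f a) z)))
           (Fa M N f a z)
     = Pa M N f a z) /\
  (forall chi : Mat -> C, is_character N chi ->
     chi (WN N) = cpow Ci (RtoC (5 / 2 - k)) ->
     forall z, in_H z ->
       Cplus (slash_chi chi (- Z.of_nat M) (WN N) (Pa M N f a) z)
             (slash_chi chi (- Z.of_nat M) I2 (Pa M N f a) z) = RtoC 0) /\
  (Nat.divide 4 M ->
     forall z, in_H z ->
       Cplus (slash_int (- Z.of_nat M) (WN N) (Pa M N f a) z)
             (slash_int (- Z.of_nat M) I2 (Pa M N f a) z) = RtoC 0) /\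
  (* (ii) *)
  (forall z : C,
     Pa M N f a z =
     Cmult (cpow Ci (RtoC (a + 1)))
       (Csum M (fun n =>
          Cmult
            (Cplus
               (Cmult (RtoC (binom (k - 2) (INR n) * INR N ^ n))
                      (Lam (RtoC (a + 1 - INR n))))
               (Cmult (Cmult (RtoC (binom (k - 2) (INR n + 1 / 2)
                                    * Rpower (INR N) (2 * k - a - INR n - 19 / 4)))
                             (cpow Ci (RtoC (2 * INR n - k + 1 / 2))))
                      (Lam (RtoC (2 * k - 7 / 2 - a - INR n)))))
            (Cpow z n)))).
Proof.
  intros k _ HN _ Hf HLam _.
  split; [ | split; [ | split ] ].
  - intros z Hz. rewrite slash_int_WN by (auto; apply Im_pos_neq0; exact Hz).
    rewrite (proj1 (period_inversion M N f a z HN Hf Hz)), Cmult_assoc, Ci_pow_cancel. ring.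
  - intros chi Hchi HW z Hz. unfold slash_chi.
    rewrite slash_int_WN, slash_int_I2 by (auto; apply Im_pos_neq0; exact Hz).
    rewrite (proj2 (period_inversion M N f a z HN Hf Hz)), (character_I2 N chi Hchi), HW.
    rewrite cpow_Ci, Cconj_Cexp.
    (* As 5/2 - k = -M, the value of chi at W_N is i^(-M), and the conjugation in the twisted action
       turns it into i^M, which cancels the factor (-i)^M of the inversion. *)
    replace (Cconj (RtoC (5 / 2 - k) * (Ci * RtoC (PI / 2)))) with (RtoC (INR M) * (Ci * RtoC (PI / 2)))%C.
    2: { unfold k; apply injective_projections; simpl; field. }
    rewrite <- Ci_pow_Cexp.
    replace (Cconj 1) with (RtoC 1) by (apply injective_projections; simpl; ring).
    replace (Ci ^ M * - ((- Ci) ^ M * Pa M N f a z) + 1 * Pa M N f a z)%C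
      with (- (Ci ^ M * (- Ci) ^ M) * Pa M N f a z + Pa M N f a z)%C by ring.
    rewrite Ci_pow_cancel; ring.
  - intros [j Hj] z Hz.
    rewrite slash_int_WN, slash_int_I2 by (auto; apply Im_pos_neq0; exact Hz).
    rewrite (proj2 (period_inversion M N f a z HN Hf Hz)).
    (* Divisibility of M by 4 makes the factor trivial, so the untwisted action gives the same
       relation. *)
    replace ((- Ci) ^ M)%C with (RtoC 1); [ ring | ].
    rewrite Hj, Nat.mul_comm, Cpow_mult_r.
    replace ((- Ci) ^ 4)%C with ((Ci * Ci) * (Ci * Ci))%C by ring.
    rewrite Ci_sqr. replace (-1 * -1)%C with (RtoC 1) by ring. rewrite Cpow_1_l; reflexivity.
  - intros z; apply (Pa_formula M N f Lam a z HN Hf HLam).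
Qed.
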